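(* Let $\mathbf{w}$ be a weight in $\mathbb{R}^n$, let $\boldsymbol\theta\in\mathbb{R}^n$, and let $\mathcal{M}$ be a nondegenerate analytic manifold in $\mathbb{R}^n$. Then almost every point on $\mathcal{M}$ is not in $\mathbf{Bad}_{\boldsymbol\theta}(\mathbf{w})$.
   Context: A weight in $\mathbb{R}^n$ is a vector $\mathbf{w}=(w_1,\dots,w_n)$ with $w_i\ge 0$ and $\sum_i w_i=1$. $|x|_{\mathbb{Z}}$ is the distance from $x\in\mathbb{R}$ to the nearest integer. For $\boldsymbol\theta=(\theta_i)\in\mathbb{R}^n$, $$\mathbf{Bad}_{\boldsymbol\theta}(\mathbf{w}):=\Big\{\mathbf{x}\in\mathbb{R}^n:\ \liminf_{q\in\mathbb{Z}\setminus\{0\},\,|q|\to\infty}\ \max_{1\le i\le n}|qx_i-\theta_i|_{\mathbb{Z}}^{1/w_i}\,|q|>0\Big\},$$ with the convention $|x|_{\mathbb{Z}}^{1/w_i}:=0$ if $w_i=0$. Let $U\subset\mathbb{R}^d$ be open. A map $\mathbf{f}:U\to\mathbb{R}^n$ is $l$-nondegenerate at $\mathbf{x}\in U$ if $\mathbf{f}$ is $C^l$ on a neighbourhood of $\mathbf{x}$ in $U$ and there are $n$ linearly independent vectors among the partial derivatives of $\mathbf{f}$ at $\mathbf{x}$ of orders between $1$ and $l$. $\mathbf{f}$ is nondegenerate if there is $l$ such that $\mathbf{f}$ is $l$-nondegenerate at Lebesgue almost every $\mathbf{x}\in U$. A nondegenerate analytic manifold of dimension $d$ in $\mathbb{R}^n$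 is a submanifold (locally) parametrized by real-analytic nondegenerate maps $\mathbf{f}:U\to\mathbb{R}^n$, $U\subset\mathbb{R}^d$ open; ''almost every point on $\mathcal{M}$'' means $\mathbf{f}(\mathbf{x})$ for Lebesgue almost every $\mathbf{x}\in U$, for such parametrizations. *)

(* Defs.v *)
From HB Require Import structures.
From mathcomp Require Import all_boot all_order all_algebra.
From mathcomp Require Import all_classical all_reals all_analysis.
Set Implicit Arguments.
Unset Strict Implicit.
Unset Printing Implicit Defensive.
Import Order.TTheory GRing.Theory Num.Theory.
Import numFieldNormedType.Exports.
Local Open Scope classical_set_scope.
Local Open Scope ring_scope.

Section Bad.
Context {R : realType}.

Definition is_weight n (w : 'rV[R]_n) : Prop :=
  (forall i, 0 <= w 0 i) /\ \sum_i w 0 i = 1.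

Definition dist_int (x : R) : R := inf [set `|x - m%:~R| | m in [set: int]].

(* The test with [w 0 i == 0] is needed: [0^-1 = 0] and [0 `^ 0 = 1]. *)
Definition weighted_dist n (w theta x : 'rV[R]_n) (q : int) (i : 'I_n) : R :=
  if w 0 i == 0 then 0
  else dist_int (q%:~R * x 0 i - theta 0 i) `^ (w 0 i)^-1.

(* liminf of u(q) as |q| -> +oo over the nonzero integers; [limf_einf] cannot be
   used directly because [int] is not a [filteredType]. *)
Definition liminf_absz (u : int -> \bar R) : \bar R :=
  ereal_sup [set ereal_inf (u @` [set q | q != 0 /\ (N <= `|q|)%N])
            | N in [set: nat]].

(* The summands are nonnegative, so that starting the maximum at 0 is harmless
   (a weight only exists for [0 < n]). *)
Definition Bad n (theta w : 'rV[R]_n) : set 'rV[R]_n :=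
  [set x | (0 < liminf_absz (fun q : int =>
    ((\big[Num.max/0]_(i < n) weighted_dist w theta x q i)
       * `|q%:~R|)%:E))%E].

End Bad.

Section Lebesgue.
Context {R : realType}.

(* The library has no d-dimensional Lebesgue measure: it is built here, on the
   Borel sets of [d.-tuple R], as an iterated product. *)
Fixpoint lebesgue_tuple (d : nat) :
    set (d.-tuple (measurableTypeR R)) -> \bar R :=
  if d is d'.+1 then
    pushforward (@lebesgue_measure R \x @lebesgue_tuple d')%E
      (fun xt => cons_tuple xt.1 xt.2)
  else \d_[tuple].

Definition row_of_tuple d (t : d.-tuple (measurableTypeR R)) : 'rV[R]_d :=
  \row_i (tnth t i : R).

Definition ae_in d (U P : set 'rV[R]_d) : Prop :=
  \forall t \ae @lebesgue_tuple d, U (row_of_tuple t) -> P (row_of_tuple t).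

End Lebesgue.

Section Analytic.
Context {R : realType} (d : nat).

Definition monomial (h : 'rV[R]_d) (a : {ffun 'I_d -> nat}) : R :=
  \prod_i h 0 i ^+ a i.

(* Near x, g is the sum of an absolutely convergent power series in d
   variables. Since the convergence is absolute, the sum of the series is the
   limit of its partial sums over the multi-indices in [0, N[^d. *)
Definition real_analytic_at (g : 'rV[R]_d -> R) (x : 'rV[R]_d) : Prop :=
  exists c : {ffun 'I_d -> nat} -> R, \forall y \near x,
    summable [set: {ffun 'I_d -> nat}]
      (fun a => (c a * monomial (y - x) a)%:E) /\
    (fun N : nat => \sum_(a : {ffun 'I_d -> 'I_N})
       let a' := [ffun i => a i : nat] in c a' * monomial (y - x) a')
      @ \oo --> g y.

Context {n : nat}.
Implicit Types f : 'rV[R]_d -> 'rV[R]_n.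

Definition real_analytic (U : set 'rV[R]_d) f : Prop :=
  forall x, U x -> forall j, real_analytic_at (fun y => f y 0 j) x.

Definition partial (s : seq 'I_d) f : 'rV[R]_d -> 'rV[R]_n :=
  foldr (fun i g => 'D_(delta_mx 0 i) g) f s.

Definition C_near (l : nat) f (x : 'rV[R]_d) : Prop :=
  \forall y \near x,
    (forall s i, (size s < l)%N -> derivable (partial s f) y (delta_mx 0 i)) /\
    (forall s, (size s <= l)%N -> {for y, continuous (partial s f)}).

Definition nondegenerate_at (l : nat) f (x : 'rV[R]_d) : Prop :=
  C_near l f x /\
  exists s : 'I_n -> seq 'I_d,
    (forall k, (1 <= size (s k) <= l)%N) /\
    row_free (\matrix_(k < n) partial (s k) f x).

Definition nondegenerate (U : set 'rV[R]_d) f : Prop :=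
  exists l : nat, ae_in U (nondegenerate_at l f).

(* f parametrizes the part of M lying in some open subset of R^n. Only the
   values of f on the open set U matter. *)
Definition local_parametrization (M : set 'rV[R]_n) (U : set 'rV[R]_d) f :
    Prop :=
  [/\ open U, exists2 V : set 'rV[R]_n, open V & f @` U = M `&` V,
      real_analytic U f & nondegenerate U f].

End Analytic.

Definition nondegenerate_analytic_manifold {R : realType} (d n : nat)
    (M : set 'rV[R]_n) : Prop :=
  forall p, M p -> exists (U : set 'rV[R]_d) (f : 'rV[R]_d -> 'rV[R]_n),
    local_parametrization M U f /\ (f @` U) p.

Definition almost_every_point {R : realType} (d n : nat)
    (M P : set 'rV[R]_n) : Prop :=
  forall (U : set 'rV[R]_d) (f : 'rV[R]_d -> 'rV[R]_n),
    local_parametrization M U f -> ae_in U (fun x => P (f x)).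

(* Main.v *)
Require Import Defs.
From HB Require Import structures.
From mathcomp Require Import all_boot all_order all_algebra perm ring lra zify.
From mathcomp Require Import all_classical all_reals all_analysis measurable_realfun.
Set Implicit Arguments.
Unset Strict Implicit.
Unset Printing Implicit Defensive.
Import Order.TTheory GRing.Theory Num.Theory.
Import numFieldNormedType.Exports.
Local Open Scope classical_set_scope.
Local Open Scope ring_scope.

(** The proof works along curves and then passes to U by Fubini. It rests on quantitative
    nondivergence in the manner of Kleinbock and Margulis, a transference principle and two
    applications of Lebesgue density.

    Along a curve. Let g be a curve in R^n whose derivatives of positive order at 0 span R^n, let
    all w_i be positive, and let B be a measurable set of parameters whose images are bad with
    uniform constants. For a large P, give the coordinates tolerances of order P^(-w_i), tightened
    by a constant L in all coordinates but one, i1, of largest weight, and relaxed by L^(n-1) in i1.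
    For more than half of the parameters t the corresponding unimodular lattice has no short vector
    ([frame_nondivergence]). Transference ([covering], [lattice_point]) then yields an integer q of
    size P such that q g(t) - theta is within these tolerances of an integer vector, up to a shear
    along the tangent of g. Moving t by a distance d of order P^(-1 - w_i1) cancels the error in
    coordinate i1. Because of the shear the other errors stay small, and since w_i1 is maximal the
    move is harmless for their tolerances ([curve_hole], [hole_at_scale]). The result is a hole of B
    of size proportional to d, within distance d of t. Parameters with such holes at arbitrarily
    small scales are not density points of B, so B fills at most half of suitable small intervals
    around t0 ([half_null]), and a second use of density makes B null near 0 ([curve_null]).

    From curves to U. Fix the monomial curve gamma whose exponents separate the monomials of degree
    at most l ([curve_weight]). If f is l-nondegenerate at x, then t -> f(x + gamma(t)) is spanning
    ([spanning_curve]). Coordinates of weight 0 are dropped; they contribute 0 to the maximum that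
    defines [Bad]. The bad parameters in U are a countable union of closed sets [uniformly_bad k].
    Almost every translate of gamma meets such a set in a null set of parameters near 0, and as all
    these curves are translates of one curve, Fubini shows that the set is null ([fiber_null],
    [ae_not_Bad]). *)

Section Covering.
Context {R : realType}.

(** * Transference: short vectors of a lattice and coverings by its dual *)

Definition dot N (u v : 'rV[R]_N) : R := (u *m v^T) 0 0.

Lemma dotC N (u v : 'rV[R]_N) : dot u v = dot v u.
Proof. by rewrite /dot -[u *m v^T]trmxK trmx_mul trmxK mxE. Qed.

Lemma dotDl N (u v w : 'rV[R]_N) : dot (u + v) w = dot u w + dot v w.
Proof. by rewrite /dot mulmxDl mxE. Qed.

Lemma dotZl N a (u v : 'rV[R]_N) : dot (a *: u) v = a * dot u v.
Proof. by rewrite /dot -scalemxAl mxE. Qed.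

Lemma dotDr N (u v w : 'rV[R]_N) : dot w (u + v) = dot w u + dot w v.
Proof. by rewrite dotC dotDl !(dotC _ w). Qed.

Lemma dotZr N a (u v : 'rV[R]_N) : dot v (a *: u) = a * dot v u.
Proof. by rewrite dotC dotZl dotC. Qed.

Definition dotE := (dotDl, dotDr, dotZl, dotZr).

Lemma dot_sum N (u v : 'rV[R]_N) : dot u v = \sum_j u 0 j * v 0 j.
Proof. by rewrite /dot mxE; apply: eq_bigr => j _; rewrite mxE. Qed.

Lemma dot_ge0 N (u : 'rV[R]_N) : 0 <= dot u u.
Proof. by rewrite dot_sum sumr_ge0 // => i _; rewrite -expr2 sqr_ge0. Qed.

Lemma dot_coord N (u : 'rV[R]_N) j : `|u 0 j| ^+ 2 <= dot u u.
Proof.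
rewrite dot_sum (bigD1 j) //= real_normK ?num_real // expr2 lerDl sumr_ge0 // => i _.
by rewrite -expr2 sqr_ge0.
Qed.

Lemma round_int (x : R) : exists m : int, `|x - m%:~R| <= 2^-1.
Proof.
exists (Num.floor (x + 2^-1)).
have h1 : (Num.floor (x + 2^-1))%:~R <= x + 2^-1 by exact: floor_le.
have h2 : x + 2^-1 < (Num.floor (x + 2^-1))%:~R + 1.
  by have := floorD1_gt (x + 2^-1); rewrite intrD.
by rewrite ler_norml; apply/andP; split; lra.
Qed.

(** The Smith normal form of a single row: an integer vector is a multiple of a vector that extends
    to a basis of the lattice. *)
Lemma row_factor_unimodular k (a : 'rV[int]_k.+1) :
  exists c, exists2 U : 'M[int]_(1 + k), U \in unitmx & a = c *: usubmx U.
Proof.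
have [L _ [U Uu [d _ ->]]] := int_Smith_normal_form a.
exists (L 0 0 * d`_0); exists U => //.
rewrite {1}(mx11_scalar L) mul_scalar_mx -scalemxAl -scalerA; congr (_ *: _).
apply/rowP => j; rewrite !mxE (bigD1 0) //= mxE eqxx mulr1n.
rewrite big1 ?addr0 => [|i i0]; last first.
  by rewrite mxE [_ == _]negbTE ?mulr0n ?mul0r // eq_sym.
by congr (_ * U _ _); apply: val_inj.
Qed.

                                                                              
                                                                          
(** A lattice without short vectors has a dual with small covering radius. By induction on the rank:
    split off a nearly shortest basis vector b, solve for the lattice projected orthogonally to b,
    whose squared minimum is still at least m / 2, and correct the solution along b. *)
Lemma covering N k : exists2 K : R, 0 < K &
  forall (B : 'M[R]_(k, N)) m, 0 < m ->
  (forall a : 'rV[int]_k, a != 0 ->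
     m <= dot (map_mx intr a *m B) (map_mx intr a *m B)) ->
  forall beta : 'rV[R]_k, exists2 x : 'rV[R]_N, dot x x <= K / m &
    exists p : 'rV[int]_k, x *m B^T = beta + map_mx intr p.
Proof.
elim: k => [|k [K K0 IH]].
  exists 1 => // B m m0 _ beta; exists 0.
    by rewrite /dot mul0mx mxE divr_ge0 // ltW.
  by exists 0; apply/rowP => -[].
exists (2 * K + 1) => [|B m m0 Bm beta]; first lra.
pose nrm (a : 'rV[int]_k.+1) := dot (map_mx intr a *m B) (map_mx intr a *m B).
pose S := [set nrm a | a in [set a | a != 0]].
have S0 : S !=set0.
  exists (nrm (const_mx 1)); exists (const_mx 1) => //=.
  by apply/eqP => /rowP /(_ 0); rewrite !mxE.
have Sm : lbound S m by move=> _ [a a0 <-]; exact: Bm.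
have hS : has_inf S by split=> //; exists m.
have mS : m <= inf S by exact: lb_le_inf.
have lam0 : 0 < inf S by lra.
(* A factor below 2 is what matters: the projection below keeps a proportion 1 - (19/10) / 4 > 1/2
   of [inf S]. *)
have [_ [a a0 <-] aS] : exists2 e, S e & e < inf S + 9/10 * inf S.
  by apply: inf_adherent => //; lra.
have [c [U Uu aE]] := row_factor_unimodular a.
pose Um : 'M[R]_(1 + k) := map_mx intr U.
pose B' : 'M[R]_(1 + k, N) := Um *m B.
pose b := usubmx B'; pose C := dsubmx B'.
have B'E : B' = col_mx b C by rewrite vsubmxK.
have latt (e : 'rV[int]_(1 + k)) : e != 0 ->
    inf S <= dot (map_mx intr e *m B') (map_mx intr e *m B').
  move=> e0; rewrite /B' mulmxA /Um -map_mxM; apply: ge_inf; first exact: hS.2.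
  exists (e *m U) => //; apply: contra e0 => /eqP eU0.
  by rewrite -[e](mulmxK Uu) eU0 mul0mx.
have bE : b = map_mx intr (usubmx U) *m B 
  by apply/rowP => j; rewrite !mxE; apply: eq_bigr => i _; rewrite !mxE.
have bS : inf S <= dot b b.
  have := latt (row_mx 1%:M 0); rewrite map_row_mx map_mx1 map_mx0 B'E.
  rewrite mul_row_col mul1mx mul0mx addr0; apply.
  apply/eqP => h; have : (1%:M : 'M[int]_1) = 0.
      by rewrite -(row_mxKl 1%:M (0 : 'rV[int]_k)) h; apply/rowP => j; rewrite !mxE.
    by move/rowP/(_ 0); rewrite !mxE.
have bb0 : 0 < dot b b by lra.
have b_lt : dot b b < 19/10 * inf S.
  apply: le_lt_trans (_ : nrm a < _); last by lra.
  rewrite /nrm aE map_mxZ -scalemxAl -bE !dotE mulrA ler_peMl ?dot_ge0 //.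
  have c0 : c != 0 by apply: contra a0 => /eqP c0; rewrite aE c0 scale0r.
  rewrite -intrM -[1]/(1%:~R) ler_int -expr2.
  by move: c0; rewrite -sqrf_eq0; have := sqr_ge0 c; lia.
pose C' := C - (dot b b)^-1 *: (C *m b^T *m b).
have C'E (v : 'rV_k) : v *m C' = v *m C - (dot (v *m C) b / dot b b) *: b.
  rewrite /C' mulmxBr -scalemxAr !mulmxA; congr (_ - _).
  by rewrite [v *m C *m b^T]mx11_scalar mul_scalar_mx scalerA mulrC.
have proj0 (v : 'rV_N) : dot (v - (dot v b / dot b b) *: b) b = 0.
  by rewrite -scaleNr !dotE mulNr -mulrA mulVf ?mulr1 ?subrr // gt_eqF.
have C'm (e : 'rV[int]_k) : e != 0 ->
    m / 2 <= dot (map_mx intr e *m C') (map_mx intr e *m C').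
  move=> e0; set v := map_mx intr e *m C; set s := dot v b / dot b b.
  (* Subtracting q times b from the lattice vector leaves a component along b of at most half of
     b. *)
  have [q qs] := round_int s.
  have := latt (row_mx (- q)%:M e).
  have -> : map_mx intr (row_mx (- q)%:M e) *m B' =
      map_mx intr e *m C' + (s - q%:~R) *: b.
    rewrite map_row_mx B'E mul_row_col -/v C'E -/v -/s map_scalar_mx mul_scalar_mx.
    by rewrite rmorphN /= scalerBl scaleNr addrC addrA subrK.
  have p0 : dot (map_mx intr e *m C') b = 0 by rewrite C'E -/v proj0.
  rewrite !dotE (dotC b) p0 !mulr0 addr0 add0r => /(_ _)/wrap[].
    apply: contra e0 => /eqP h; rewrite -(row_mxKr (- q)%:M e) h.
    by apply/eqP/rowP => j; rewrite !mxE.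
  have : (s - q%:~R) ^+ 2 <= (2^-1) ^+ 2.
    by rewrite -[_ ^+ 2]real_normK ?num_real // lerXn2r ?nnegrE.
  rewrite mulrA -expr2; set z := _ ^+ 2; set D := dot (map_mx _ _ *m _) _.
  move=> hz hD; have : z * dot b b <= (2^-1) ^+ 2 * dot b b.
    by rewrite ler_wpM2r // ltW.
  by rewrite expr2; lra.
pose beta' : 'rV[R]_(1 + k) := beta *m Um^T.
have [q qs] := round_int (lsubmx beta' 0 0).
pose s := lsubmx beta' 0 0 - q%:~R.
(* The target for C is corrected in advance for the component s / |b|^2 along b, which is added to y
   at the end to meet the first congruence. *)
have [x'' x''K [p'' x''E]] := IH C' (m / 2) ltac:(lra) C'm
  (rsubmx beta' - (s / dot b b) *: (b *m C^T)).
pose y := x'' - (dot x'' b / dot b b) *: b.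
have yb : dot y b = 0 by exact: proj0.
have yC : y *m C^T = x'' *m C'^T.
  have -> : C'^T = C^T - (dot b b)^-1 *: (C *m b^T *m b)^T.
    by rewrite /C' linearB /= linearZ.
  rewrite /y mulmxBl mulmxBr -scalemxAl -scalemxAr !trmx_mul trmxK !mulmxA; congr (_ - _).
  by rewrite [x'' *m b^T]mx11_scalar mul_scalar_mx -scalemxAl scalerA mulrC.
have x''y : x'' = y + (dot x'' b / dot b b) *: b by rewrite subrK.
clearbody y; pose x := y + (s / dot b b) *: b.
have xB' : x *m B'^T = beta' + map_mx intr (row_mx (- q)%:M p'').
  rewrite B'E tr_col_mx mul_mx_row map_row_mx -[beta' in RHS]hsubmxK.
  rewrite add_row_mx; congr row_mx.
    rewrite [LHS]mx11_scalar -[(x *m _) 0 0]/(dot x b) /x !dotE yb add0r.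
    rewrite divfK ?gt_eqF // [lsubmx beta']mx11_scalar map_scalar_mx -raddfD /=.
    by rewrite rmorphN.
  rewrite /x mulmxDl yC x''E -scalemxAl.
  by rewrite addrAC subrK.
exists x.
  have x''x : dot y y <= dot x'' x''.
    rewrite x''y; move: (_ / _) => z; rewrite !dotE (dotC b) yb !mulr0 addr0 add0r lerDl.
    by rewrite mulrA -expr2 mulr_ge0 ?sqr_ge0 // ltW.
  have s2 : s ^+ 2 <= 4^-1.
    have -> : 4^-1 = (2^-1) ^+ 2 :> R by field.
    by rewrite -[_ ^+ 2]real_normK ?num_real // lerXn2r ?nnegrE.
  have xx : dot x x = dot y y + s ^+ 2 / dot b b.
    rewrite /x !dotE (dotC b) yb !mulr0 addr0 add0r; congr (_ + _).
    by field; rewrite gt_eqF.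
  have : s ^+ 2 / dot b b <= 1 / m.
    by rewrite ler_pM ?sqr_ge0 ?invr_ge0 ?lef_pV2 ?posrE //; lra.
  have : K / (m / 2) = 2 * K / m by field; rewrite gt_eqF.
  rewrite xx mulrDl; lra.
exists (row_mx (- q)%:M p'' *m (invmx U)^T).
have UmV : Um *m map_mx intr (invmx U) = 1%:M.
  by rewrite /Um -map_mxM mulmxV // map_mx1.
have -> : B = map_mx intr (invmx U) *m B'.
  by rewrite /B' mulmxA /Um -map_mxM mulVmx // map_mx1 mul1mx.
rewrite trmx_mul mulmxA xB' mulmxDl map_mxM -map_trmx; congr (_ + _).
by rewrite /beta' -mulmxA -trmx_mul -map_mxM mulVmx // map_mx1 trmx1 mulmx1.
Qed.

End Covering.

(** * Covolumes of integer sublattices and flags *)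

Section Covolume.
Context {R : realType} {m : nat}.

(** The sup norm of the exterior product of the rows, a substitute for the covolume. Maps f that are
    not injective contribute 0, and the value is 1 for k = 0. *)
Definition maxminor k (A : 'M[R]_(k, m)) : R :=
  \big[Num.max/0]_(f : {ffun 'I_k -> 'I_m}) `|\det (colsub f A)|.

Lemma maxminor_ge k (A : 'M[R]_(k, m)) (f : 'I_k -> 'I_m) :
  `|\det (colsub f A)| <= maxminor A.
Proof.
have -> : colsub f A = colsub (finfun f) A.
  by apply/matrixP => i j; rewrite !mxE ffunE.
exact: (le_bigmax _ (fun f : {ffun 'I_k -> 'I_m} => `|\det (colsub f A)|)).
Qed.

Lemma maxminor_le k (A : 'M[R]_(k, m)) c : 0 <= c ->
  (forall f : {ffun 'I_k -> 'I_m}, `|\det (colsub f A)| <= c) ->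
  maxminor A <= c.
Proof. by move=> c0 Ac; apply: bigmax_le. Qed.

Lemma maxminor_ge0 k (A : 'M[R]_(k, m)) : 0 <= maxminor A.
Proof. by apply: bigmax_ge_id. Qed.

Lemma maxminor_mulmx k (U : 'M[R]_k) (A : 'M[R]_(k, m)) :
  maxminor (U *m A) = `|\det U| * maxminor A.
Proof.
have mulE (f : {ffun 'I_k -> 'I_m}) :
    \det (colsub f (U *m A)) = \det U * \det (colsub f A).
  by rewrite -det_mulmx; congr determinant; apply/matrixP => i j; rewrite !mxE;
    apply: eq_bigr => l _; rewrite mxE.
apply/eqP; rewrite eq_le; apply/andP; split.
  apply: maxminor_le => [|f]; first by rewrite mulr_ge0 ?maxminor_ge0.
  by rewrite mulE normrM ler_wpM2l // maxminor_ge.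
have [->|U0] := eqVneq (\det U) 0; first by rewrite normr0 mul0r maxminor_ge0.
rewrite mulrC -ler_pdivlMr ?normr_gt0 //; apply: maxminor_le => [|f].
  by rewrite divr_ge0 ?maxminor_ge0.
rewrite ler_pdivlMr ?normr_gt0 // -normrM mulrC -mulE; exact: maxminor_ge.
Qed.

Lemma maxminor_col_mx k (a : 'rV[R]_m) (A : 'M[R]_(k, m)) c : 0 <= c ->
  (forall j, `|a 0 j| <= c) ->
  maxminor (col_mx a A) <= k.+1%:R * c * maxminor A.
Proof.
move=> c0 ac; apply: maxminor_le => [|f].
  by rewrite !mulr_ge0 ?maxminor_ge0 ?ler0n.
rewrite (expand_det_row _ ord0) (le_trans (ler_norm_sum _ _ _)) //.
apply: (@le_trans _ _ (\sum_(j < k.+1) c * maxminor A)); last first.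
  by rewrite sumr_const card_ord -mulrA mulr_natl.
apply: ler_sum => j _; rewrite normrM ler_pM //.
  by rewrite !mxE; case: splitP => l //= _; rewrite ord1.
rewrite /cofactor normrM normrX normrN1 expr1n mul1r.
rewrite (_ : row' ord0 _ = colsub (fun l : 'I_k => f (lift j l : 'I_(1 + k))) A) ?maxminor_ge //.
apply/matrixP => i l; rewrite !mxE.
case: splitP => l' /= h; first by have := ltn_ord l'; rewrite -h.
by congr (A _ _); apply: val_inj => /=; move: h; rewrite /bump /= => -[].
Qed.

Definition realmx k (A : 'M[int]_(k, m)) : 'M[R]_(k, m) := map_mx intr A.

(** For integer rows this means that they extend to a basis of the integer lattice. *)
Definition primitive k (A : 'M[int]_(k, m)) :=
  exists W : 'M[int]_(m, k), A *m W = 1%:M.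

Lemma primitive_free k (A : 'M[int]_(k, m)) : primitive A -> row_free (realmx A).
Proof.
move=> [W AW]; apply/row_freeP; exists (map_mx intr W).
by rewrite /realmx -map_mxM AW map_mx1.
Qed.

Lemma row_free_mull k (U : 'M[R]_k) (A : 'M[R]_(k, m)) :
  row_free (U *m A) -> \det U != 0.
Proof.
move=> /eqP UA; rewrite -unitfE -unitmxE -row_free_unit /row_free eqn_leq rank_leq_row.
by rewrite -{1}UA mxrankM_maxl.
Qed.

(** Put A in Smith form and replace the diagonal entries, nonzero by freeness, by 1: the first k
    rows of U remain. *)
Lemma saturate k (A : 'M[int]_(k, m)) : row_free (realmx A) ->
  exists A0 : 'M[int]_(k, m),
    [/\ primitive A0, (realmx A <= realmx A0)%MS & (realmx A0 <= realmx A)%MS].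
Proof.
move=> fA; have km : (k <= m)%N by rewrite -(eqP fA) rank_leq_col.
have [L Lu [U Uu [d _ AE]]] := int_Smith_normal_form A.
pose D : 'M[int]_k := \matrix_(i, j) (d`_i *+ (i == j :> nat)).
pose P : 'M[int]_(k, m) := pid_mx k.
have DP : \matrix_(i < k, j < m) (d`_i *+ (i == j :> nat)) = D *m P.
  apply/matrixP => i j; rewrite !mxE (bigD1 i) //= big1 ?addr0 => [|l li].
    by rewrite !mxE eqxx mulr1n ltn_ord andbT mulr_natr.
  by rewrite !mxE [_ == _]negbTE ?mul0r // eq_sym.
have AV : A = L *m D *m (P *m U) by rewrite AE DP !mulmxA.
have rAV : realmx A = map_mx intr (L *m D) *m realmx (P *m U).
  by rewrite {1}AV /realmx map_mxM.
exists (P *m U); split.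
- exists (invmx U *m P^T); rewrite mulmxA mulmxK // tr_pid_mx.
  by rewrite pid_mx_id // pid_mx_1.
- by rewrite rAV submxMl.
- rewrite -[X in (X <= _)%MS]mul1mx.
  have Vu : map_mx intr (L *m D) \in @unitmx R k.
    by rewrite unitmxE unitfE (@row_free_mull _ _ (realmx (P *m U))) // -rAV.
  by rewrite -(mulVmx Vu) -mulmxA -rAV submxMl.
Qed.

(** A = D A' with D integral, because A' has an integral right inverse, and D is nonsingular, so
    |det D| >= 1. *)
Lemma maxminor_primitive k (A A' : 'M[int]_(k, m)) (B : 'M[R]_m) :
  primitive A' -> row_free (realmx A) -> (realmx A <= realmx A')%MS ->
  maxminor (realmx A' *m B) <= maxminor (realmx A *m B).
Proof.
move=> [W AW] fA /submxP[D AD].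
have DV : D = map_mx intr (A *m W).
  by rewrite map_mxM -/(realmx A) AD -mulmxA /realmx -map_mxM AW map_mx1 mulmx1.
have : \det D != 0 by apply: (@row_free_mull _ _ (realmx A')); rewrite -AD.
rewrite AD -mulmxA maxminor_mulmx DV det_map_mx intr_eq0 => d0.
rewrite ler_peMl ?maxminor_ge0 // -intr_norm -[1]/(1%:~R) ler_int.
by move: d0; rewrite -normr_gt0; lia.
Qed.

Definition sublattice := {k : nat & 'M[int]_(k, m)}.
Implicit Types s f : sublattice.
Definition rk s : nat := projT1 s.
Definition basis s : 'M[R]_(rk s, m) := realmx (projT2 s).
Definition nested s s' := (basis s <= basis s')%MS || (basis s' <= basis s)%MS.
Definition vol (B : 'M[R]_m) s := maxminor (basis s *m B).

Lemma max_rank (F : seq sublattice) : F != [::] ->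
  exists2 s, s \in F & {in F, forall s', (rk s' <= rk s)%N}.
Proof.
elim: F => // s F IH _; have [->|/IH[s1 s1F s1max]] := eqVneq F [::].
  by exists s; rewrite ?mem_head // => s'; rewrite inE => /eqP ->.
have [h|h] := leqP (rk s) (rk s1).
  exists s1; first by rewrite inE s1F orbT.
  by move=> s'; rewrite inE => /orP[/eqP->|/s1max].
exists s; first exact: mem_head.
move=> s'; rewrite inE => /orP[/eqP->//|/s1max h']; exact: leq_trans h' (ltnW h).
Qed.

Lemma row_free_col_mx k (a : 'rV[R]_m) (A : 'M[R]_(k, m)) :
  row_free A -> ~~ (a <= A)%MS -> row_free (col_mx a A).
Proof.
move=> fA aA; apply/inj_row_free => v.
rewrite -[v]hsubmxK mul_row_col [lsubmx v]mx11_scalar mul_scalar_mx.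
set x := lsubmx v 0 0; move=> h.
have x0 : x = 0.
  apply: contraNeq aA => x0; rewrite -(eqmx_scale _ x0).
  move/eqP: h; rewrite addr_eq0 => /eqP ->; by rewrite -mulNmx submxMl.
move: h; rewrite x0 scale0r add0r => h.
rewrite (_ : rsubmx v = 0) ?row_mx0 //.
  by rewrite raddf0 row_mx0.
by apply/eqP; rewrite -(mulmx_free_eq0 _ fA) h.
Qed.

(** Suppose that a is short. Adding a to the largest member of F that does not contain it and
    saturating gives a sublattice comparable with all of F, of covolume below delta. This
    contradicts |det B| >= 1 at full rank, the bounds on F if its rank occurs in F, and the last
    hypothesis otherwise. *)
Lemma flag_short_vector (B : 'M[R]_m) (F : seq sublattice) delta :
  0 < delta <= 1 -> 1 <= `|\det B| ->
  {in F, forall s, primitive (projT2 s) /\ delta <= vol B s <= 1} ->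
  {in F &, forall s s', nested s s'} ->
  (forall s, primitive (projT2 s) -> (0 < rk s < m)%N ->
     {in F, forall f, nested s f} -> rk s \notin map rk F -> delta <= vol B s) ->
  forall a : 'rV[int]_m, a != 0 ->
  exists j, delta / m.+1%:R <= `|(realmx a *m B) 0 j|.
Proof.
move=> /andP[d0 d1] B1 Fvol Fnest Frest a a0; apply: contrapT => /forallNP small.
(* A is the member of F of largest rank whose span does not contain a or, failing that, the zero
   lattice, whose [maxminor] is 1. *)
have [k [A [fA aA volA AF]]] : exists k (A : 'M[int]_(k, m)),
    [/\ row_free (realmx A), ~~ (realmx a <= realmx A)%MS,
      maxminor (realmx A *m B) <= 1 & {in F, forall f,
      (if (realmx a <= basis f)%MS then realmx A <= basis f
       else basis f <= realmx A)%MS}].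
  have [F0|F0] := eqVneq ([seq f <- F | ~~ (realmx a <= basis f)%MS] : seq sublattice) [::].
    exists 0%N, 0; split.
    - by rewrite /row_free -leqn0 rank_leq_row.
    - apply/negP => /submxP[D]; rewrite [realmx 0]flatmx0 mulmx0 => /matrixP h.
      by case/eqP: a0; apply/rowP => j; have /eqP := h 0 j; rewrite !mxE intr_eq0 => /eqP.
    - by apply: maxminor_le => // f; rewrite det_mx00 normr1.
    - move=> f fF; case: ifPn => [_|af]; first by rewrite [realmx 0]flatmx0 sub0mx.
      have : f \in [seq f <- F | ~~ (realmx a <= basis f)%MS] by rewrite mem_filter af.
      by rewrite F0.
  have [s] := max_rank F0; rewrite mem_filter => /andP[as_ sF] smax.
  have [/primitive_free fs /andP[_ sv]] := Fvol s sF.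
  exists (rk s), (projT2 s); split => // f fF; case: ifPn => af.
    have /orP[//|fs'] := Fnest s f sF fF.
    by rewrite (submx_trans af fs') in as_.
  have /orP[sf|//] := Fnest s f sF fF.
  have [/primitive_free ff _] := Fvol f fF.
  have := smax f; rewrite mem_filter af fF => /(_ isT) rkfs.
  have [_ <-] := mxrank_leqif_sup sf.
  by rewrite eqn_leq mxrankS //= (eqP fs) (eqP ff).
pose A1 : 'M[int]_(1 + k, m) := col_mx a A.
have A1E : realmx A1 = col_mx (realmx a) (realmx A) by exact: map_col_mx.
have fA1 : row_free (realmx A1) by rewrite A1E row_free_col_mx.
have [A' [A'p A1A' A'A1]] := saturate fA1.
have km : (1 + k <= m)%N by rewrite -(eqP fA1) rank_leq_col.
have volA' : maxminor (realmx A' *m B) < delta.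
  apply: le_lt_trans (maxminor_primitive B A'p fA1 A1A') _.
  rewrite A1E mul_col_mx; set c := delta / m.+1%:R.
  have c0 : 0 <= c by rewrite divr_ge0 // ltW.
  have /(maxminor_col_mx (realmx A *m B) c0) : forall j, `|(realmx a *m B) 0 j| <= c.
    by move=> j; have /negP := small j; rewrite -ltNge => /ltW.
  move=> /le_lt_trans; apply.
  (* The strict inequality comes from k + 1 <= m < m + 1. *)
  apply: (@le_lt_trans _ _ (k.+1%:R * c)).
    by rewrite ler_piMr // mulr_ge0.
  rewrite /c mulrCA gtr_pMr // ltr_pdivrMr ?ltr0n // mul1r ltr_nat.
  exact: leq_ltn_trans km _.
have nestA' : {in F, forall f, nested (existT _ (1 + k)%N A') f}.
  move=> f fF; rewrite /nested /basis /=; have := AF f fF; case: ifP => af Af.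
    by rewrite (submx_trans A'A1) // A1E col_mx_sub af.
  apply/orP; right; apply: submx_trans A1A'; apply: submx_trans Af _.
  by rewrite A1E -addsmxE addsmxSr.
have [km1|km1] := eqVneq (1 + k)%N m.
  move: A' A'p volA' {A1A' A'A1 nestA'}; rewrite km1 => A' A'p.
  have [W /(congr1 determinant)] := A'p; rewrite det_mulmx det1 => A'W.
  apply/negP; rewrite -leNgt; apply: le_trans d1 _.
  apply: le_trans (maxminor_ge _ id).
  rewrite (_ : colsub id _ = realmx A' *m B); last by apply/matrixP => i j; rewrite mxE.
  rewrite det_mulmx normrM det_map_mx -intr_norm mulr_ege1 //.
  rewrite -[1]/(1%:~R) ler_int.
  have : \det A' != 0 
    by apply/eqP => A'0; move: A'W => /eqP; rewrite A'0 mul0r eq_sym oner_eq0.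
  by rewrite -normr_gt0; lia.
have [/mapP[f fF rkf]|h] := boolP ((1 + k)%N \in map rk F); last first.
  have := Frest (existT _ (1 + k)%N A') A'p _ nestA' h.
  rewrite /rk /= ltn_neqAle km1 km => /(_ isT).
  by rewrite leNgt => /negP; apply.
have := nestA' f fF; have [fp /andP[fv _]] := Fvol f fF.
case: f rkf fp fv {fF} => kf f /= rkf; rewrite /rk /= in rkf; move: rkf f => <- f.
move=> fp fv fA'.
apply: (negP (_ : ~~ (delta <= maxminor (realmx f *m B)))); last exact: fv.
rewrite -ltNge; apply: le_lt_trans volA'; apply: maxminor_primitive => //.
  exact: primitive_free.
case/orP: fA' => //= ff; rewrite /basis /= in ff.
have [_ <-] := mxrank_leqif_sup ff.
by rewrite (eqP (primitive_free A'p)) (eqP (primitive_free fp)).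
Qed.

End Covolume.

(** * Quantitative nondivergence on an interval *)

Section Nondivergence.
Context {R : realType}.
Local Notation mu := (@lebesgue_measure R).

(** A variant of the (C, alpha)-good condition at a single level: on every subinterval the function
    is at least e times its supremum outside a set of relative measure eta. *)
Definition good_fun (eta e r0 : R) (f : R -> R) :=
  (forall t, -r0 <= t <= r0 -> {for t, continuous f}) /\
  forall a b, - r0 <= a -> a < b -> b <= r0 ->
  exists X : set R, [/\ measurable X, (mu X <= (eta * (b - a))%:E)%E &
    forall t, a <= t <= b -> ~ X t ->
    forall t', a <= t' <= b -> e * `|f t'| <= `|f t|].

Context (T : eqType) (rk : T -> nat) (cmp : rel T) (psi : T -> R -> R).
Context (eta0 e r0 : R).
Hypothesis eta0_le : eta0 <= 4^-1.
Hypothesis e01 : 0 < e <= 1.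
Hypothesis cmpxx : reflexive cmp.
Hypothesis cmpC : symmetric cmp.
Hypothesis psi_ge0 : forall s t, 0 <= psi s t.
Hypothesis psi_good : forall s, good_fun eta0 e r0 (psi s).

(** When an element joins the flag the threshold sigma drops to e sigma for the others, and the
    element itself may fall to e (e sigma). At 0 no rank is left, so any value would do. *)
Fixpoint margin (m : nat) (sigma : R) : R :=
  if m is m'.+1 then
    Num.min sigma (Num.min (e * (e * sigma)) (margin m' (e * sigma)))
  else 1.

Lemma margin_gt0 m sigma : 0 < sigma -> 0 < margin m sigma.
Proof.
have /andP[e0 _] := e01.
elim: m sigma => //= m IH sigma s0.
by rewrite !lt_min s0 !mulr_gt0 //= IH ?mulr_gt0.
Qed.

(** The requirements of [flag_short_vector] on a flag, at the parameter t. *)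
Definition flag_at delta (P : T -> Prop) t := exists F : seq T,
  [/\ {in F, forall s, P s}, {in F &, forall s s', cmp s s'},
      {in F, forall s, delta <= psi s t <= 1} &
      forall s, P s -> {in F, forall f, cmp s f} -> rk s \notin map rk F ->
        delta <= psi s t].

Definition rises sigma (P : T -> Prop) (a b : R) :=
  forall s, P s -> exists2 t, a <= t <= b & sigma <= psi s t.

Let itv_measure (a b : R) : a <= b -> mu `[a, b] = (b - a)%:E.
Proof.
by move=> ab; rewrite lebesgue_measure_itv /= lte_fin; case: ltgtP ab => // -> _;
  rewrite subrr.
Qed.

(** The set where psi s is below e times its supremum fills at most a quarter of [a, b], so it
    cannot contain a half of it. *)
Lemma rises_sub P sigma a b a' b' : 0 < sigma ->
  -r0 <= a -> a < b -> b <= r0 -> a <= a' -> b' <= b -> b' - a' = (b - a) / 2 ->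
  rises sigma P a b -> rises (e * sigma) P a' b'.
Proof.
move=> s0 ra ab rb aa bb h rs s Ps; have [t' t'ab st'] := rs s Ps.
have [_ /(_ a b ra ab rb) [X [mX muX Xgood]]] := psi_good s.
have [t [tab nX]] : exists t, a' <= t <= b' /\ ~ X t.
  apply: contrapT => /forallNP H.
  have : (mu `[a', b'] <= mu X)%E.
    apply: le_measure; rewrite ?inE //.
    move=> t /=; rewrite in_itv /= => tab; apply: contrapT => nX.
    exact: (H t).
  rewrite itv_measure; last by lra.
  move=> /le_trans /(_ muX); rewrite lee_fin h.
  have := ler_wpM2r (ltac:(lra) : 0 <= b - a) eta0_le; lra.
exists t => //; have := Xgood t ltac:(lra) nX t' t'ab.
rewrite !ger0_norm //; apply: le_trans; rewrite ler_wpM2l //.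
by have /andP[/ltW] := e01.
Qed.

Section Stopping.
Variables (sigma : R) (P : T -> Prop) (stop : R -> R -> set R).

Definition dips a b := exists2 s, P s & forall t, a <= t <= b -> psi s t < sigma.

(** Bisection down to depth j. A half on which some element stays below sigma is handed over to
    [stop]; the other halves are bisected again. *)
Fixpoint stopped (j : nat) (a b : R) : set R :=
  if j is j'.+1 then
    let c := (a + b) / 2 in
    (if `[< dips a c >] then stop a c else stopped j' a c) `|`
    (if `[< dips c b >] then stop c b else stopped j' c b)
  else set0.

Lemma stopped_mono j a b : stopped j a b `<=` stopped j.+1 a b.
Proof.
elim: j a b => [|j IH] a b; first by move=> ?.
move=> t; rewrite [X in X -> _]/= [X in _ -> X]/=.
by move=> [|] h; [left|right]; move: h; case: ifP => // _; apply: IH.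
Qed.

Lemma not_dips_rises a b : ~ dips a b -> rises sigma P a b.
Proof.
move=> nd s Ps; apply: contrapT => /forall2NP H; apply: nd; exists s => // t tab.
by rewrite ltNge; apply/negP => h; case: (H t).
Qed.

Hypothesis s01 : 0 < sigma <= 1.
Variables (delta eta : R).
Hypothesis delta_sigma : delta <= sigma.
Hypothesis eta_gt0 : 0 < eta.
Hypothesis stopP : forall a b, - r0 <= a -> a < b -> b <= r0 -> dips a b ->
  rises (e * sigma) P a b ->
  [/\ measurable (stop a b), (mu (stop a b) <= (eta * (b - a))%:E)%E &
    forall t, a <= t <= b -> ~ stop a b t -> flag_at delta P t].

Lemma stopped_measure j a b : - r0 <= a -> a < b -> b <= r0 ->
  rises sigma P a b ->
  measurable (stopped j a b) /\ (mu (stopped j a b) <= (eta * (b - a))%:E)%E.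
Proof.
elim: j a b => [|j IH] a b ra ab rb rs.
  change (stopped 0 a b) with (@set0 R); rewrite measure0 lee_fin.
  by split=> //; rewrite mulr_ge0 // ?(ltW eta_gt0) //; lra.
have /andP[s0 _] := s01.
have half a' b' : a <= a' -> b' <= b -> b' - a' = (b - a) / 2 ->
    let S := if `[< dips a' b' >] then stop a' b' else stopped j a' b' in
    measurable S /\ (mu S <= (eta * (b' - a'))%:E)%E.
  move=> aa bb h; case: ifPn => [/asboolP d|/asboolP nd].
    have [] // := @stopP a' b' ltac:(lra) ltac:(lra) ltac:(lra) d.
    exact: rises_sub rs.
  apply: IH; [lra|lra|lra|exact: not_dips_rises].
rewrite [stopped _ _ _]/=; set c := (a + b) / 2.
have [m1 l1] := half a c ltac:(lra) ltac:(rewrite /c; lra) ltac:(rewrite /c; lra).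
have [m2 l2] := half c b ltac:(rewrite /c; lra) ltac:(lra) ltac:(rewrite /c; lra).
split; first exact: measurableU.
apply: le_trans (measureU2 _ _ _) _ => //.
apply: le_trans (leeD l1 l2) _.
by rewrite -EFinD lee_fin /c; lra.
Qed.

(** Either t lies in an interval handed over to [stop], which provides the flag, or every psi s
    reaches sigma on arbitrarily short intervals around t. Then psi s t >= sigma by continuity, and
    the empty flag works. *)
Lemma stopped_flag a b t : - r0 <= a -> a < b -> b <= r0 ->
  rises sigma P a b -> a <= t <= b -> (forall j, ~ stopped j a b t) ->
  flag_at delta P t.
Proof.
move=> ra ab rb rs tab tn; apply: contrapT => nf.
have /andP[s0 _] := s01.
have nested j : exists a' b', [/\ a <= a' <= t, t <= b' <= b,
    b' - a' = (b - a) / 2 ^+ j, rises sigma P a' b' & forall i, ~ stopped i a' b' t].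
  elim: j => [|j [a' [b' [/andP[aa at_] /andP[tb bb] h rs' n']]]].
    by exists a, b; rewrite expr0 divr1; split=> //; lra.
  have h0 : 0 < (b - a) / 2 ^+ j by rewrite divr_gt0 ?exprn_gt0 //; lra.
  have hS : (b - a) / 2 ^+ j.+1 = ((b - a) / 2 ^+ j) / 2.
    by rewrite exprS; field; rewrite expf_neq0.
  set c := (a' + b') / 2; have cE : 2 * c = a' + b' by rewrite /c; lra.
  have [tc|tc] := leP t c.
    have [/asboolP d|/asboolP nd] := boolP `[< dips a' c >].
      have [|_ _ /(_ t)] // := @stopP a' c ltac:(lra) ltac:(lra)
         ltac:(lra) d.
        apply: (@rises_sub P sigma a' b') => //; lra.
      move=> fl; exfalso; apply: nf; apply: fl; first by rewrite at_ tc.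
      by move=> st; apply: (n' 1%N); left; rewrite -/c asboolT.
    exists a', c; split; rewrite ?hS; [lra|lra|lra|exact: not_dips_rises|].
    by move=> i si; apply: (n' i.+1); left; rewrite -/c asboolF.
  have [/asboolP d|/asboolP nd] := boolP `[< dips c b' >].
    have [|_ _ /(_ t)] // := @stopP c b' ltac:(lra) ltac:(lra)
       ltac:(lra) d.
      apply: (@rises_sub P sigma a' b') => //; lra.
    move=> fl; exfalso; apply: nf; apply: fl; first by rewrite tb ltW.
    by move=> st; apply: (n' 1%N); right; rewrite -/c asboolT.
  exists c, b'; split; rewrite ?hS; [lra|lra|lra|exact: not_dips_rises|].
  by move=> i si; apply: (n' i.+1); right; rewrite -/c asboolF.
apply: nf; exists [::]; split=> // s Ps _ _; apply: le_trans delta_sigma _.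
rewrite leNgt; apply/negP => pst.
have [/(_ t ltac:(lra)) ct _] := psi_good s.
have : \forall u \near t, psi s u < sigma by move/cvgr_lt: ct; apply.
move=> /nbhs_ballP[d /= d0 dP].
have [j jd] : exists j, (b - a) / 2 ^+ j < d.
  exists (Num.bound ((b - a) / d)); rewrite ltr_pdivrMr ?exprn_gt0 //.
  rewrite mulrC -ltr_pdivrMr //; apply: lt_le_trans (archi_boundP _) _.
    by rewrite divr_ge0 // ?(ltW d0) //; lra.
  by rewrite -natrX ler_nat ltnW // ltn_expl.
have [a' [b' [aa bb h rs' _]]] := nested j.
have [u uab su] := rs' s Ps.
have := dP u; rewrite /= ltNge su => /(_ _)/wrap[]//.
by rewrite /ball /= ltr_norml; apply/andP; split; lra.
Qed.

End Stopping.

                                                                              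
                                                                     
                          
(** Induction on the number of ranks still available. The bisection stops at an interval where some
    s stays below sigma, while by [rises_sub] all elements still reach e sigma there. There s joins
    the flag and the induction hypothesis completes it with elements comparable with s. *)
Lemma nondivergence m sigma eta (L : seq nat) (P : T -> Prop) a b :
  0 < sigma <= 1 -> 0 < eta0 -> eta0 * 2 ^+ m <= eta -> (size L <= m)%N ->
  (forall s, P s -> rk s \in L) ->
  - r0 <= a -> a < b -> b <= r0 -> rises sigma P a b ->
  exists X : set R, [/\ measurable X, (mu X <= (eta * (b - a))%:E)%E &
    forall t, a <= t <= b -> ~ X t -> flag_at (margin m sigma) P t].
Proof.
elim: m sigma eta L P a b => [|m IH] sigma eta L P a b s01 eta00 etam Lm PL ra ab rb rs.
  exists set0; rewrite measure0 lee_fin mulr_ge0; [|move: etam; rewrite expr0; lra..].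
  split=> // t _ _.
  exists [::]; split=> // s /PL.
  by move: Lm; rewrite leqn0 size_eq0 => /eqP ->.
set delta := margin m.+1 sigma.
have /andP[e0 e1] := e01.
(* One half of eta is for the induction hypothesis, the other for the set where psi s is small;
   hence the factor 2 per rank. *)
have eta2 : eta0 * 2 ^+ m <= eta / 2 by move: etam; rewrite exprS; lra.
have eta02 : eta0 <= eta / 2.
  by apply: le_trans eta2; rewrite ler_peMr ?(ltW eta00) // exprn_ege1 // ler1n.
have eta_gt0 : 0 < eta by lra.
have s'01 : 0 < e * sigma <= 1.
  case/andP: s01 => s0 s1.
  by rewrite mulr_gt0 //= mulr_ile1 // ltW.
(* The hypotheses stand under the existential quantifier so that a total function [stop] can be
   chosen. *)
have halt a' b' : exists X : set R, - r0 <= a' -> a' < b' -> b' <= r0 ->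
    dips sigma P a' b' -> rises (e * sigma) P a' b' ->
    [/\ measurable X, (mu X <= (eta * (b' - a'))%:E)%E &
     forall t, a' <= t <= b' -> ~ X t -> flag_at delta P t].
  have [[ra' [ab' [rb' [[s Ps dip] rs']]]]|no] := pselect
    (- r0 <= a' /\ a' < b' /\ b' <= r0 /\
    dips sigma P a' b' /\ rises (e * sigma) P a' b'); last first.
    by exists set0 => h1 h2 h3 h4 h5; exfalso; apply: no.
  (* Requiring a rank different from that of s removes one rank from L. *)
  pose P' s' := [/\ P s', cmp s' s & rk s' != rk s].
  pose L' := [seq i <- L | i != rk s].
  have L'm : (size L' <= m)%N.
    rewrite size_filter -ltnS; apply: leq_trans Lm.
    rewrite -(count_predC (fun i => i != rk s)) -addn1 leq_add2l -has_count.
    by apply/hasP; exists (rk s); [exact: PL|rewrite /= negbK].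
  have P'L' s' : P' s' -> rk s' \in L'.
    by move=> [Ps' _ r]; rewrite mem_filter r PL.
  have rs'' : rises (e * sigma) P' a' b'.
    by move=> s' [Ps' _ _]; exact: rs'.
  have [X1 [mX1 muX1 X1P]] := IH _ _ _ _ _ _ s'01 eta00 eta2 L'm P'L' ra' ab' rb' rs''.
  have [_ /(_ a' b' ra' ab' rb') [X2 [mX2 muX2 X2P]]] := psi_good s.
  exists (X1 `|` X2) => _ _ _ _ _; split; first exact: measurableU.
    apply: le_trans (measureU2 _ _ _) _ => //.
    apply: le_trans (leeD muX1 muX2) _; rewrite -EFinD lee_fin.
    have := ler_wpM2r (ltac:(lra) : 0 <= b' - a') eta02; lra.
  move=> t tab nX.
  have nX1 : ~ X1 t by move=> ?; apply: nX; left.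
  have nX2 : ~ X2 t by move=> ?; apply: nX; right.
  have [F [FP Fc Fp Fr]] := X1P t tab nX1.
  have dm : delta <= margin m (e * sigma).
    by rewrite /delta /= !ge_min lexx !orbT.
  have ds : delta <= psi s t.
    have [u uab su] := rs' s Ps.
    have := X2P t tab nX2 u uab; rewrite !ger0_norm //; apply: le_trans.
    apply: (@le_trans _ _ (e * (e * sigma))).
      by rewrite /delta /= !ge_min lexx !orbT.
    by rewrite ler_wpM2l // ltW.
  exists (s :: F); split.
  - by move=> f; rewrite inE => /orP[/eqP->//|/FP[]].
  - move=> f f'; rewrite !inE => /orP[/eqP->|fF] /orP[/eqP->|f'F] //.
    + by rewrite cmpC; have [] := FP _ f'F.
    + by have [] := FP _ fF.
    + exact: Fc.
  - move=> f; rewrite inE => /orP[/eqP->|/Fp /andP[h1 h2]].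
      by rewrite ds /=; have := dip t tab; lra.
    by rewrite h2 andbT (le_trans dm).
  - move=> f Pf fF; rewrite inE negb_or => /andP[r1 r2].
    apply: le_trans dm _; apply: Fr => //; last first.
      by move=> f' f'F; apply: fF; rewrite inE f'F orbT.
    by split=> //; apply: fF; exact: mem_head.
have [stop stopP] : exists stop : R -> R -> set R, forall a' b', - r0 <= a' -> a' < b' -> b' <= r0 ->
    dips sigma P a' b' -> rises (e * sigma) P a' b' ->
    [/\ measurable (stop a' b'), (mu (stop a' b') <= (eta * (b' - a'))%:E)%E &
     forall t, a' <= t <= b' -> ~ stop a' b' t -> flag_at delta P t].
  by exists (fun a' b' => sval (cid (halt a' b'))) => a' b'; exact: svalP (cid (halt a' b')).
have ds : delta <= sigma by rewrite /delta /= ge_min lexx.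
have mS j := (stopped_measure s01 eta_gt0 stopP j ra ab rb rs).1.
have lS j := (stopped_measure s01 eta_gt0 stopP j ra ab rb rs).2.
exists (\bigcup_j stopped sigma P stop j a b); split.
- exact: bigcup_measurable.
- have cv := nondecreasing_cvg_mu (mu := mu) mS (bigcup_measurable (fun j _ => mS j)) _.
  have /cv {}cv : nondecreasing_seq (fun j => stopped sigma P stop j a b).
    by apply/nondecreasing_seqP => j; apply/subsetPset; exact: stopped_mono.
  rewrite -(cvg_lim _ cv) //; apply: lime_le; first by apply/cvg_ex; eexists; exact: cv.
  by apply: nearW => j; exact: lS.
- move=> t tab nX; apply: (@stopped_flag sigma P stop s01 delta eta ds stopP a b t) => //.
  by move=> j sj; apply: nX; exists j.
Qed.

End Nondivergence.

(** * Taylor estimates, interpolation and greedy coverings *)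

Section Taylor.
Context {R : realType}.

Definition taylor_poly (F : nat -> R -> R) (m : nat) (s : R) : {poly R} :=
  \poly_(k < m) (F k s / k`!%:R).

Lemma deriv_taylor_poly F m s :
  (taylor_poly F m.+1 s)^`() = taylor_poly (fun k => F k.+1) m s.
Proof.
apply/polyP => i; rewrite coef_deriv !coef_poly ltnS.
case: ifP => _; last by rewrite mul0rn.
rewrite factS natrM -mulr_natr; field.
by rewrite nat1r !pnatr_eq0 -lt0n fact_gt0.
Qed.

(** Induction on m: along s + t u the remainder has t-derivative u times the remainder of the
    derivative, one order lower, and the mean value theorem on [0, 1] applies. The factorial is
    given up. *)
Lemma taylor_bound (F : nat -> R -> R) (r r1 M : R) m (s u : R) : r1 < r ->
  (forall k (t : R), `|t| < r -> is_derive t (1 : R) (F k) (F k.+1 t)) ->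
  (forall t, `|t| <= r1 -> `|F m t| <= M) ->
  `|s| <= r1 -> `|s + u| <= r1 ->
  `|F 0%N (s + u) - (taylor_poly F m s).[u]| <= M * `|u| ^+ m.
Proof.
move=> r1r; elim: m F s u => [|m IH] F s u dF FM sr sur.
  rewrite /taylor_poly poly_def big_ord0 horner0 subr0 expr0 mulr1; exact: FM.
pose H t := F 0%N (s + t * u) - (taylor_poly F m.+1 s).[t * u].
pose H' t := (F 1%N (s + t * u) - (taylor_poly (fun k => F k.+1) m s).[t * u]) * u.
have conv t : 0 <= t <= 1 -> `|s + t * u| <= r1.
  move=> t01; have -> : s + t * u = (1 - t) * s + t * (s + u) by ring.
  apply: le_trans (ler_normD _ _) _; rewrite !normrM.
  rewrite (ger0_norm (ltac:(lra) : 0 <= t)) (ger0_norm (ltac:(lra) : 0 <= 1 - t)).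
  have := ler_wpM2l (ltac:(lra) : 0 <= t) sur.
  have := ler_wpM2l (ltac:(lra) : 0 <= 1 - t) sr; lra.
have dlin t : is_derive (t : R) (1 : R) (fun t => t * u) u.
  rewrite (_ : (fun t : R => _) = horner (u *: 'X)); last first.
    by apply/funext => z; rewrite !hornerE mulrC.
  by apply: is_derive_eq; rewrite derivZ derivX !hornerE.
have dlin' t : is_derive (t : R) (1 : R) (fun t => s + t * u) u.
  rewrite (_ : (fun t : R => _) = horner (s%:P + u *: 'X)); last first.
    by apply/funext => z; rewrite !hornerE mulrC.
  by apply: is_derive_eq; rewrite derivD derivC derivZ derivX !hornerE.
have dH t : 0 <= t <= 1 -> is_derive (t : R) (1 : R) H (H' t).
  move=> t01; rewrite /H' mulrBl; apply: is_deriveB.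
    apply: (@is_derive1_comp _ (F 0%N) (fun t => s + t * u)).
    by apply: dF; apply: le_lt_trans r1r; exact: conv.
  apply: (@is_derive1_comp _ (horner (taylor_poly F m.+1 s)) (fun t => t * u)).
  by rewrite -deriv_taylor_poly; exact: is_derive_poly.
have [c c01] : exists2 c, c \in `[0, 1] & H 1 - H 0 = H' c * (1 - 0).
  apply: MVT_segment => [|x|]; first exact: ler01.
    by rewrite in_itv /= => /andP[x0 x1]; apply: dH; rewrite !ltW.
  apply: derivable_within_continuous => x; rewrite in_itv /= => x01.
  by have [] := dH x x01.
have H0 : H 0 = 0.
  rewrite /H !mul0r addr0 horner_coef0 /taylor_poly coef_poly /=.
  by rewrite fact0 divr1 subrr.
rewrite H0 !subr0 mulr1 /H !mul1r => ->.
rewrite /H' normrM exprS mulrCA mulrC ler_wpM2l //.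
move: c01; rewrite in_itv /= => c01.
have := IH (fun k => F k.+1) s (c * u) _ _ sr (conv c c01).
move=> /(_ (fun k => dF k.+1) FM) /le_trans; apply.
have M0 : 0 <= M by apply: le_trans (FM s sr).
rewrite ler_wpM2l // lerXn2r ?nnegrE // normrM ger0_norm; last by lra.
by rewrite ler_piMl //; lra.
Qed.

End Taylor.

Section Interpolation.
Context {R : realType}.

Lemma det_norm_le k (A : 'M[R]_k) :
  (forall i j, `|A i j| <= 1) -> `|\det A| <= k`!%:R.
Proof.
move=> A1; rewrite /determinant; apply: le_trans (ler_norm_sum _ _ _) _.
apply: (@le_trans _ _ (\sum_(s : 'S_k) 1)).
  apply: ler_sum => s _; rewrite normrM normrX normrN1 expr1n mul1r normr_prod.
  by apply: prodr_ile1 => i _; rewrite normr_ge0 A1.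
by rewrite sumr_const card_Sn.
Qed.

(** Cramer's rule for the Vandermonde matrix: its determinant is a product of gaps, each at least
    theta, and its cofactors are at most D! since the nodes lie in [-1, 1]. *)
Lemma interpolation_bound D (theta : R) : 0 < theta ->
  exists2 C : R, 0 < C & forall (x : 'I_D.+1 -> R) (p : nat -> R) (tau : R),
    (forall i, `|x i| <= 1) ->
    (forall i j, i != j -> theta <= `|x i - x j|) ->
    (forall i, `|\sum_(k < D.+1) p k * x i ^+ k| <= tau) ->
    forall k : 'I_D.+1, `|p k| <= C * tau.
Proof.
move=> th0; set c : R := \prod_(i < D.+1) \prod_(j < D.+1 | (i < j)%N) theta.
have c0 : 0 < c by rewrite /c; apply: prodr_gt0 => i _; apply: prodr_gt0.
have CN0 : 0 < D.+1%:R * D`!%:R :> R by rewrite mulr_gt0 // ltr0n ?fact_gt0.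
exists (D.+1%:R * D`!%:R / c); first by rewrite divr_gt0.
move=> x p tau x1 xth ptau k.
pose V := Vandermonde D.+1 (\row_i x i).
have V1 i j : `|V i j| <= 1 by rewrite !mxE normrX exprn_ile1.
have detV : c <= `|\det V|.
  rewrite det_Vandermonde normr_prod; apply: ler_prod => i _.
  rewrite prodr_ge0 /=; last by move=> j _; exact: ltW.
  rewrite normr_prod; apply: ler_prod => j ij.
  by rewrite ltW //= !mxE; apply: xth; rewrite -val_eqE /= gtn_eqF.
pose pr : 'rV[R]_D.+1 := \row_i p i.
have key : pr 0 k * \det V = \sum_j (pr *m V) 0 j * (\adj V) j k.
  transitivity ((pr *m V *m \adj V) 0 k); last by rewrite mxE.
  by rewrite -mulmxA mul_mx_adj mul_mx_scalar [RHS]mxE mulrC.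
have pk : `|p k| * `|\det V| <= D.+1%:R * D`!%:R * tau.
  have -> : p k = pr 0 k by rewrite mxE.
  rewrite -normrM key; apply: le_trans (ler_norm_sum _ _ _) _.
  have -> : D.+1%:R * D`!%:R * tau = \sum_(j < D.+1) (tau * D`!%:R).
    by rewrite sumr_const card_ord -mulr_natl; ring.
  apply: ler_sum => j _; rewrite normrM; apply: ler_pM => //.
    rewrite mxE; apply: le_trans (ptau j); rewrite le_eqVlt; apply/orP; left.
    by apply/eqP; congr `|_|; apply: eq_bigr => i _; rewrite !mxE.
  rewrite mxE /cofactor normrM normrX normrN1 expr1n mul1r.
  by apply: det_norm_le => i1 i2; rewrite !mxE normrX exprn_ile1.
have d0 : 0 < `|\det V| by exact: lt_le_trans detV.
apply: (@le_trans _ _ (D.+1%:R * D`!%:R * tau / `|\det V|)).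
  by rewrite ler_pdivlMr.
rewrite [leRHS]mulrAC; have tau0 : 0 <= tau by exact: le_trans (ptau ord0).
by rewrite ler_wpM2l ?lef_pV2 ?posrE // mulr_ge0 // ltW.
Qed.

(** Points are chosen greedily; when no further point keeps the distance theta, those already chosen
    form a net. *)
Lemma separated_or_covered (X : set R) (theta : R) (k : nat) :
  (exists x : nat -> R, (forall i, (i < k)%N -> X (x i)) /\
     forall i j, (i < k)%N -> (j < k)%N -> i != j -> theta <= `|x i - x j|) \/
  (exists x : nat -> R, exists2 k', (k' < k)%N &
     forall t, X t -> exists2 i, (i < k')%N & `|x i - t| < theta).
Proof.
elim: k => [|k [[x [xX xth]]|[x [k' k'k xc]]]]; first by left; exists (fun=> 0).
  have [[t [Xt tx]]|no] := pselect (exists t, X t /\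
      forall i, (i < k)%N -> theta <= `|x i - t|).
    left; exists (fun i => if (i < k)%N then x i else t); split=> [i _|i j ik jk ij].
      by case: ifP => // /xX.
    case: ifPn => [ik'|ik']; case: ifPn => [jk'|jk'].
    - exact: xth.
    - exact: tx.
    - by rewrite distrC; exact: tx.
    - exfalso; move: ij; have -> : i = j by lia.
      by rewrite eqxx.
  right; exists x, k => // t Xt; apply: contrapT => /forall2NP h; apply: no.
  exists t; split=> // i ik; rewrite leNgt; apply/negP => ?.
  by case: (h i).
by right; exists x, k' => //; exact: ltnW.
Qed.

End Interpolation.

(** * Goodness of the linear forms along a nondegenerate curve *)

Section SmoothFamily.
Context {R : realType} {m : nat}.
Local Notation mu := (@lebesgue_measure R).
Implicit Types (Phi : nat -> R -> 'rV[R]_m) (c : 'rV[R]_m).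

                                                                            
(** The whole sequence of derivatives is carried as data, which replaces iterated differentiation by
    a shift of the index. *)
Definition smooth (r : R) Phi := forall k i (t : R), `|t| < r ->
  is_derive t (1 : R) (fun t => Phi k t 0 i) (Phi k.+1 t 0 i).

Definition nondeg D Phi :=
  forall c, (forall k, (k <= D)%N -> dot c (Phi k 0) = 0) -> c = 0.

Definition norm1 c : R := \sum_i `|c 0 i|.

Lemma norm1_ge0 c : 0 <= norm1 c.
Proof. exact: sumr_ge0. Qed.

Lemma dot_norm1 c (v : 'rV[R]_m) M :
  (forall i, `|v 0 i| <= M) -> `|dot c v| <= norm1 c * M.
Proof.
move=> vM; rewrite dot_sum (le_trans (ler_norm_sum _ _ _)) // /norm1 mulr_suml.
by apply: ler_sum => i _; rewrite normrM ler_wpM2l.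
Qed.

Lemma smooth_dot r Phi c k (t : R) : smooth r Phi -> `|t| < r ->
  is_derive t (1 : R) (fun t => dot c (Phi k t)) (dot c (Phi k.+1 t)).
Proof.
move=> sP tr.
have -> : (fun t => dot c (Phi k t)) = \sum_i (fun t => c 0 i * Phi k t 0 i).
  by apply/funext => u; rewrite dot_sum fct_sumE.
rewrite dot_sum; apply: is_derive_sum => i.
by apply: is_deriveZ; exact: sP.
Qed.

Lemma is_derive_continuous (f : R -> R) (t d : R) :
  is_derive t (1 : R) f d -> {for t, continuous f}.
Proof.
by move=> df; apply/differentiable_continuous/derivable1_diffP; exact: ex_derive.
Qed.

Lemma continuous_bounded (f : R -> R) (r1 : R) :
  (forall t, `|t| <= r1 -> {for t, continuous f}) ->
  exists2 M, 0 <= M & forall t, `|t| <= r1 -> `|f t| <= M.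
Proof.
have [r10 fc|r10] := leP 0 r1; last first.
  by exists 0 => // t /le_lt_trans /(_ r10); rewrite normr_lt0.
have [|c _ fm] := @EVT_max R (fun t => `|f t|) (- r1) r1 ltac:(lra).
  apply: continuous_subspace_itv => t tr.
  apply: continuous_comp; last exact: norm_continuous.
  by apply: fc; move: tr; rewrite in_itv /= ler_norml.
by exists `|f c| => // t tr; apply: fm; rewrite in_itv /= -ler_norml.
Qed.

Lemma smooth_bounded r r1 Phi k : smooth r Phi -> r1 < r ->
  exists2 M, 0 <= M & forall t, `|t| <= r1 -> forall i, `|Phi k t 0 i| <= M.
Proof.
move=> sP r1r.
have /choice[M MP] : forall i, exists M, 0 <= M /\
    forall t, `|t| <= r1 -> `|Phi k t 0 i| <= M.
  move=> i; have [|M M0 MP] := @continuous_bounded (fun t => Phi k t 0 i) r1.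
    by move=> t tr; apply: is_derive_continuous (sP k i t _); exact: le_lt_trans r1r.
  by exists M.
exists (\sum_i M i); first by apply: sumr_ge0 => i _; case: (MP i).
move=> t tr i; rewrite (bigD1 i) //=.
have [_ /(_ t tr) /le_trans] := MP i; apply.
by rewrite lerDl sumr_ge0 // => j _; case: (MP j).
Qed.

(** At 0 the matrix of derivatives up to order D has a right inverse W, so c is controlled by its
    pairings with them. Continuity of finitely many entries extends this to nearby s, uniformly in
    c. *)
Lemma nondeg_lower_bound r Phi D : 0 < r -> smooth r Phi -> nondeg D Phi ->
  exists kappa r1, [/\ 0 < kappa, 0 < r1 < r & forall s, `|s| <= r1 -> forall c,
    exists2 k, (k <= D)%N & kappa * norm1 c <= `|dot c (Phi k s)|].
Proof.
move=> r0 sP ndP; pose M s : 'M[R]_(m, D.+1) := \matrix_(i, k) Phi k s 0 i.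
have cM c s k : (c *m M s) 0 k = dot c (Phi k s).
  by rewrite dot_sum mxE; apply: eq_bigr => i _; rewrite mxE.
have /row_freeP[W MW] : row_free (M 0).
  apply/inj_row_free => c cM0; apply: ndP => k kD.
  by rewrite -(cM c 0 (Ordinal (kD : (k < D.+1)%N))) cM0 mxE.
pose w := 1 + \sum_i \sum_k `|W k i|.
have w1 : 1 <= w by rewrite lerDl; apply: sumr_ge0 => i _; exact: sumr_ge0.
(* The pairings at s and the perturbation each contribute d [norm1 c], and w * 2 d = 1/2 < 1. *)
pose d := (4 * w)^-1; have d0 : 0 < d by rewrite invr_gt0; lra.
have : \forall s \near (0 : R), forall k : 'I_D.+1, forall i,
    `|Phi k s 0 i - Phi k 0 0 i| <= d.
  apply: (@filter_forall R _ (fun (k : 'I_D.+1) s => forall i : 'I_m,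
    `|Phi k s 0 i - Phi k 0 0 i| <= d) (nbhs (0 : R)) _) => k.
  apply: (@filter_forall R _ (fun i s => `|Phi k s 0 i - Phi k 0 0 i| <= d) (nbhs (0 : R)) _) => i.
  have /is_derive_continuous : is_derive (0 : R) (1 : R) (fun t => Phi k t 0 i)
    (Phi k.+1 0 0 i) by apply: sP; rewrite normr0.
  by move=> /cvgr_dist_le /(_ d d0); apply: filterS => s; rewrite distrC.
move=> /nbhs_ballP[r2 /= r20 r2P].
set r3 := Num.min r2 r.
have [r30 r3r r32] : [/\ 0 < r3, r3 <= r & r3 <= r2].
  by rewrite /r3 lt_min r20 r0 !ge_min !lexx orbT.
exists d, (r3 / 2); split=> //; first lra.
move=> s sr c; apply: contrapT => /forall2NP small.
have {}small k : (k <= D)%N -> `|dot c (Phi k s)| < d * norm1 c.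
  by move=> kD; rewrite ltNge; apply/negP => ?; case: (small k).
have sd (k : 'I_D.+1) i : `|Phi k s 0 i - Phi k 0 0 i| <= d.
  apply: r2P; rewrite /ball /= sub0r normrN; apply: le_lt_trans sr _; lra.
have small0 (k : 'I_D.+1) : `|(c *m M 0) 0 k| <= 2 * d * norm1 c.
  rewrite cM; have -> : Phi k 0 = Phi k s - (Phi k s - Phi k 0) by rewrite subKr.
  rewrite dotDr -scaleN1r dotZr mulN1r (le_trans (ler_normB _ _)) //.
  have := small k (ltn_ord k).
  have : `|dot c (Phi k s - Phi k 0)| <= norm1 c * d.
    by apply: dot_norm1 => i; rewrite !mxE; exact: sd.
  lra.
have : norm1 c <= w * (2 * d * norm1 c).
  rewrite /w mulrDl mul1r -[leLHS]add0r lerD //.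
    by rewrite !mulr_ge0 ?norm1_ge0 // ltW.
  rewrite {1}/norm1 mulr_suml; apply: ler_sum => i _.
  have -> : c 0 i = \sum_k (c *m M 0) 0 k * W k i.
    by rewrite -[c in LHS]mulmx1 -MW mulmxA mxE.
  rewrite (le_trans (ler_norm_sum _ _ _)) // mulr_suml.
  by apply: ler_sum => k _; rewrite normrM mulrC ler_wpM2l.
have -> : w * (2 * d * norm1 c) = 2^-1 * norm1 c.
  by rewrite /d; field; lra.
have := small 0%N isT; have := norm1_ge0 c.
have := normr_ge0 (dot c (Phi 0 s)).
move=> h1 h2 h3 h4; have c0 : norm1 c = 0 by lra.
by rewrite c0 mulr0 in h3; lra.
Qed.

Lemma measure_cover (x : nat -> R) (theta : R) k : 0 <= theta ->
  exists X : set R, [/\ measurable X, (mu X <= (k%:R * (theta *+ 2))%:E)%E &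
    forall i t, (i < k)%N -> `|x i - t| < theta -> X t].
Proof.
move=> th0; elim: k => [|k [X [mX muX XP]]].
  by exists set0; rewrite measure0 mul0r.
have mb : measurable (ball (x k) theta) by rewrite ball_itv; exact: measurable_itv.
exists (X `|` ball (x k) theta); split; first exact: measurableU.
  apply: le_trans (measureU2 _ _ _) _ => //.
  have := lebesgue_measure_ball (x k) th0 => muB.
  apply: le_trans (leeD muX (le_refl _)) _.
  by rewrite [X in (_ + X)%E]muB -EFinD lee_fin -natr1; lra.
move=> i t; rewrite ltnS leq_eqVlt => /orP[/eqP->|ik] h; first by right.
by left; exact: XP h.
Qed.

Lemma continuous_max (f : R -> R) (r1 a b : R) : - r1 <= a -> a < b -> b <= r1 ->
  (forall t, `|t| <= r1 -> {for t, continuous f}) ->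
  exists2 T, a <= T <= b & forall t, a <= t <= b -> `|f t| <= `|f T|.
Proof.
move=> ra ab rb fc.
have [|T Tab fT] := @EVT_max R (fun t => `|f t|) a b (ltW ab).
  apply: continuous_subspace_itv => t; rewrite in_itv /= => tab.
  apply: continuous_comp; last exact: norm_continuous.
  by apply: fc; rewrite ler_norml; lra.
exists T; first by move: Tab; rewrite in_itv.
by move=> t tab; apply: fT; rewrite in_itv.
Qed.

Section Goodness.
Variables (r : R) (Phi : nat -> R -> 'rV[R]_m) (D : nat).
Hypotheses (r0 : 0 < r) (sP : smooth r Phi) (ndP : nondeg D Phi).

                                                                              
                                                   
(** Taylor expansion at the midpoint gives a polynomial with error of order [norm1 c] h^(D+1). By
    [nondeg_lower_bound] some coefficient is at least a constant times [norm1 c] h^D, and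
    interpolation bounds the coefficients by the maximum of the function plus the error. On short
    intervals the error is absorbed, so it is a small multiple of the maximum. *)
Let expansion : exists C r1, [/\ 0 < C, 0 < r1 < r, r1 < 1 & forall c a b,
  - r1 <= a -> a < b -> b <= r1 -> exists p : nat -> R, exists2 T,
  a <= T <= b /\ norm1 c * ((b - a) / 2) ^+ D <= C * `|dot c (Phi 0 T)| &
  forall t, a <= t <= b -> `|dot c (Phi 0 t)| <= `|dot c (Phi 0 T)| /\
  `|dot c (Phi 0 t) - \sum_(k < D.+1) p k * ((t - (a + b) / 2) / ((b - a) / 2)) ^+ k|
    <= C * (b - a) * `|dot c (Phi 0 T)|].
Proof.
have [kappa [r2 [kap0 /andP[r20 r2r] low]]] := nondeg_lower_bound r0 sP ndP.
have [M M0 MP] := smooth_bounded D.+1 sP r2r.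
have [C1 C10 interp] := @interpolation_bound R D (D.+1%:R)^-1 ltac:(by rewrite invr_gt0 ltr0n).
pose C2 := 2 * D`!%:R * C1 / kappa.
have F0 : 0 < D`!%:R :> R by rewrite ltr0n fact_gt0.
have C20 : 0 < C2 by rewrite divr_gt0 ?mulr_gt0.
(* The last bound makes the Taylor error absorbable ([hM]); the bound 2^-1 gives h <= 1, hence h^D
   <= h^k. *)
pose r1 := Num.min (r2 / 2) (Num.min 2^-1 (1 / (C2 * (M + 1)))).
have r1P : [/\ 0 < r1, r1 <= r2 / 2, r1 <= 2^-1 & r1 <= 1 / (C2 * (M + 1))].
  split; rewrite /r1 ?ge_min ?lexx ?orbT //.
  rewrite !lt_min; apply/and3P; split; [lra|lra|].
  by apply: divr_gt0; [lra|apply: mulr_gt0; lra].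
case: r1P => r10 r1r2 r1h r1M.
pose C := C2 * (M + 1); have C0 : 0 < C by rewrite mulr_gt0 //; lra.
exists C, r1; split=> //; [lra|lra|].
move=> c a b ra ab rb; set s := (a + b) / 2; set h := (b - a) / 2.
have [hE sE] : h = (b - a) / 2 /\ s = (a + b) / 2 by [].
clearbody h s; have h0 : 0 < h by lra.
have [T Tab fT] : exists2 T, a <= T <= b &
    forall t, a <= t <= b -> `|dot c (Phi 0 t)| <= `|dot c (Phi 0 T)|.
  apply: (@continuous_max _ r1) => // t tr; apply: is_derive_continuous.
  apply: (smooth_dot c 0 sP); lra.
set A := `|dot c (Phi 0 T)| in fT *.
pose p k := dot c (Phi k s) / k`!%:R * h ^+ k.
have taylor t : a <= t <= b ->
    `|dot c (Phi 0 t) - \sum_(k < D.+1) p k * ((t - s) / h) ^+ k| <=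
    norm1 c * M * h ^+ D.+1.
  move=> tab; have sr : `|s| <= r1 by rewrite ler_norml; lra.
  have stE : s + (t - s) = t by rewrite addrC subrK.
  have tr : `|s + (t - s)| <= r1 by rewrite stE ler_norml; lra.
  have := @taylor_bound R (fun k t => dot c (Phi k t)) r r1 (norm1 c * M) D.+1 s (t - s)
    ltac:(lra) (fun k t tr => smooth_dot c k sP tr) _ sr tr.
  rewrite stE => /(_ _)/wrap[].
    by move=> u ur; apply: dot_norm1; apply: MP; lra.
  move=> H; apply: le_trans (_ : _ <= norm1 c * M * `|t - s| ^+ D.+1) _; last first.
    rewrite ler_wpM2l ?mulr_ge0 ?norm1_ge0 // lerXn2r ?nnegrE // ?(ltW h0) //.
    by rewrite ler_norml; lra.
  apply: le_trans H; rewrite horner_poly le_eqVlt; apply/orP; left; apply/eqP.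
  congr `|_ - _|; apply: eq_bigr => k _; rewrite /p expr_div_n -mulrA.
  by congr (_ * _); rewrite mulrC divfK // expf_neq0 // gt_eqF.
have low_h : norm1 c * h ^+ D <= C2 * A.
  have sr : `|s| <= r2 by rewrite ler_norml; lra.
  have [k kD ck] := low s sr c.
  (* Equally spaced nodes with gap 1 / (D + 1), coming from the right half of [a, b]. *)
  pose x (i : 'I_D.+1) : R := i%:R / D.+1%:R.
  have D0 : 0 < D.+1%:R :> R by rewrite ltr0n.
  have xi01 i : 0 <= x i <= 1.
    by rewrite /x divr_ge0 //= ler_pdivrMr // mul1r ler_nat ltnW.
  have pk : `|p k| <= C1 * (A + norm1 c * M * h ^+ D.+1).
    apply: (interp x p _ _ _ _ (Ordinal (kD : (k < D.+1)%N))).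
    - by move=> i; rewrite ger0_norm; have := xi01 i; lra.
    - move=> i j ij; rewrite /x -mulrBl normrM normfV normr_nat -[leLHS]mul1r.
      rewrite ler_wpM2r ?invr_ge0 ?ler0n //.
      wlog ij' : i j ij / (j < i)%N => [H|].
        move: ij; rewrite -val_eqE neq_ltn => /orP[] ij; last by apply: H; rewrite // -val_eqE gtn_eqF.
        by rewrite distrC; apply: H; rewrite // -val_eqE gtn_eqF.
      by rewrite -natrB 1?ltnW // normr_nat ler1n subn_gt0.
    - move=> i; pose t := s + h * x i.
      have tab : a <= t <= b.
        have := xi01 i; rewrite /t => /andP[x0 x1].
        have := mulr_ge0 (ltW h0) x0; have := ler_wpM2l (ltW h0) x1; lra.
      have xt : (t - s) / h = x i by rewrite /t addrC addKr mulrC mulKf // gt_eqF.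
      have := taylor t tab; rewrite xt; have := fT t tab.
      set S := \sum_(_ < _) _; set f := dot _ _ => h1 h2.
      have -> : S = f - (f - S) by rewrite subKr.
      by apply: le_trans (ler_normB _ _) _; exact: lerD.
  have kapN : kappa * norm1 c * h ^+ D <= D`!%:R * `|p k|.
    have kf0 : 0 < k`!%:R :> R by rewrite ltr0n fact_gt0.
    rewrite /p !normrM normfV normr_nat [`|h ^+ k|]ger0_norm ?exprn_ge0 ?(ltW h0) //.
    apply: le_trans (_ : kappa * norm1 c * h ^+ k <= _).
      apply: ler_wpM2l; first by rewrite mulr_ge0 ?norm1_ge0 // ltW.
      by apply: ler_wiXn2l => //; lra.
    rewrite [leRHS](_ : _ = `|dot c (Phi k s)| * (D`!%:R / k`!%:R) * h ^+ k); last by ring.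
    rewrite ler_wpM2r ?exprn_ge0 ?(ltW h0) // (le_trans ck) // ler_peMr //.
    by rewrite ler_pdivlMr // mul1r ler_nat; exact: leq_fact.
  have hM : D`!%:R * C1 * (norm1 c * M * h ^+ D.+1) <= kappa / 2 * (norm1 c * h ^+ D).
    have hh : h * (C2 * M) <= 1.
      have : h <= r1 by lra.
      move=> /le_trans /(_ r1M); rewrite ler_pdivlMr // => hC.
      apply: le_trans hC; rewrite ler_wpM2l ?(ltW h0) // ler_wpM2l ?(ltW C20) //; lra.
    have -> : D`!%:R * C1 * (norm1 c * M * h ^+ D.+1) =
       kappa / 2 * (norm1 c * h ^+ D) * (h * (C2 * M)).
      by rewrite /C2 exprS; field; rewrite gt_eqF.
    by rewrite ler_piMr // !mulr_ge0 ?norm1_ge0 ?exprn_ge0 ?invr_ge0 ?ltW.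
  have : D`!%:R * `|p k| <= D`!%:R * (C1 * (A + norm1 c * M * h ^+ D.+1)).
    by rewrite ler_wpM2l // ltW.
  have -> : C2 * A = (2 / kappa) * (D`!%:R * C1 * A) by rewrite /C2; field; rewrite gt_eqF.
  move=> pC; rewrite mulrAC ler_pdivlMr //; lra.
have MC : norm1 c * M * h ^+ D.+1 <= C * (b - a) * A.
  have -> : norm1 c * M * h ^+ D.+1 = norm1 c * h ^+ D * (M * h) by rewrite exprS; ring.
  apply: le_trans (_ : C2 * A * ((M + 1) * (b - a)) <= _).
    apply: ler_pM => //; first by rewrite mulr_ge0 ?norm1_ge0 ?exprn_ge0 // ltW.
      by rewrite mulr_ge0 // ltW.
    rewrite (_ : b - a = 2 * h); last by lra.
    by have := mulr_ge0 M0 (ltW h0); lra.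
  by rewrite /C le_eqVlt; apply/orP; left; apply/eqP; ring.
exists p, T; last by move=> t tab; split; [exact: fT|apply: le_trans MC; exact: taylor].
have C2C : C2 <= C by have := mulr_ge0 (ltW C20) M0; rewrite /C; lra.
split=> //; apply: le_trans low_h _.
by apply: ler_wpM2r; [exact: normr_ge0|exact: C2C].
Qed.

(** If |f| < e A held at D + 1 points separated by theta h, interpolation would make all
    coefficients small and |f| would be less than its maximum A at T. So that set is covered by at
    most D short balls, of total length at most eta (b - a). *)
Lemma smooth_good eta : 0 < eta -> exists e r1 C,
  [/\ 0 < e <= 1, 0 < r1 < r, 0 < C,
    (forall c, good_fun eta e r1 (fun t => dot c (Phi 0 t))) &
    forall c a b, - r1 <= a -> a < b -> b <= r1 -> exists2 T,
      a <= T <= b & norm1 c * ((b - a) / 2) ^+ D <= C * `|dot c (Phi 0 T)|].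
Proof.
move=> eta0; have [C [r2 [C0 r2r r21 exp]]] := expansion.
pose theta := eta / D.+1%:R.
have D0 : 0 < D.+1%:R :> R by rewrite ltr0n.
have th0 : 0 < theta by rewrite divr_gt0.
have [C1 C10 interp] := @interpolation_bound R D theta th0.
pose B := D.+1%:R * C1; have B0 : 0 < B by rewrite mulr_gt0.
(* This e and the r1 below make each of B e A, B C (b - a) A and C (b - a) A at most A / 4, so that
   their sum is below A. *)
pose e := Num.min 1 (4 * B)^-1.
have [e0 e1 eB] : [/\ 0 < e, e <= 1 & e <= (4 * B)^-1].
  by rewrite /e lt_min ltr01 invr_gt0 mulr_gt0 // !ge_min !lexx orbT.
pose r1 := Num.min r2 (Num.min (8 * C)^-1 (8 * (B * C))^-1).
have [r10 r12 r1C r1B] : [/\ 0 < r1, r1 <= r2, r1 <= (8 * C)^-1 & r1 <= (8 * (B * C))^-1].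
  rewrite /r1 !lt_min !invr_gt0 !mulr_gt0 // !ge_min !lexx !orbT.
  by case/andP: r2r => ->.
have eB' : B * e <= 4^-1.
  have := ler_wpM2l (ltW B0) eB; rewrite (_ : B * (4 * B)^-1 = 4^-1) //.
  by field; rewrite gt_eqF.
have r1C' : C * r1 <= 8^-1.
  have := ler_wpM2l (ltW C0) r1C; rewrite (_ : C * (8 * C)^-1 = 8^-1) //.
  by field; rewrite gt_eqF.
have r1B' : B * C * r1 <= 8^-1.
  have := ler_wpM2l (ltW (mulr_gt0 B0 C0)) r1B.
  rewrite (_ : B * C * (8 * (B * C))^-1 = 8^-1) //.
  by field; rewrite !gt_eqF.
clearbody r1 e.
exists e, r1, C; split=> //; first by rewrite e0.
- by case/andP: r2r => h1 h2; rewrite r10 (le_lt_trans r12).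
- move=> c; split=> [t tr1|a b ra ab rb].
    apply: is_derive_continuous (smooth_dot c 0 sP _).
    by case/andP: r2r => h1 h2; rewrite -ler_norml in tr1; apply: le_lt_trans tr1 (le_lt_trans r12 h2).
  have [p [T [Tab _] pT]] := exp c a b ltac:(lra) ab ltac:(lra).
  set A := `|dot c (Phi 0 T)| in pT.
  have [h hE] : exists h, h = (b - a) / 2 by exists ((b - a) / 2).
  have h0 : 0 < h by lra.
  have [[x [xX xsep]]|[x [k kD xcov]]] := separated_or_covered
    [set t | a <= t <= b /\ `|dot c (Phi 0 t)| < e * A] (theta * h) D.+1; last first.
    have [X [mX muX XP]] := measure_cover x k (ltW (mulr_gt0 th0 h0)).
    exists X; split=> //.
      apply: le_trans muX _; rewrite lee_fin.
      apply: (@le_trans _ _ (D.+1%:R * (theta * h *+ 2))).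
        by apply: ler_wpM2r; [rewrite mulrn_wge0 // ltW // mulr_gt0|rewrite ler_nat ltnW].
      rewrite /theta le_eqVlt hE; apply/orP; left; apply/eqP.
      by rewrite -mulr_natl; field; rewrite gt_eqF.
    move=> t tab nX t' t'ab; apply: (@le_trans _ _ (e * A)).
      by rewrite ler_wpM2l ?(ltW e0) //; have [] := pT t' t'ab.
    rewrite leNgt; apply/negP => small; apply: nX.
    by have [|i ik xt] := xcov t; [by split|exact: XP xt].
  exfalso.
  have A0 : 0 < A.
    have [_ ] := xX 0%N isT; have := normr_ge0 (dot c (Phi 0 (x 0%N))).
    by move=> h1 h2; have := le_lt_trans h1 h2; rewrite pmulr_rgt0.
  have CbA : C * (b - a) * A <= 4^-1 * A.
    apply: ler_wpM2r; first exact: ltW.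
    apply: le_trans (_ : C * (2 * r1) <= _); last by lra.
    by apply: ler_wpM2l; [exact: ltW|lra].
  have BCbA : B * (C * (b - a) * A) <= 4^-1 * A.
    rewrite !mulrA; apply: ler_wpM2r; first exact: ltW.
    apply: le_trans (_ : B * C * (2 * r1) <= _); last by lra.
    by apply: ler_wpM2l; [rewrite ltW // mulr_gt0|lra].
  pose u t := (t - (a + b) / 2) / ((b - a) / 2).
  have u1 t : a <= t <= b -> `|u t| <= 1.
    move=> tab; rewrite /u -hE normrM normfV (gtr0_norm h0) ler_pdivrMr // mul1r.
    by rewrite ler_norml; lra.
  have pk (k : 'I_D.+1) : `|p k| <= C1 * (e * A + C * (b - a) * A).
    apply: (interp (fun i => u (x i))) => [i|i j ij|i].
    - by apply: u1; have [] := xX i (ltn_ord i).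
    - have -> : u (x i) - u (x j) = (x i - x j) / h by rewrite /u -hE; field; rewrite gt_eqF.
      rewrite normrM normfV (gtr0_norm h0) ler_pdivlMr //; exact: xsep.
    - have [tab small] := xX i (ltn_ord i); have [_] := pT _ tab; rewrite -/(u _).
      set S := \sum_(_ < _) _; set f := dot c _ in small *; move=> h1.
      have -> : S = f - (f - S) by rewrite subKr.
      by apply: le_trans (ler_normB _ _) _; apply: lerD => //; exact: ltW.
  have [_] := pT T Tab; rewrite -/(u T); set S := \sum_(_ < _) _ => fS.
  have SB : `|S| <= B * (e * A + C * (b - a) * A).
    apply: le_trans (ler_norm_sum _ _ _) _.
    have -> : B * (e * A + C * (b - a) * A) =
        \sum_(k < D.+1) (C1 * (e * A + C * (b - a) * A)).
      by rewrite sumr_const card_ord /B -mulrA mulr_natl.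
    apply: ler_sum => k _; apply: le_trans (pk k); rewrite normrM normrX.
    by rewrite ler_piMr // exprn_ile1 // u1.
  have : A <= `|S| + C * (b - a) * A.
    rewrite /A -{1}[dot c (Phi 0 T)](subrK S) addrC.
    by apply: le_trans (ler_normD _ _) _; rewrite lerD2l.
  have : B * e * A <= 4^-1 * A by apply: ler_wpM2r => //; exact: ltW.
  rewrite mulrDr mulrA in SB; lra.
- move=> c a b ra ab rb; have [p [T [Tab TC] _]] := exp c a b ltac:(lra) ab ltac:(lra).
  by exists T.
Qed.

End Goodness.
End SmoothFamily.

(** * Maxima of good functions *)

Section MaxGood.
Context {R : realType}.
Local Notation mu := (@lebesgue_measure R).

Lemma continuous_bigmax (I : Type) (s : seq I) (F : I -> R -> R) (t : R) :
  (forall i, {for t, continuous (F i)}) ->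
  {for t, continuous (fun t => \big[Num.max/0]_(i <- s) `|F i t|)}.
Proof.
move=> Fc; elim: s => [|i s IH].
  rewrite (_ : (fun _ => _) = cst 0); last by apply/funext => u; rewrite big_nil.
  exact: cst_continuous.
rewrite (_ : (fun _ => _) =
  (fun u => Num.max `|F i u| (\big[Num.max/0]_(i <- s) `|F i u|))); last first.
  by apply/funext => u; rewrite big_cons.
set g := fun u : R => \big[Num.max/0]_(i <- s) `|F i u|.
set f := fun u : R => `|F i u|.
have fc : {for t, continuous f} by apply: cvg_norm; exact: Fc.
rewrite (_ : (fun _ => _) = (fun u => (f u + g u + `|f u - g u|) / 2)); last first.
  by apply/funext => u; rewrite maxr_absE.
apply: cvgM; last exact: cvg_cst.
apply: cvgD; first exact: cvgD.
by apply: cvg_norm; exact: cvgB.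
Qed.

Lemma good_bigmax (I : finType) (eta e r1 : R) (F : I -> R -> R) :
  0 <= eta -> 0 <= e ->
  (forall i, good_fun eta e r1 (F i)) ->
  good_fun eta e r1 (fun t => \big[Num.max/0]_i `|F i t|).
Proof.
move=> eta0 e0 gF; split=> [t tr|a b ra ab rb].
  by apply: continuous_bigmax => i; have [+ _] := gF i; exact.
have /choice[T TP] : forall i, exists T, a <= T <= b /\
    forall t, a <= t <= b -> `|F i t| <= `|F i T|.
  move=> i; have [|T Tab TP] := @continuous_max _ (F i) r1 a b ra ab rb.
    by move=> t tr; have [+ _] := gF i; apply; rewrite -ler_norml.
  by exists T.
have psi0 t : 0 <= \big[Num.max/0]_i `|F i t| by exact: bigmax_ge_id.
case: (pickP I) => [i0 _|noI]; last first.
  exists set0; rewrite measure0 lee_fin mulr_ge0 //; last by lra.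
  split=> // t _ _ t' _; rewrite [X in e * `|X|]big_pred0 //.
  by rewrite normr0 mulr0.
pose i1 := [arg max_(i > i0) `|F i (T i)|]%O.
have i1max i : `|F i (T i)| <= `|F i1 (T i1)|.
  by rewrite /i1; case: arg_maxP => // j _ /(_ i isT).
have [_ /(_ a b ra ab rb) [X [mX muX XP]]] := gF i1.
exists X; split=> // t tab nX t' t'ab; rewrite !ger0_norm //.
apply: (@le_trans _ _ (e * `|F i1 (T i1)|)).
  rewrite ler_wpM2l //; apply: bigmax_le => // i _.
  by apply: le_trans (i1max i); have [_] := TP i; exact.
have [T1 _] := TP i1; apply: le_trans (XP t tab nX _ T1) _.
exact: (le_bigmax _ (fun i => `|F i t|)).
Qed.

End MaxGood.

(** * The lattice attached to a point and to scales, and its minors *)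

Section Frame.
Context {R : realType} {n : nat}.
Implicit Types (E : 'M[R]_n.+1) (w : 'I_n.+1 -> R) (v : 'rV[R]_n.+1).

                                                                            
                                                                                 
(** The vector z is sent to Q <z, v>, with Q the product of the w l, and to the (z E)_j / w_j for j
    != 0: the linear forms dual to simultaneous approximation. Column 0 alone depends on v. *)
Definition frame E w v : 'M[R]_n.+1 :=
  \matrix_(i, j) if j == 0 then (\prod_l w l) * v 0 i else E i j / w j.

Lemma det_frame (N : 'M[R]_n) w (u : 'rV[R]_n) :
  (forall j, w j != 0) -> w 0 = 1 ->
  \det (frame (block_mx 1%:M 0 0 N : 'M[R]_(1 + n)) w (row_mx 1%:M u : 'rV[R]_(1 + n))) = \det N.
Proof.
move=> w0 w01; set Q := \prod_l w l.
have QE : Q = \prod_(j < n) w (rshift 1 j).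
  by rewrite /Q big_ord_recl w01 mul1r; apply: eq_bigr => j _; congr w; exact: val_inj.
rewrite (_ : frame _ _ _ = block_mx Q%:M 0 (Q *: u^T)
  (N *m diag_mx (\row_j (w (rshift 1 j))^-1)) :> 'M[R]_(1 + n)).
  rewrite (det_lblock Q%:M (Q *: u^T) (N *m diag_mx (\row_j (w (rshift 1 j))^-1))).
  rewrite det_scalar1 det_mulmx det_diag QE mulrCA -big_split /=.
  by rewrite big1 ?mulr1 // => j _; rewrite mxE mulfV.
have row0 : (row_mx 1%:M u : 'rV[R]_(1 + n)) 0 (lshift n 0) = 1 by rewrite row_mxEl mxE.
have rowS l : (row_mx 1%:M u : 'rV[R]_(1 + n)) 0 (rshift 1 l) = u 0 l by rewrite row_mxEr.
have bul (X : 'M[R]_1) Y Z (W : 'M[R]_n) :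
  block_mx X Y Z W (lshift n 0) (lshift n 0) = X 0 0 by rewrite block_mxEul.
have bur (X : 'M[R]_1) Y Z (W : 'M[R]_n) l :
  block_mx X Y Z W (lshift n 0) (rshift 1 l) = Y 0 l by rewrite block_mxEur.
have bdl (X : 'M[R]_1) Y Z (W : 'M[R]_n) l :
  block_mx X Y Z W (rshift 1 l) (lshift n 0) = Z l 0 by rewrite block_mxEdl.
have bdr (X : 'M[R]_1) Y Z (W : 'M[R]_n) l l' :
  block_mx X Y Z W (rshift 1 l) (rshift 1 l') = W l l' by rewrite block_mxEdr.
apply/matrixP => i j; rewrite mxE.
case: (splitP j) => [j0 jE|j' jE].
  have -> : j = lshift n 0 by apply: val_inj; rewrite /= jE ord1.
  case: eqP => [_|[]]; last exact: val_inj.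
  case: (splitP i) => [i0 iE|i' iE].
    have -> : i = lshift n 0 by apply: val_inj; rewrite /= iE ord1.
    by rewrite row0 bul mxE mulr1.
  have -> : i = rshift 1 i' by apply: val_inj; rewrite /= iE.
  by rewrite rowS bdl !mxE.
have -> : j = rshift 1 j' by apply: val_inj; rewrite /= jE.
case: eqP => [/(congr1 val)//|_]; case: (splitP i) => [i0 iE|i' iE].
  have -> : i = lshift n 0 by apply: val_inj; rewrite /= iE ord1.
  by rewrite !bur !mxE mul0r.
have -> : i = rshift 1 i' by apply: val_inj; rewrite /= iE.
by rewrite !bdr mul_mx_diag !mxE.
Qed.

(** A minor that omits column 0 does not depend on v and is a multiple of v 0 0 = 1; one that
    repeats it vanishes; any other is expanded along it. *)
Lemma minor_linear E w k (A : 'M[R]_(k, n.+1)) (f : 'I_k -> 'I_n.+1) :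
  exists c : 'rV[R]_n.+1, forall v, v 0 0 = 1 ->
    \det (colsub f (A *m frame E w v)) = dot c v.
Proof.
set M := fun v => colsub f (A *m frame E w v).
have indep v v' i j : f j != 0 -> M v i j = M v' i j.
  move=> fj; rewrite !mxE; apply: eq_bigr => l _; congr (_ * _).
  by rewrite !mxE (negbTE fj).
have [[j0 /eqP fj0]|no0] := pselect (exists j, f j == 0); last first.
  exists (\row_l (\det (M 0) *+ (l == 0))) => v v0.
  rewrite dot_sum (bigD1 0) //= big1 => [|l /negbTE l0]; last by rewrite mxE l0 mul0r.
  rewrite mxE eqxx v0 mulr1 addr0; congr determinant; apply/matrixP => i j.
  by apply: indep; apply/negP => fj; apply: no0; exists j.
have [[j1 [j10 /eqP fj1]]|only] := pselect (exists j, j != j0 /\ f j == 0).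
  exists 0 => v _; rewrite -det_tr (determinant_alternate j10).
    by rewrite dot_sum big1 // => i _; rewrite mxE mul0r.
  by move=> i; rewrite !mxE fj0 fj1.
exists (\row_l \sum_i (\prod_l w l) * A i l * cofactor (M 0) i j0) => v _.
rewrite (expand_det_col _ j0) dot_sum.
under [RHS]eq_bigr => l _ do rewrite mxE mulr_suml.
rewrite exchange_big /=; apply: eq_bigr => i _.
have -> : cofactor (M v) i j0 = cofactor (M 0) i j0.
  rewrite /cofactor; congr (_ * _); congr determinant; apply/matrixP => i' j'.
  rewrite ![row' _ _ _ _]mxE ![col' _ _ _ _]mxE; apply: indep.
  by apply/negP => h; apply: only; exists (lift j0 j'); rewrite eq_sym neq_lift.
rewrite mxE fj0 mxE mulr_suml; apply: eq_bigr => l _; rewrite mxE eqxx.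
by ring.
Qed.

(** Summing over all maps, as [maxminor] does, reduces the formula to multilinear expansion. *)
Lemma cauchy_binet k m (C : 'M[R]_(k, m)) (E : 'M[R]_(m, k)) :
  \det (C *m E) = \sum_(s : {ffun 'I_k -> 'I_m})
    (\prod_i E (s i) i) * \det (colsub s C).
Proof.
rewrite -det_tr /determinant.
under eq_bigr => p _.
  under eq_bigr => i _ do rewrite !mxE.
  rewrite bigA_distr_bigA /= mulr_sumr.
  over.
rewrite exchange_big /=; apply: eq_bigr => s _.
rewrite -[\sum_p _ in RHS]/(\det (colsub s C)) -det_tr /determinant mulr_sumr.
apply: eq_bigr => p _; rewrite mulrCA; congr (_ * _).
by rewrite -big_split /=; apply: eq_bigr => i _; rewrite !mxE mulrC.
Qed.

Lemma entry_bound p q (M : 'M[R]_(p, q)) : exists2 K : R, 1 <= K & forall i j, `|M i j| <= K.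
Proof.
exists (1 + \sum_i \sum_j `|M i j|).
  by rewrite lerDl; apply: sumr_ge0 => i _; exact: sumr_ge0.
move=> i j; rewrite (bigD1 i) //= (bigD1 j) //=.
have : 0 <= \sum_(i0 | i0 != i) \sum_j0 `|M i0 j0|.
  by apply: sumr_ge0 => i0 _; exact: sumr_ge0.
have : 0 <= \sum_(j0 | j0 != j) `|M i j0| by exact: sumr_ge0.
lra.
Qed.

(** Integer minors are 0 or at least 1 in absolute value, and Cauchy-Binet applied to A W = 1
    forbids that all vanish. *)
Lemma big_minor k (A : 'M[int]_(k, n.+1)) : row_free (realmx A : 'M[R]_(k, _)) ->
  exists f : 'I_k -> 'I_n.+1, 1 <= `|\det (colsub f (realmx A : 'M[R]_(k, _)))|.
Proof.
move=> /row_freeP[W AW]; apply: contrapT => /forallNP small.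
have : \det (realmx A *m W) = 0.
  rewrite cauchy_binet big1 // => s _.
  have -> : \det (colsub s (realmx A)) = 0 :> R; last by rewrite mulr0.
  have -> : colsub s (realmx A) = map_mx intr (colsub s A) :> 'M[R]_k.
    by apply/matrixP => i j; rewrite !mxE.
  apply/eqP/negPn/negP => d0; apply: (small s).
  have -> : colsub s (realmx A) = map_mx intr (colsub s A) :> 'M[R]_k.
    by apply/matrixP => i j; rewrite !mxE.
  move: d0; rewrite det_map_mx intr_eq0 -intr_norm -[1]/(1%:~R) ler_int.
  by rewrite -normr_gt0; lia.
by rewrite AW det1 => /eqP; rewrite oner_eq0.
Qed.

(** The s j with j != j0 are at most n - 1 nonzero indices, so some nonzero l is left over, and its
    factor w l >= Q0 pays for Q0. *)
Lemma prod_complement w (Q0 : R) k (s : 'I_k -> 'I_n.+1) (j0 : 'I_k) : (k <= n)%N ->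
  1 <= Q0 -> w 0 = 1 -> (forall j, j != 0 -> Q0 <= w j) -> injective s ->
  (forall j, j != j0 -> s j != 0) ->
  Q0 * \prod_(j | j != j0) w (s j) <= \prod_l w l.
Proof.
move=> kn Q01 w0 wQ injs s0.
have wge1 l : 1 <= w l.
  by have [->|/wQ] := eqVneq l 0; [rewrite w0|apply: le_trans].
have w_ge0 l : 0 <= w l by apply: le_trans (wge1 l).
pose S := [set s j | j in [set~ j0]]%SET.
have SE : \prod_(j | j != j0) w (s j) = \prod_(l in S) w l.
  rewrite big_imset /=; last by move=> x y _ _; exact: injs.
  by apply: eq_bigl => j; rewrite !inE.
have [l] : exists l, l \notin (ord0 |: S)%SET.
  apply: contrapT => /forallNP full.
  have : (#|[set: 'I_n.+1]%SET| <= #|ord0 |: S|)%N.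
    apply: subset_leq_card; apply/fintype.subsetP => l _.
    by apply/negPn/negP; exact: full.
  rewrite cardsT card_ord cardsU1 leqNgt => /negP; apply.
  have : (#|S| <= k.-1)%N.
    by apply: leq_trans (leq_imset_card _ _) _; rewrite cardsC1 card_ord.
  by have := ltn_ord j0; have := leq_b1 (ord0 \notin S); lia.
rewrite in_setU1 negb_or => /andP[l0 lS].
rewrite SE [leRHS](bigID (mem S)) /= mulrC ler_wpM2l ?prodr_ge0 //.
rewrite (bigD1 l) //= -[leLHS]mulr1; apply: ler_pM => //.
- exact: le_trans Q01.
- exact: wQ.
- by apply: (big_ind (fun x : R => 1 <= x)) => // x y x1 y1; exact: mulr_ege1.
Qed.

(** Some minor of A E, on columns s, is bounded below uniformly in A. Putting column 0 of the frame
    in place of column j0 gives a form <c, v>, with c made of cofactors. Pairing c with a column of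
    E returns the original minor, so c is not small; the scales give the factor Q0 by
    [prod_complement]. *)
Lemma minor_lower_bound E : E \in unitmx -> exists2 c0 : R, 0 < c0 &
  forall k (A : 'M[int]_(k, n.+1)), (0 < k <= n)%N ->
  row_free (realmx A : 'M[R]_(k, _)) -> exists2 c : 'rV[R]_n.+1, c0 <= norm1 c &
  forall w Q0 v, 1 <= Q0 -> w 0 = 1 -> (forall j, j != 0 -> Q0 <= w j) ->
    Q0 * `|dot c v| <= maxminor (realmx A *m frame E w v).
Proof.
move=> Eu; have [KE KE1 KEP] := entry_bound E.
have [KI KI1 KIP] := entry_bound (invmx E).
(* If all (n+1)^k minors of A E were below c1, Cauchy-Binet with weights at most KI^k would bound
   every minor of A by 1/2, against [big_minor]. *)
pose c1 : R := (2 * (n.+1%:R * KI) ^+ n)^-1.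
have nKI : 1 <= n.+1%:R * KI by rewrite mulr_ege1 // ler1n.
have c10 : 0 < c1 by rewrite invr_gt0 mulr_gt0 // exprn_gt0 //; lra.
exists (c1 / KE); first by rewrite divr_gt0 //; lra.
move=> k A /andP[k0 kn] fA; set a : 'M[R]_(k, n.+1) := realmx A.
have [C CE] : exists C, C = a *m E by exists (a *m E).
have aC : a = C *m invmx E by rewrite CE mulmxK.
have [f f1] := big_minor fA.
have [s sc1] : exists s : {ffun 'I_k -> 'I_n.+1}, c1 <= `|\det (colsub s C)|.
  apply: contrapT => /forallNP small.
  have : colsub f a = C *m colsub f (invmx E).
    by rewrite {1}aC; apply/matrixP => i j; rewrite !mxE; apply: eq_bigr => l _; rewrite mxE.
  move: f1; rewrite -/a => f1 fE; move: f1; rewrite fE cauchy_binet.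
  apply/negP; rewrite -ltNge.
  apply: (@le_lt_trans _ _ (\sum_(s : {ffun 'I_k -> 'I_n.+1}) KI ^+ k * c1)).
    apply: le_trans (ler_norm_sum _ _ _) _; apply: ler_sum => s _.
    rewrite normrM normr_prod; apply: ler_pM => //.
    - by apply: prodr_ge0.
    - rewrite -[X in _ ^+ X]card_ord -prodr_const; apply: ler_prod => i _.
      by rewrite normr_ge0 mxE KIP.
    - by have /negP := small s; rewrite -ltNge => /ltW.
  rewrite sumr_const card_ffun !card_ord -mulr_natl natrX mulrA -exprMn.
  apply: (@le_lt_trans _ _ ((n.+1%:R * KI) ^+ n * c1)).
    by rewrite ler_wpM2r ?(ltW c10) // ler_weXn2l.
  have X0 : (n.+1%:R * KI) ^+ n != 0 by rewrite expf_neq0 // gt_eqF //; lra.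
  have -> : (n.+1%:R * KI) ^+ n * c1 = 2^-1 by rewrite /c1; field.
  by lra.
have injs : injective s.
  move=> i j sij; apply/eqP/negPn/negP => ij; move: sc1.
  rewrite -det_tr (determinant_alternate ij) ?normr0; first by lra.
  by move=> l; rewrite !mxE sij.
(* By injectivity at most one s j is 0; j0 is that index, or any index if there is none. *)
have [j0 sj0] : exists j0, forall j, j != j0 -> s j != 0.
  have [[j1 /eqP sj1]|no] := pselect (exists j, s j == 0).
    exists j1 => j; apply: contra => /eqP sj; apply/eqP/injs.
    by rewrite sj sj1.
  exists (Ordinal k0) => j _; apply/negP => sj; apply: no; by exists j.
pose cof i := cofactor (colsub s C) i j0.
exists (\row_l \sum_i a i l * cof i).
  rewrite ler_pdivrMr; last by lra.
  apply: le_trans sc1 _; rewrite (expand_det_col _ j0).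
  have -> : \sum_i colsub s C i j0 * cofactor (colsub s C) i j0 =
      dot (\row_l \sum_i a i l * cof i) (\row_l E l (s j0)).
    rewrite dot_sum; under [RHS]eq_bigr => l _ do rewrite !mxE mulr_suml.
    rewrite exchange_big /=; apply: eq_bigr => i _.
    have -> : colsub s C i j0 = \sum_l a i l * E l (s j0) by rewrite mxE CE mxE.
    by rewrite mulr_suml; apply: eq_bigr => l _; rewrite -/(cof i); ring.
  by apply: dot_norm1 => l; rewrite mxE.
move=> w Q0 v Q01 w0 wQ; set c := \row_l _.
pose f' j := if j == j0 then 0 else s j.
apply: le_trans (maxminor_ge _ f').
pose Y : 'M[R]_k := \matrix_(i, j) if j == j0 then (a *m v^T) i 0 else C i (s j).
pose d : 'rV[R]_k := \row_j if j == j0 then \prod_l w l else (w (s j))^-1.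
have -> : colsub f' (a *m frame E w v) = Y *m diag_mx d.
  apply/matrixP => i j; rewrite mul_mx_diag [LHS]mxE [RHS]mxE [Y i j]mxE [d 0 j]mxE /f'.
  have [_|jj0] := eqVneq j j0; rewrite ?CE !mxE mulr_suml.
    by apply: eq_bigr => l _; rewrite !mxE eqxx; ring.
  by apply: eq_bigr => l _; rewrite [frame _ _ _ _ _]mxE (negbTE (sj0 j jj0)) mulrA.
have wgt0 j : 0 < w j.
  have [->|/wQ] := eqVneq j 0; first by rewrite w0.
  by apply: lt_le_trans; exact: lt_le_trans Q01.
have detY : \det Y = dot c v.
  rewrite (expand_det_col _ j0) dot_sum.
  under [RHS]eq_bigr => l _ do rewrite mxE mulr_suml.
  rewrite exchange_big /=; apply: eq_bigr => i _.
  have -> : cofactor Y i j0 = cof i.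
    rewrite /cof /cofactor; congr (_ * _); congr determinant; apply/matrixP => i' j'.
    by rewrite ![row' _ _ _ _]mxE ![col' _ _ _ _]mxE !mxE eq_sym (negbTE (neq_lift _ _)).
  rewrite [Y i j0]mxE eqxx [(a *m v^T) i 0]mxE mulr_suml.
  by apply: eq_bigr => l _; rewrite [v^T l 0]mxE; ring.
rewrite det_mulmx det_diag detY normrM mulrC ler_wpM2l // (bigD1 j0) //= mxE eqxx.
rewrite (eq_bigr (fun j => (w (s j))^-1)) => [|j /negbTE jj0]; last by rewrite mxE jj0.
rewrite prodfV ger0_norm; last first.
  by rewrite mulr_ge0 ?invr_ge0 ?prodr_ge0 // => j _; exact: ltW.
by rewrite ler_pdivlMr ?prodr_gt0 //; exact: prod_complement.
Qed.

Lemma frame_good (Phi : nat -> R -> 'rV[R]_n.+1) eta e r1 E w k (A : 'M[R]_(k, n.+1)) :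
  0 <= eta -> 0 <= e -> (forall t, Phi 0 t 0 0 = 1) ->
  (forall c, good_fun eta e r1 (fun t => dot c (Phi 0 t))) ->
  good_fun eta e r1 (fun t => maxminor (A *m frame E w (Phi 0 t))).
Proof.
move=> eta0 e0 Phi1 gP; apply: good_bigmax => // f.
have [c cP] := minor_linear E w A f.
rewrite (_ : (fun t => _) = fun t => dot c (Phi 0 t)) //.
by apply/funext => t; exact: cP.
Qed.

End Frame.

(** * No short vectors for most parameters *)

Section FrameNondivergence.
Context {R : realType} {n : nat}.
Local Notation mu := (@lebesgue_measure R).

Lemma nested_refl : reflexive (@nested R n.+1).
Proof. by move=> s; rewrite /nested submx_refl. Qed.

Lemma nested_sym : symmetric (@nested R n.+1).
Proof. by move=> s s'; rewrite /nested orbC. Qed.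

(** The k-th derivative of t -> (1, g t). *)
Definition graph_family (g : nat -> R -> 'rV[R]_n) (k : nat) (t : R) : 'rV[R]_n.+1 :=
  row_mx (k == 0)%N%:R%:M (g k t).

Lemma graph_family_coord0 g t : graph_family g 0 t 0 0 = 1.
Proof.
transitivity (graph_family g 0 t 0 (lshift n (0 : 'I_1))).
  by congr (graph_family _ _ _ _ _); exact: val_inj.
by rewrite /graph_family (row_mxEl ((0 == 0)%N%:R%:M : 'M[R]_1)) mxE.
Qed.

Lemma margin_le1 (e : R) m : margin e m 1 <= 1.
Proof. by case: m => //= m; rewrite ge_min lexx. Qed.

(** The minors are linear in (1, g), hence good with constants independent of N and w. Large scales
    lift every sublattice of intermediate rank to covolume 1 somewhere on [a, b], so [nondivergence]
    supplies the flags for [flag_short_vector]. Only Q0 depends on N and on the interval. *)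
Lemma frame_nondivergence r D (g : nat -> R -> 'rV[R]_n) : 0 < r ->
  smooth r (graph_family g) -> nondeg D (graph_family g) ->
  exists delta r1, [/\ 0 < delta, 0 < r1 < r & forall (N : 'M[R]_n) a b, \det N = 1 ->
   - r1 <= a -> a < b -> b <= r1 -> exists2 Q0 : R, 1 <= Q0 &
   forall w, w 0 = 1 -> (forall j, j != 0 -> Q0 <= w j) ->
   exists X : set R, [/\ measurable X, (mu X <= (2^-1 * (b - a))%:E)%E &
     forall t, a <= t <= b -> ~ X t -> forall z : 'rV[int]_n.+1, z != 0 ->
     exists j, delta <= `|(realmx z *m
       frame (block_mx 1%:M 0 0 N : 'M[R]_(1 + n)) w (graph_family g 0 t)) 0 j|]].
Proof.
move=> r0 sP ndP; set Phi := graph_family g.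
(* The n intermediate ranks cost a factor 2^n in [nondivergence]. *)
pose eta0 : R := 4^-1 / 2 ^+ n.
have P20 : 0 < 2 ^+ n :> R by rewrite exprn_gt0.
have eta00 : 0 < eta0 by rewrite divr_gt0.
have eta0_le : eta0 <= 4^-1.
  by rewrite ler_pdivrMr // ler_peMr // exprn_ege1 // ler1n.
have eta0n : eta0 * 2 ^+ n <= 2^-1 by rewrite divfK ?gt_eqF //; lra.
have [e [r1 [C [e01 r1r C0 gP lowP]]]] := smooth_good r0 sP ndP eta00.
have /andP[e0 e1] := e01.
pose delta := margin e n 1; have delta0 : 0 < delta by exact: margin_gt0.
exists (delta / n.+2%:R), r1; split=> //; first by rewrite divr_gt0 ?ltr0n.
move=> N a b detN ra ab rb; set E : 'M[R]_(1 + n) := block_mx _ _ _ _.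
have detE : \det E = 1 by rewrite det_lblock det1 mul1r.
have Eu : E \in @unitmx R n.+1 by rewrite unitmxE [\det _]detE unitr1.
have [c0 c00 c0P] := minor_lower_bound Eu.
pose h := (b - a) / 2; have h0 : 0 < h by rewrite /h; lra.
have hD0 : 0 < h ^+ D by rewrite exprn_gt0.
(* By [smooth_good], each |<c, (1, g)>| with [norm1 c] >= c0 reaches at least c0 h^D / C on
   [a, b]. *)
exists (Num.max 1 (C / (c0 * h ^+ D))); first by rewrite le_max lexx.
move=> w w0; set Q0 := Num.max _ _ => wQ.
have Q01 : 1 <= Q0 by rewrite le_max lexx.
pose P (s : @sublattice n.+1) := primitive (projT2 s) /\ (0 < rk s < n.+1)%N.
pose psi (s : @sublattice n.+1) t := maxminor (basis s *m frame E w (Phi 0 t)).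
have psi_good s : good_fun eta0 e r1 (psi s).
  by apply: frame_good => //; [exact: ltW|exact: ltW|exact: graph_family_coord0].
have psi0 s t : 0 <= psi s t by exact: maxminor_ge0.
have PL s : P s -> rk s \in iota 1 n by move=> [_]; rewrite mem_iota add1n.
have Prise : rises psi 1 P a b.
  move=> s [sp srk]; have [|c cc0 cP] := c0P _ (projT2 s) srk; first exact: primitive_free.
  have [T Tab cT] := lowP c a b ra ab rb.
  exists T => //; apply: le_trans (cP w Q0 (Phi 0 T) Q01 w0 wQ).
  apply: (@le_trans _ _ (C / (c0 * h ^+ D) * `|dot c (Phi 0 T)|)); last first.
    by rewrite ler_wpM2r // le_max lexx orbT.
  rewrite mulrAC ler_pdivlMr ?mulr_gt0 // mul1r; apply: le_trans cT.
  by rewrite ler_wpM2r // ltW.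
have [X [mX muX XP]] := nondivergence eta0_le e01 nested_refl nested_sym psi0 psi_good
  (ltac:(lra) : 0 < 1 <= 1) eta00 eta0n (eq_leq (size_iota 1 n)) PL ra ab rb Prise.
exists X; split=> // t tab nX z z0.
have [F [FP Fn Fv Fr]] := XP t tab nX.
have detB : \det (frame E w (Phi 0 t)) = 1.
  rewrite /Phi /graph_family det_frame //.
  move=> j; have [->|/wQ] := eqVneq j 0; first by rewrite w0 oner_eq0.
  by move=> h1; rewrite gt_eqF //; apply: lt_le_trans h1; exact: lt_le_trans Q01.
have [||||//|j jP] := @flag_short_vector R n.+1 (frame E w (Phi 0 t)) F delta _ _ _ _ _ z z0.
- by rewrite delta0 margin_le1.
- by rewrite detB normr1.
- by move=> s sF; split; [have [] := FP s sF|exact: Fv].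
- exact: Fn.
- by move=> s sp srk snest srkF; apply: Fr => //; split.
- by exists j.
Qed.

End FrameNondivergence.

(** * Inhomogeneous approximations from lattices without short vectors *)

Section LatticePoint.
Context {R : realType} {n : nat}.

(** If gamma 0 i1 = 0, column i1 has entry 1 at i1 and gamma elsewhere; with gamma the slopes of a
    curve relative to coordinate i1, it is the tangent direction. *)
Definition shear (i1 : 'I_n) (gamma : 'rV[R]_n) : 'M[R]_n :=
  1%:M + gamma^T *m delta_mx 0 i1.

Lemma det_shear i1 (gamma : 'rV[R]_n) : gamma 0 i1 = 0 -> \det (shear i1 gamma) = 1.
Proof.
move=> g0; have sE i j : shear i1 gamma i j = (i == j)%:R + gamma 0 i * (j == i1)%:R.
  by rewrite !mxE big_ord1 !mxE eqxx.
rewrite (expand_det_row _ i1) (bigD1 i1) //= big1 ?addr0 => [|j /negbTE ji1].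
  rewrite sE !eqxx g0 mul0r addr0 mul1r /cofactor -signr_odd oddD addbb mul1r.
  rewrite (_ : row' _ _ = 1%:M) ?det1 //; apply/matrixP => i j.
  rewrite ![row' _ _ _ _]mxE ![col' _ _ _ _]mxE sE mxE (inj_eq lift_inj).
  by rewrite [lift _ _ == i1]eq_sym (negbTE (neq_lift _ _)) mulr0 addr0.
by rewrite sE g0 mul0r eq_sym ji1 addr0 mul0r.
Qed.

(** Apply [covering] with target (b0, theta + b0 u): the first congruence defines q, and the others
    say how far q u - theta is from an integer vector. *)
Lemma lattice_point (delta : R) : 0 < delta -> exists2 kappa : R, 1 <= kappa &
  forall (i1 : 'I_n) (gamma u theta : 'rV[R]_n) (W : 'I_n.+1 -> R),
  (forall j, 0 < W j) ->
  (forall z : 'rV[int]_n.+1, z != 0 -> exists j, delta <= `|(realmx z *m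
     frame (block_mx 1%:M 0 0 (shear i1 gamma) : 'M[R]_(1 + n)) W
       (row_mx 1%:M u : 'rV[R]_(1 + n))) 0 j|) ->
  let Q := \prod_l W l in
  exists (q : int) (p : 'I_n -> int) (y : 'I_n -> R),
  [/\ forall i, `|y i| <= kappa, kappa * Q <= q%:~R <= 3 * kappa * Q &
     forall i, q%:~R * u 0 i - theta 0 i - (p i)%:~R =
       y i / W (rshift 1 i) + gamma 0 i * (y i1 / W (rshift 1 i1))].
Proof.
move=> d0; have [K K0 cov] := @covering R n.+1 n.+1.
have d20 : 0 < delta ^+ 2 by rewrite exprn_gt0.
pose kappa := 1 + K / delta ^+ 2.
have Kd0 : 0 < K / delta ^+ 2 by rewrite divr_gt0.
exists kappa; first by rewrite /kappa; lra.
move=> i1 gamma u theta W W0 short Q.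
have Q0 : 0 < Q by rewrite prodr_gt0.
set v : 'rV[R]_(1 + n) := row_mx 1%:M u in short.
set E : 'M[R]_(1 + n) := block_mx _ _ _ _ in short.
set B := frame E W v in short.
have Bshort (z : 'rV[int]_n.+1) : z != 0 ->
    delta ^+ 2 <= dot (map_mx intr z *m B) (map_mx intr z *m B).
  move=> /short[j dj]; apply: le_trans (dot_coord _ j).
  by rewrite lerXn2r ?nnegrE // ltW.
(* Since |x 0 0| <= kappa, this shift puts q = Q x 0 0 - b0 between kappa Q and 3 kappa Q; in
   particular q > 0. *)
pose b0 := - (2 * kappa * Q).
pose beta : 'rV[R]_(1 + n) := row_mx b0%:M (theta + b0 *: u).
have [x xK [p xp]] := cov B _ d20 Bshort (beta : 'rV[R]_n.+1).
have xk j : `|x 0 j| <= kappa.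
  have h1 := le_trans (dot_coord x j) xK; rewrite leNgt; apply/negP => h2.
  have k1 : 1 <= kappa by rewrite /kappa; lra.
  have : kappa ^+ 2 < `|x 0 j| ^+ 2 by rewrite !expr2 ltr_pM //; lra.
  have : kappa <= kappa ^+ 2 by rewrite expr2 ler_peMr //; lra.
  rewrite {1}/kappa; lra.
have beta0 : beta 0 (lshift n 0) = b0 by rewrite row_mxEl mxE.
have betaS i : beta 0 (rshift 1 i) = theta 0 i + b0 * u 0 i by rewrite row_mxEr !mxE.
have v0 : v 0 (lshift n 0) = 1 by rewrite row_mxEl mxE.
have vS i : v 0 (rshift 1 i) = u 0 i by rewrite row_mxEr.
have l0 : lshift n (0 : 'I_1) = 0 :> 'I_n.+1 by exact: val_inj.
have rl0 i : (rshift 1 i == 0 :> 'I_n.+1) = false by [].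
have xB (i : 'I_n.+1) : (x *m B^T) 0 i =
    Q * x 0 0 * v 0 i + \sum_j x 0 (rshift 1 j) * (E i (rshift 1 j) / W (rshift 1 j)).
  rewrite mxE big_ord_recl; congr (_ + _).
    have Bi0 : B i 0 = Q * v 0 i by rewrite mxE eqxx.
    rewrite [B^T ord0 i]mxE -[B i ord0]/(B i 0) Bi0 -[x 0 ord0]/(x 0 0); ring.
  apply: eq_bigr => j _; rewrite (_ : lift ord0 j = rshift 1 j); last exact: val_inj.
  by rewrite !mxE rl0.
have x0 : Q * x 0 0 = b0 + (p 0 0)%:~R.
  have := congr1 (fun M : 'rV[R]_n.+1 => M 0 (lshift n (0 : 'I_1))) xp; rewrite xB v0 mulr1.
  rewrite big1 => [|j _]; last by rewrite block_mxEur mxE mul0r mulr0.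
  by rewrite addr0 => ->; rewrite [in LHS]mxE beta0 mxE l0.
have xS i : Q * x 0 0 * u 0 i + x 0 (rshift 1 i) / W (rshift 1 i) +
    gamma 0 i * (x 0 (rshift 1 i1) / W (rshift 1 i1)) =
    theta 0 i + b0 * u 0 i + (p 0 (rshift 1 i))%:~R.
  have := congr1 (fun M : 'rV[R]_n.+1 => M 0 (rshift 1 i)) xp; rewrite xB vS.
  rewrite [in X in _ = X -> _]mxE betaS [in X in _ = _ + X -> _]mxE => <-.
  rewrite -addrA; congr (_ + _).
  under [RHS]eq_bigr => j _ do rewrite block_mxEdr [shear _ _ _ _]mxE mulrDl mulrDr.
  rewrite big_split /=; congr (_ + _).
    rewrite (bigD1 i) //= big1 ?addr0 => [|j /negbTE ji].
      by rewrite mxE eqxx mul1r.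
    by rewrite mxE eq_sym ji mul0r mulr0.
  rewrite (bigD1 i1) //= big1 ?addr0 => [|j /negbTE ji].
    by rewrite mxE big_ord1 !mxE !eqxx /=; ring.
  by rewrite mxE big_ord1 !mxE ji andbF mulr0 mul0r mulr0.
exists (p 0 0), (fun i => p 0 (rshift 1 i)), (fun i => - x 0 (rshift 1 i)); split.
- by move=> i; rewrite normrN.
- have := xk 0; rewrite ler_norml => /andP[xl xr].
  have := ler_wpM2l (ltW Q0) xl; have := ler_wpM2l (ltW Q0) xr.
  rewrite x0 /b0; lra.
- move=> i; have := xS i; rewrite x0 => h; rewrite !mulNr mulrN.
  lra.
Qed.

End LatticePoint.

(** * Lebesgue density and auxiliary estimates *)

Section Density.
Context {R : realType}.
Local Notation mu := (@lebesgue_measure R).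

Lemma density_null (A B : set R) (c : R) : measurable B -> A `<=` B -> c < 1 ->
  (forall t, A t -> forall rho0, 0 < rho0 -> exists rho, [/\ 0 < rho, rho < rho0 &
     (mu (B `&` ball t rho) <= (c * (rho *+ 2))%:E)%E]) ->
  mu.-negligible A.
Proof.
move=> mB AB c1 Ac; have := lebesgue_density mB.
apply: negligibleS => t At /= dens.
have tB : \1_B t = 1 :> R by rewrite indicE mem_set //; exact: AB.
have {}dens := dens : (mu (B `&` ball t r) / mu (ball t r))%E @[r --> 0^'+] --> (\1_B t)%:E.
rewrite tB in dens.
have cnbhs : nbhs (1%:E : \bar R) [set x | (c%:E < x)%E].
  by apply: open_nbhs_nbhs; split; [exact: open_ereal_gt_ereal|rewrite /= lte_fin].
have /nbhs_ballP[d /= d0 dP] := dens _ cnbhs.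
have [rho [rho0 rhod]] := Ac t At d d0.
have := dP rho; rewrite /ball /= sub0r normrN gtr0_norm // => /(_ rhod rho0).
have -> : mu (ball t rho) = (rho *+ 2)%:E by exact: lebesgue_measure_ball (ltW rho0).
have r20 : 0 < rho *+ 2 by rewrite mulrn_wgt0.
rewrite inver gt_eqF // lte_pdivlMr // -EFinM => h1 h2.
by have := lt_le_trans h1 h2; rewrite ltxx.
Qed.

(** For the least m with F m 0 != 0, the Taylor term of order |t|^m dominates the remainder of order
    |t|^(m+1). *)
Lemma nonvanishing (F : nat -> R -> R) (r : R) k : 0 < r ->
  (forall k (t : R), `|t| < r -> is_derive t (1 : R) (F k) (F k.+1 t)) ->
  F k 0 != 0 -> exists2 r1, 0 < r1 & forall t, 0 < `|t| < r1 -> F 0%N t != 0.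
Proof.
move=> r0 dF Fk; have ex : exists k, F k 0 != 0 by exists k.
have [m Fm mmin] := ex_minnP ex.
have [|M M0 MP] := @continuous_bounded R (F m.+1) (r / 2).
  by move=> t tr; apply: is_derive_continuous (dF _ _ _); lra.
pose c := `|F m 0| / m`!%:R.
have c0 : 0 < c by rewrite divr_gt0 ?normr_gt0 ?ltr0n ?fact_gt0.
exists (Num.min (r / 2) (c / (M + 1))).
  by rewrite lt_min; apply/andP; split; [lra|apply: divr_gt0; lra].
move=> t /andP[t0]; rewrite lt_min => /andP[tr tc]; apply/eqP => Ft.
have := @taylor_bound R F r (r / 2) M m.+1 0 t ltac:(lra) dF MP
  ltac:(by rewrite normr0; lra) ltac:(by rewrite add0r ltW).
rewrite add0r Ft sub0r normrN horner_poly big_ord_recr /= big1 ?add0r => [|i _].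
  rewrite normrM normrX normrM normfV normr_nat -/c exprS mulrCA mulrC.
  set a := `|t| ^+ m => h; have a0 : 0 < a by rewrite exprn_gt0.
  have : a * c <= a * (M * `|t|).
    by apply: le_trans h _; rewrite le_eqVlt; apply/orP; left; apply/eqP; ring.
  by rewrite ler_pM2l //; move: tc; rewrite ltr_pdivlMr; lra.
apply/eqP; rewrite mulf_eq0 mulf_eq0; apply/orP; left; apply/orP; left.
by apply/negPn/negP => /mmin; rewrite leqNgt ltn_ord.
Qed.

Lemma powR_sum n (P : R) (w : 'I_n -> R) : 0 < P ->
  \prod_i P `^ w i = P `^ (\sum_i w i).
Proof.
move=> P0; apply/esym; apply: (big_morph (fun s => P `^ s)).
  by move=> x y; rewrite powRD //; apply/implyP => _; rewrite gt_eqF.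
by rewrite powRr0.
Qed.

Lemma powR_unbounded n (w : 'I_n -> R) (C : R) : 0 <= C -> (forall i, 0 < w i) ->
  exists2 P0, 1 <= P0 & forall P, P0 <= P -> forall i, C <= P `^ w i.
Proof.
move=> C0 w0; exists (1 + \sum_i C `^ (w i)^-1).
  by rewrite lerDl; apply: sumr_ge0 => i _; exact: powR_ge0.
move=> P hP i; have CP : C `^ (w i)^-1 <= P.
  apply: le_trans hP; rewrite (bigD1 i) //=.
  have : 0 <= \sum_(j | j != i) C `^ (w j)^-1 by apply: sumr_ge0 => j _; exact: powR_ge0.
  lra.
have -> : C = (C `^ (w i)^-1) `^ w i by rewrite -powRrM mulVf ?gt_eqF // powRr1.
by rewrite ge0_ler_powR ?nnegrE ?powR_ge0 // ?(ltW (w0 i)) // (le_trans (powR_ge0 _ _) CP).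
Qed.

End Density.

(** * Holes in the bad set near a point of a curve *)

Section Curve.
Context {R : realType} {n : nat}.
Local Notation mu := (@lebesgue_measure R).
Implicit Types g : nat -> R -> 'rV[R]_n.

Definition spanning D g := forall c : 'rV[R]_n,
  (forall k, (0 < k <= D)%N -> dot c (g k 0) = 0) -> c = 0.

Lemma graph_family_l g k t (i : 'I_1) : graph_family g k t 0 (lshift n i) = (k == 0)%N%:R.
Proof.
rewrite /graph_family (row_mxEl ((k == 0)%N%:R%:M : 'M[R]_1) (g k t) 0 i).
by rewrite mxE ord1.
Qed.

Lemma graph_family_r g k t (i : 'I_n) : graph_family g k t 0 (rshift 1 i) = g k t 0 i.
Proof. by rewrite /graph_family (row_mxEr ((k == 0)%N%:R%:M : 'M[R]_1) (g k t) 0 i). Qed.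

Lemma dot_row_mx p q (a a' : 'rV[R]_p) (b b' : 'rV[R]_q) :
  dot (row_mx a b) (row_mx a' b') = dot a a' + dot b b'.
Proof. by rewrite /dot tr_row_mx mul_row_col mxE. Qed.

Lemma smooth_graph r g : smooth r g -> smooth r (graph_family g).
Proof.
move=> sg k i t tr; case: (split_ordP (i : 'I_(1 + n))) => i' ->.
  rewrite (_ : (fun t => _) = cst (k == 0)%N%:R); last first.
    by apply/funext => u; rewrite graph_family_l.
  by rewrite graph_family_l; exact: is_derive_cst.
rewrite (_ : (fun t => _) = (fun t => g k t 0 i')); last first.
  by apply/funext => u; rewrite graph_family_r.
by rewrite graph_family_r; exact: sg.
Qed.

Lemma nondeg_graph D g : spanning D g -> nondeg D (graph_family g).
Proof.
move=> ndg c cP.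
pose c0 := lsubmx (c : 'rV[R]_(1 + n)); pose c1 := rsubmx (c : 'rV[R]_(1 + n)).
have cE : c = row_mx c0 c1 by rewrite hsubmxK.
have dotE (k : nat) : dot c (graph_family g k 0) = c0 0 0 * (k == 0)%N%:R + dot c1 (g k 0).
  rewrite cE /graph_family (dot_row_mx c0 ((k == 0)%N%:R%:M : 'M[R]_1) c1 (g k 0)).
  by rewrite {1}/dot tr_scalar_mx mul_mx_scalar mxE [X in X + _]mulrC.
have r0 : c1 = 0.
  apply: ndg => k /andP[k0 kD]; have := cP k kD.
  by rewrite dotE gtn_eqF // mulr0 add0r.
have := cP 0%N isT; rewrite dotE r0 (_ : dot 0 _ = 0) ?addr0 ?mulr1 => [l0|]; last by rewrite /dot mul0mx mxE.
by rewrite cE r0 [c0]mx11_scalar l0 raddf0 row_mx0.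
Qed.

Lemma mvt_bound (f df : R -> R) (lo hi K : R) :
  (forall x : R, lo <= x <= hi -> is_derive x (1 : R) f (df x)) ->
  (forall x, lo <= x <= hi -> `|df x| <= K) ->
  forall x y : R, lo <= x <= hi -> lo <= y <= hi -> `|f y - f x| <= K * `|y - x|.
Proof.
move=> fd fK x y; wlog xy : x y / x <= y => [H xP yP|xP yP].
  have [xy|/ltW yx] := leP x y; first exact: H.
  by rewrite distrC (distrC y); exact: H.
have [z zP ->] : exists2 z, z \in `[x, y] & f y - f x = df z * (y - x).
  apply: MVT_segment => // [z|].
    by rewrite in_itv /= => zP; apply: fd; lra.
  apply: derivable_within_continuous => z; rewrite in_itv /= => zP.
  by have [] := fd z ltac:(lra).
rewrite in_itv /= in zP; rewrite normrM ler_wpM2r //; apply: fK; lra.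
Qed.

                                                                           
                                                           
(** The error at t is e plus e i1 times a multiple of the tangent. Moving along the curve to the t'
    where coordinate i1 is exact removes this tangential part from all coordinates, up to q omega d
    for the variation of the tangent; going on to u costs at most q M |u - t'|. *)
Lemma curve_hole (f f' : 'I_n -> R -> R) (i1 : 'I_n) (gamma : 'I_n -> R)
    (lo hi s omega M s0 t d q : R) (a e : 'I_n -> R) :
  (forall i x, lo <= x <= hi -> is_derive x (1 : R) (f i) (f' i x)) ->
  (forall i x, lo <= x <= hi -> `|f' i x| <= M) ->
  (forall x, lo <= x <= hi -> `|f' i1 x - s0| <= s / 2) -> `|s0| = s -> 0 < s ->
  (forall i x, i != i1 -> lo <= x <= hi -> `|f' i x - gamma i * f' i1 x| <= omega) ->
  0 <= omega -> lo <= t - d -> t + d <= hi -> 0 < d -> 0 < q -> gamma i1 = 0 ->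
  (forall i, q * f i t - a i = e i + gamma i * e i1) ->
  `|e i1| <= q * (s / 2 * d) ->
  exists2 t', `|t' - t| <= d & forall u, lo <= u <= hi -> forall i,
    `|q * f i u - a i| <= `|e i| *+ (i != i1) + q * (omega * d) + q * (M * `|u - t'|).
Proof.
move=> fd fM fs s0s sgt0 fg om lot thi d0 q0 g0 eE ei1.
have tI : lo <= t <= hi by lra.
have mvt x y : lo <= x -> x < y -> y <= hi -> exists2 z, x <= z <= y &
    f i1 y - f i1 x = f' i1 z * (y - x).
  move=> lx xy yh; have [||z zP ->] := @MVT_segment R (f i1) (f' i1) x y (ltW xy).
  - by move=> z; rewrite in_itv /= => zP; apply: fd; lra.
  - apply: derivable_within_continuous => z; rewrite in_itv /= => zP.
    by have [] := fd i1 z ltac:(lra).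
  - by exists z => //; move: zP; rewrite in_itv.
pose v := f i1 t - e i1 / q.
have vt : `|v - f i1 t| <= s / 2 * d.
  rewrite /v addrC addKr normrN normrM normfV (gtr0_norm q0).
  by rewrite ler_pdivrMr // mulrC.
(* The slope of f i1 is at least s / 2 in absolute value and of constant sign, so f i1 takes the
   value v within d of t. *)
have [t' t'P t'v] : exists2 c, c \in `[t - d, t + d] & f i1 c = v.
  apply: IVT; first by lra.
    apply: derivable_within_continuous => z; rewrite in_itv /= => zP.
    by have [] := fd i1 z ltac:(lra).
  have [z1 z1P z1E] := mvt (t - d) t ltac:(lra) ltac:(lra) ltac:(lra).
  have [z2 z2P z2E] := mvt t (t + d) ltac:(lra) ltac:(lra) ltac:(lra).
  have h1 := fs z1 ltac:(lra); have h2 := fs z2 ltac:(lra).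
  have z1E' : f i1 t - f i1 (t - d) = f' i1 z1 * d by rewrite z1E; ring.
  have z2E' : f i1 (t + d) - f i1 t = f' i1 z2 * d by rewrite z2E; ring.
  move: vt h1 h2; rewrite !ler_norml => /andP[v1 v2] /andP[h11 h12] /andP[h21 h22].
  have [s0p|s0n] := leP 0 s0.
    rewrite ger0_norm // in s0s.
    have k1 := ler_wpM2r (ltW d0) (ltac:(lra) : s / 2 <= f' i1 z1).
    have k2 := ler_wpM2r (ltW d0) (ltac:(lra) : s / 2 <= f' i1 z2).
    by rewrite ge_min le_max; apply/andP; split; apply/orP; [left|right]; lra.
  rewrite ltr0_norm // in s0s.
  have k1 := ler_wpM2r (ltW d0) (ltac:(lra) : f' i1 z1 <= - (s / 2)).
  have k2 := ler_wpM2r (ltW d0) (ltac:(lra) : f' i1 z2 <= - (s / 2)).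
  by rewrite ge_min le_max; apply/andP; split; apply/orP; [right|left]; lra.
move: t'P; rewrite in_itv /= => t'P.
have t'd : `|t' - t| <= d by rewrite ler_norml; lra.
exists t' => // u uP i.
have fu : `|f i u - f i t'| <= M * `|u - t'|.
  by apply: (mvt_bound (fd i) (fM i)); lra.
have -> : q * f i u - a i = (q * f i t' - a i) + q * (f i u - f i t') by ring.
apply: le_trans (ler_normD _ _) _; apply: lerD; last first.
  by rewrite normrM gtr0_norm // ler_wpM2l // ltW.
have [->|ii1] := eqVneq i i1.
  rewrite mulr0n add0r t'v /v (_ : q * _ - _ = 0) ?normr0; first by rewrite !mulr_ge0 // ltW.
  rewrite (_ : e i1 = q * f i1 t - a i1); last by rewrite eE g0 mul0r addr0.
  by field; rewrite gt_eqF.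
rewrite mulr1n.
have dH : `|(f i t' - gamma i * f i1 t') - (f i t - gamma i * f i1 t)| <= omega * d.
  apply: le_trans (_ : omega * `|t' - t| <= _); last by rewrite ler_wpM2l.
  apply: (@mvt_bound (fun x => f i x - gamma i * f i1 x)
    (fun x => f' i x - gamma i * f' i1 x) lo hi) => // [x xP|x xP|]; last by lra.
    by apply: is_deriveB; [exact: fd|apply: is_deriveZ; exact: fd].
  exact: fg.
have -> : q * f i t' - a i = e i + q * ((f i t' - gamma i * f i1 t') - (f i t - gamma i * f i1 t)).
  have := eE i; rewrite t'v /v => h.
  have -> : e i = q * f i t - a i - gamma i * e i1 by rewrite h; ring.
  by field; rewrite gt_eqF.
apply: le_trans (ler_normD _ _) _; rewrite lerD2l normrM gtr0_norm //.
by rewrite ler_wpM2l // ltW.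
Qed.

(** Z is the lower limit of the X k: the increasing union of the intersections of their tails. *)
Lemma liminf_measure (X : nat -> set R) (c : \bar R) :
  (forall k, measurable (X k)) -> (forall k, (mu (X k) <= c)%E) ->
  exists Z : set R, [/\ measurable Z, (mu Z <= c)%E &
    forall t, ~ Z t -> forall m, exists2 k, (m <= k)%N & ~ X k t].
Proof.
move=> mX Xc; pose Y m := \bigcap_(k in [set k | (m <= k)%N]) X k.
have mY m : measurable (Y m) by apply: bigcap_measurable => //; exists m => /=.
have mU : measurable (\bigcup_m Y m) by exact: bigcup_measurable.
exists (\bigcup_m Y m); split=> // [|t tZ m].
  have /(_ _)/wrap[|cv] := nondecreasing_cvg_mu (mu := mu) mY mU.
    apply/nondecreasing_seqP => j; apply/subsetPset => t Yt k /= jk.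
    by apply: Yt => /=; exact: ltnW.
  rewrite -(cvg_lim _ cv) //; apply: lime_le; first by apply/cvg_ex; eexists; exact: cv.
  apply: nearW => j; apply: le_trans (Xc j); apply: le_measure; rewrite ?inE; [exact: mY|exact: mX|].
  by move=> t; apply => /=.
apply: contrapT => /forall2NP h; apply: tZ; exists m => // k /= mk.
by apply: contrapT => nX; case: (h k).
Qed.

(** The scales V sharpen the coordinates other than i1 by L and pay with A in coordinate i1, whose
    error [curve_hole] cancels. Each of the three remaining terms is at most eta / P^(w i); for the
    cost of the move this uses w i <= w i1. As q <= 3 kappa P, the tolerance eps / q^(w i) is at
    least 4 eta / P^(w i). *)
Lemma hole_at_scale (f f' : 'I_n -> R -> R) (i1 : 'I_n) (gamma w : 'I_n -> R)
    (lo hi s omega M s0 t q eps kappa A L tau P : R) (a y : 'I_n -> R) :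
  let pw i := P `^ w i in
  let V i := if i == i1 then pw i / A else L * pw i in
  let d := 2 * A / s / (P * pw i1) in
  let eta := eps / (12 * kappa) in
  (forall i (x : R), lo <= x <= hi -> is_derive x (1 : R) (f i) (f' i x)) ->
  (forall i x, lo <= x <= hi -> `|f' i x| <= M) ->
  (forall x, lo <= x <= hi -> `|f' i1 x - s0| <= s / 2) -> `|s0| = s -> 0 < s ->
  (forall i x, i != i1 -> lo <= x <= hi -> `|f' i x - gamma i * f' i1 x| <= omega) ->
  0 <= omega -> 0 <= M -> lo <= t - d -> t + d <= hi -> gamma i1 = 0 ->
  (forall i, 0 < w i <= w i1) -> w i1 <= 1 ->
  0 < eps -> 1 <= kappa -> 1 <= A -> 0 < L -> 0 <= tau -> 1 <= P ->
  kappa / L <= eta -> 6 * kappa * omega * A / s <= eta ->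
  6 * kappa * M * tau * A / s <= eta ->
  kappa * P <= q <= 3 * kappa * P -> (forall i, `|y i| <= kappa) ->
  (forall i, q * f i t - a i = y i / V i + gamma i * (y i1 / V i1)) ->
  exists2 t', `|t' - t| <= d & forall u, lo <= u <= hi -> `|u - t'| < tau * d ->
    forall i, `|q * f i u - a i| < eps / q `^ w i.
Proof.
move=> pw V d eta fd fM fs s0s sgt0 fg om M0 lot thi g0 w0 w1 eps0 k1 A1 L0 tau0 P1
  etaL etaom etaM /andP[q1 q3] yk eE.
have pw1 i : 1 <= pw i.
  by have := w0 i; rewrite -(powRr0 P) => /andP[wi _]; apply: ler_powR => //; exact: ltW.
have pw0 i : 0 < pw i by apply: lt_le_trans (pw1 i).
have pwi1 i : pw i <= pw i1 by apply: ler_powR => //; have := w0 i; case/andP.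
have P0 : 0 < P by lra.
have d0 : 0 < d by rewrite /d !divr_gt0 ?mulr_gt0 //; lra.
have k0 : 0 < kappa by lra.
have q0 : 0 < q by apply: lt_le_trans q1; rewrite mulr_gt0.
have eta0 : 0 < eta by rewrite /eta divr_gt0 // mulr_gt0.
have dE : P * d = 2 * A / s / pw i1 by rewrite /d; field; rewrite !gt_eqF.
have ei1 : `|y i1 / V i1| <= q * (s / 2 * d).
  rewrite /V eqxx normrM normfV [`|pw i1 / A|]gtr0_norm; last by rewrite divr_gt0 //; lra.
  have -> : (pw i1 / A)^-1 = s / 2 * (P * d).
    by rewrite dE; field; rewrite !gt_eqF //; lra.
  have sd0 : 0 <= s / 2 * d by rewrite mulr_ge0 ?(ltW d0) //; lra.
  apply: le_trans (_ : kappa * (s / 2 * (P * d)) <= _).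
    by apply: ler_wpM2r => //; rewrite mulrCA mulr_ge0 // ltW.
  have := ler_wpM2r sd0 q1; lra.
have [t' t'd t'P] := curve_hole fd fM fs s0s sgt0 fg om lot thi d0 q0 g0 eE ei1.
exists t' => // u uP ut i; have := t'P u uP i.
have T1 : `|y i / V i| *+ (i != i1) <= eta / pw i.
  rewrite /V; have [_|_] := eqVneq i i1; first by rewrite mulr0n divr_ge0 // ltW.
  rewrite mulr1n normrM normfV [`|L * _|]gtr0_norm ?mulr_gt0 //.
  rewrite invfM mulrA ler_wpM2r ?invr_ge0 ?(ltW (pw0 i)) //.
  by apply: le_trans etaL; rewrite ler_wpM2r // invr_ge0 ltW.
have etapw : eta / pw i1 <= eta / pw i.
  by rewrite ler_wpM2l ?(ltW eta0) // lef_pV2 ?posrE.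
have T2 : q * (omega * d) <= eta / pw i.
  apply: le_trans etapw; apply: le_trans (_ : 3 * kappa * P * (omega * d) <= _).
    by apply: ler_wpM2r => //; rewrite mulr_ge0 // ltW.
  have -> : 3 * kappa * P * (omega * d) = 6 * kappa * omega * A / s / pw i1.
    transitivity (3 * kappa * omega * (P * d)); first by ring.
    by rewrite dE; field; rewrite !gt_eqF.
  by rewrite ler_wpM2r // invr_ge0 ltW.
have T3 : q * (M * `|u - t'|) <= eta / pw i.
  apply: le_trans etapw; apply: le_trans (_ : 3 * kappa * P * (M * (tau * d)) <= _).
    apply: ler_pM => //; rewrite ?mulr_ge0 //; first by rewrite ltW.
    by rewrite ler_wpM2l // ltW.
  have -> : 3 * kappa * P * (M * (tau * d)) = 6 * kappa * M * tau * A / s / pw i1.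
    transitivity (3 * kappa * M * tau * (P * d)); first by ring.
    by rewrite dE; field; rewrite !gt_eqF.
  by rewrite ler_wpM2r // invr_ge0 ltW.
move=> /le_lt_trans; apply; apply: le_lt_trans (lerD (lerD T1 T2) T3) _.
have qw : q `^ w i <= 3 * kappa * pw i.
  have /andP[wi0 wi1] := w0 i.
  apply: le_trans (_ : (3 * kappa * P) `^ w i <= _).
    by apply: ge0_ler_powR; rewrite ?nnegrE ?mulr_ge0 // ?(ltW q0) ?(ltW wi0) ?(ltW k0) ?(ltW P0).
  rewrite powRM ?mulr_ge0 ?(ltW k0) ?(ltW P0) //.
  apply: ler_wpM2r; first exact: (ltW (pw0 i)).
  rewrite -[leRHS]powRr1; last by lra.
  by apply: ler_powR; lra.
have qw0 : 0 < q `^ w i by exact: powR_gt0.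
apply: lt_le_trans (_ : eps / (3 * kappa * pw i) <= _); last first.
  by rewrite ler_wpM2l ?(ltW eps0) // lef_pV2 ?posrE // !mulr_gt0.
have -> : eps / (3 * kappa * pw i) = 4 * (eta / pw i).
  by rewrite /eta; field; rewrite !gt_eqF.
have : 0 < eta / pw i by rewrite divr_gt0.
lra.
Qed.

(** The hole has length 2 tau d and lies in a ball of length 4 d. *)
Lemma measure_hole (B : set R) (t t' d tau : R) : measurable B -> 0 < d ->
  0 < tau <= 2^-1 -> `|t' - t| <= d -> B `&` ball t' (tau * d) = set0 ->
  (mu (B `&` ball t (2 * d)) <= ((1 - tau / 2) * ((2 * d) *+ 2))%:E)%E.
Proof.
move=> mB d0 tau01 t'd B0; have td0 : 0 < tau * d by rewrite mulr_gt0 //; lra.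
have mb x e : measurable (ball x e : set R) by exact: measurable_realfun.measurable_ball.
have td : tau * d <= 2^-1 * d by rewrite ler_wpM2r //; lra.
have sub : (B `&` ball t (2 * d)) `|` ball t' (tau * d) `<=` ball t (2 * d).
  move=> x [[_ //]|]; rewrite /ball /= => xt'.
  rewrite (_ : t - x = (t - t') + (t' - x)); last by ring.
  apply: le_lt_trans (ler_normD _ _) _; rewrite distrC; lra.
have m1 : measurable (B `&` ball t (2 * d)) := measurableI _ _ mB (mb _ _).
have : (mu ((B `&` ball t (2 * d)) `|` ball t' (tau * d)) <= mu (ball t (2 * d)))%E.
  apply: le_measure; rewrite ?inE; [|exact: mb|exact: sub].
  exact: (measurableU _ _ m1 (mb _ _)).
have -> : mu ((B `&` ball t (2 * d)) `|` ball t' (tau * d)) =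
    (mu (B `&` ball t (2 * d)) + mu (ball t' (tau * d)))%E.
  apply: measureU; [exact: m1|exact: mb|].
  by rewrite setIAC B0 set0I.
have -> : mu (ball t' (tau * d)) = ((tau * d) *+ 2)%:E.
  exact: lebesgue_measure_ball (ltW td0).
have -> : mu (ball t (2 * d)) = ((2 * d) *+ 2)%:E.
  by apply: lebesgue_measure_ball; lra.
rewrite -leeBrDr // -EFinB => /le_trans; apply; rewrite lee_fin; lra.
Qed.

End Curve.

(** * Bad parameters on a spanning curve form a null set near 0 *)

Section CurveNull.
Context {R : realType} {n : nat}.
Local Notation mu := (@lebesgue_measure R).

Definition frame_weight (V : 'I_n -> R) (l : 'I_n.+1) : R :=
  match fintype.split (l : 'I_(1 + n)) with inl _ => 1 | inr j => V j end.

Lemma frame_weight0 V : frame_weight V 0 = 1.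
Proof. by rewrite /frame_weight; case: splitP => // j /=; rewrite add1n. Qed.

Lemma frame_weightS V j : frame_weight V (rshift 1 j) = V j.
Proof.
by rewrite /frame_weight -[X in fintype.split X]/(unsplit (inr j)) unsplitK.
Qed.

Lemma frame_weight_prod V : \prod_l frame_weight V l = \prod_j V j.
Proof.
rewrite big_ord_recl frame_weight0 mul1r; apply: eq_bigr => j _.
by rewrite -frame_weightS; congr frame_weight; exact: val_inj.
Qed.

Lemma frame_weight_ge V Q0 : (forall j, Q0 <= V j) ->
  forall l, l != 0 -> Q0 <= frame_weight V l.
Proof.
move=> VQ l; case: (split_ordP (l : 'I_(1 + n))) => j ->; last by rewrite frame_weightS.
by rewrite (_ : lshift n j = 0 :> 'I_n.+1) ?eqxx //; apply: val_inj; rewrite /= ord1.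
Qed.

(** The n - 1 factors L are balanced by L^(n-1) in coordinate i1, so the product of the scales,
    which is the size of q, is still P. *)
Lemma scale_prod (i1 : 'I_n) (w : 'I_n -> R) (L P : R) : 0 < L -> 0 < P -> \sum_i w i = 1 ->
  \prod_j (if j == i1 then P `^ w j / L ^+ n.-1 else L * P `^ w j) = P.
Proof.
move=> L0 P0 w1; rewrite (bigD1 i1) //= eqxx.
rewrite (eq_bigr (fun j => L * P `^ w j)) => [|j /negbTE ->] //.
rewrite big_split /= prodr_const cardC1 card_ord.
have -> : P `^ w i1 / L ^+ n.-1 * (L ^+ n.-1 * \prod_(j < n | j != i1) P `^ w j) =
    \prod_j P `^ w j.
  by rewrite [RHS](bigD1 i1) //=; field; rewrite expf_neq0 // gt_eqF.
by rewrite powR_sum // w1 powRr1 // ltW.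
Qed.

Lemma negligible_cover (A Z : set R) (c : \bar R) : measurable A -> measurable Z ->
  mu.-negligible (A `\` Z) -> (mu Z <= c)%E -> (mu A <= c)%E.
Proof.
move=> mA mZ [N [mN N0 AN]] Zc; apply: le_trans Zc; rewrite -[leRHS]adde0 -N0.
apply: le_trans (measureU2 _ _ _) => //; apply: le_measure; rewrite ?inE //.
  exact: measurableU.
by move=> x Ax; have [Zx|nZ] := pselect (Z x); [left|right; exact: AN].
Qed.

Lemma local_tangent r g (i1 : 'I_n) (t0 : R) (gamma : 'I_n -> R) omega : smooth r g ->
  `|t0| < r -> g 1%N t0 0 i1 != 0 -> 0 < omega ->
  (forall i, i != i1 -> gamma i = g 1%N t0 0 i / g 1%N t0 0 i1) ->
  exists2 e, 0 < e & forall x, `|x - t0| < e ->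
    `|g 1%N x 0 i1 - g 1%N t0 0 i1| <= `|g 1%N t0 0 i1| / 2 /\
    forall i, i != i1 -> `|g 1%N x 0 i - gamma i * g 1%N x 0 i1| <= omega.
Proof.
move=> sg t0r gt0 om0 gammaE.
have gc i : {for t0, continuous (fun x => g 1%N x 0 i)}.
  exact: is_derive_continuous (sg 1%N i t0 t0r).
have near1 : \forall x \near t0, `|g 1%N x 0 i1 - g 1%N t0 0 i1| <= `|g 1%N t0 0 i1| / 2.
  have s20 : 0 < `|g 1%N t0 0 i1| / 2 by rewrite divr_gt0 // normr_gt0.
  have /cvgr_dist_le /(_ _ s20) := gc i1.
  by apply: filterS => x; rewrite distrC.
have near2 : \forall x \near t0, forall i, i != i1 ->
    `|g 1%N x 0 i - gamma i * g 1%N x 0 i1| <= omega.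
  apply: (@filter_forall R _ (fun i x => i != i1 ->
    `|g 1%N x 0 i - gamma i * g 1%N x 0 i1| <= omega) (nbhs t0) _) => i.
  have [->|ii1] := eqVneq i i1; first by apply: nearW.
  have hc : {for t0, continuous (fun x => g 1%N x 0 i - gamma i * g 1%N x 0 i1)}.
    by apply: cvgB; [exact: gc|apply: cvgM; [exact: cvg_cst|exact: gc]].
  have /cvgr_dist_le /(_ _ om0) := hc.
  apply: filterS => x; rewrite gammaE // divfK // subrr sub0r normrN => H _.
  exact: H.
have : \forall x \near t0, `|g 1%N x 0 i1 - g 1%N t0 0 i1| <= `|g 1%N t0 0 i1| / 2 /\
    forall i, i != i1 -> `|g 1%N x 0 i - gamma i * g 1%N x 0 i1| <= omega.
  exact: filterI near1 near2.
move=> /nbhs_ballP[e /= e0 eP].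
exists e => // x xe; apply: eP; by rewrite /ball /= distrC.
Qed.

End CurveNull.

Definition no_short_vector (R : realType) n (delta : R) (E : 'M[R]_n.+1) (W : 'I_n.+1 -> R)
    (v : 'rV[R]_n.+1) :=
  forall z : 'rV[int]_n.+1, z != 0 -> exists j, delta <= `|(realmx z *m frame E W v) 0 j|.

Definition bad_near (R : realType) n (g : R -> 'rV[R]_n) (w theta : 'rV[R]_n) (eps N0 : R)
    (t : R) :=
  forall q : int, N0 <= q%:~R -> exists i, forall p : int,
  eps / q%:~R `^ w 0 i <= `|q%:~R * g t 0 i - theta 0 i - p%:~R|.

Lemma window_step (R : realType) (t0 rho t t' u d e : R) :
  t0 - rho / 2 <= t <= t0 + rho / 2 -> 0 < d -> d <= rho / 4 -> e <= d ->
  `|t' - t| <= d -> `|t' - u| < e -> t0 - rho <= u <= t0 + rho.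
Proof. rewrite ler_norml ltr_norml; lra. Qed.

                                                                               
                                                                                
                                                                                    
(** On an interval so short that the tangent varies by at most omega, let P run through scales
    tending to infinity. A parameter outside the exceptional set X k has no short vector at scale
    [Pk k], hence a hole of B nearby. Parameters outside infinitely many X k are not density points
    of B, so up to a null set B lies in the lower limit Z of the X k, which has at most half of the
    measure. *)
Lemma half_null (R : realType) n r (g : nat -> R -> 'rV[R]_n) (w theta : 'rV[R]_n)
    (eps N0 : R) (B : set R) (i1 : 'I_n) (kappa delta ra M t0 : R) :
  let mu := @lebesgue_measure R in
  smooth r g -> 0 < eps -> measurable B ->
  (forall i, 0 < w 0 i) -> \sum_i w 0 i = 1 ->
  (forall t, B t -> bad_near (g 0%N) w theta eps N0 t) ->
  (forall i, w 0 i <= w 0 i1) -> 1 <= kappa -> ra < r -> 0 <= M ->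
  (forall t, `|t| <= ra -> forall i, `|g 1%N t 0 i| <= M) ->
  `|t0| < ra -> g 1%N t0 0 i1 != 0 ->
  (forall (N : 'M[R]_n) a b, \det N = 1 -> - ra <= a -> a < b -> b <= ra ->
   exists2 Q0 : R, 1 <= Q0 & forall W, W 0 = 1 -> (forall j, j != 0 -> Q0 <= W j) ->
   exists X : set R, [/\ measurable X, (mu X <= (2^-1 * (b - a))%:E)%E &
     forall t, a <= t <= b -> ~ X t ->
     no_short_vector delta (block_mx 1%:M 0 0 N : 'M[R]_(1 + n)) W (graph_family g 0 t)]) ->
  (forall (i1 : 'I_n) (gamma u theta : 'rV[R]_n) (W : 'I_n.+1 -> R),
  (forall j, 0 < W j) ->
  no_short_vector delta (block_mx 1%:M 0 0 (shear i1 gamma) : 'M[R]_(1 + n)) W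
       (row_mx 1%:M u : 'rV[R]_(1 + n)) ->
  let Q := \prod_l W l in
  exists (q : int) (p : 'I_n -> int) (y : 'I_n -> R),
  [/\ forall i, `|y i| <= kappa, kappa * Q <= q%:~R <= 3 * kappa * Q &
     forall i, q%:~R * u 0 i - theta 0 i - (p i)%:~R =
       y i / W (rshift 1 i) + gamma 0 i * (y i1 / W (rshift 1 i1))]) ->
  forall rho0, 0 < rho0 -> exists rho, [/\ 0 < rho, rho < rho0 &
  (mu (B `&` ball t0 rho) <= (2^-1 * (rho *+ 2))%:E)%E].
Proof.
move=> mu sg eps0 mB w0 w1 BP wmax k1 rar M0 gM t0ra gt0 frameP latticeP rho0.
move=> rho00; have s00 := gt0.
set s0 := g 1%N t0 0 i1 in s00 *; set s := `|s0|.
have s_gt0 : 0 < s by rewrite normr_gt0.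
pose gamma : 'rV[R]_n := \row_i (if i == i1 then 0 else g 1%N t0 0 i / s0).
have gamma1 : gamma 0 i1 = 0 by rewrite mxE eqxx.
have k0 : 0 < kappa by lra.
pose eta := eps / (12 * kappa); have eta0 : 0 < eta by rewrite divr_gt0 // mulr_gt0.
(* The order of choices matters: L, A, omega and tau depend only on eps, kappa, M and the speed s at
   t0; the interval comes next, then Q0, and P last. *)
pose L := kappa / eta + 1.
have L1 : 1 <= L by rewrite lerDr divr_ge0 // ltW.
have L0 : 0 < L by lra.
have Leta : kappa / L <= eta.
  by rewrite ler_pdivrMr // /L mulrDr mulrCA divff ?gt_eqF // mulr1 mulr1; lra.
pose A := L ^+ n.-1; have A1 : 1 <= A by exact: exprn_ege1.
have A0 : 0 < A by lra.
pose omega := eta * s / (6 * kappa * A).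
have A6 : 0 < 6 * kappa * A by apply: mulr_gt0 => //; apply: mulr_gt0.
have es0 : 0 < eta * s by exact: mulr_gt0.
have om0 : 0 < omega by exact: divr_gt0.
have ometa : 6 * kappa * omega * A / s <= eta.
  by rewrite le_eqVlt; apply/orP; left; apply/eqP; rewrite /omega; field; rewrite !gt_eqF.
pose tau := Num.min 2^-1 (eta * s / (6 * kappa * A * (M + 1))).
have tau0 : 0 < tau.
  rewrite lt_min; apply/andP; split; first lra.
  by apply: divr_gt0 => //; apply: mulr_gt0 => //; lra.
have tau2 : tau <= 2^-1 by rewrite ge_min lexx.
have taueta : 6 * kappa * M * tau * A / s <= eta.
  have h : tau <= eta * s / (6 * kappa * A * (M + 1)) by rewrite ge_min lexx orbT.
  have c0 : 0 <= 6 * kappa * (M + 1) * A / s.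
    by rewrite divr_ge0 ?(ltW s_gt0) // !mulr_ge0 ?ltW //; lra.
  have := ler_wpM2l c0 h.
  have -> : 6 * kappa * (M + 1) * A / s * (eta * s / (6 * kappa * A * (M + 1))) = eta.
    by field; rewrite !gt_eqF //; lra.
  apply: le_trans.
  have -> : 6 * kappa * M * tau * A / s = 6 * kappa * A / s * tau * M by ring.
  have -> : 6 * kappa * (M + 1) * A / s * tau = 6 * kappa * A / s * tau * (M + 1) by ring.
  rewrite ler_wpM2l ?lerDl // !mulr_ge0 ?invr_ge0 ?ltW //.
clearbody tau omega.
have [e0 e00 loc] := @local_tangent R n r g i1 t0 (fun i => gamma 0 i) omega sg (lt_trans t0ra rar) gt0 om0
  ltac:(by move=> i ii1; rewrite /gamma /= mxE (negbTE ii1)).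
pose rho2 := Num.min (e0 / 2) (Num.min ((ra - `|t0|) / 2) rho0).
have [rho20 rho2e rho2r rho20'] : [/\ 0 < rho2, rho2 <= e0 / 2, rho2 <= (ra - `|t0|) / 2 & rho2 <= rho0].
  split; rewrite /rho2 ?ge_min ?lexx ?orbT // !lt_min rho00 andbT; apply/andP; split; lra.
clearbody rho2.
(* Parameters t are taken within rho2 / 2 of t0, while the displaced points and their holes may use
   the window of radius rho2. *)
exists (rho2 / 2); split; [lra|lra|].
set lo := t0 - rho2; set hi := t0 + rho2.
have lohi x : lo <= x <= hi -> `|x| <= ra /\ `|x - t0| < e0.
  move=> xP; split; last by rewrite ltr_norml /lo /hi in xP *; lra.
  have xt : `|x - t0| <= rho2 by rewrite ler_norml /lo /hi in xP *; lra.
  have := ler_normD (x - t0) t0; rewrite subrK; lra.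
have detN := det_shear gamma1.
have [lo1 _] := lohi lo ltac:(rewrite /lo /hi; lra).
have [hi1 _] := lohi hi ltac:(rewrite /lo /hi; lra).
move: lo1 hi1; rewrite !ler_norml => /andP[lo1 _] /andP[_ hi1].
have aJ : - ra <= t0 - rho2 / 2 by clear -lo1 rho20; rewrite /lo in lo1; lra.
have bJ : t0 + rho2 / 2 <= ra by clear -hi1 rho20; rewrite /hi in hi1; lra.
have abJ : t0 - rho2 / 2 < t0 + rho2 / 2 by clear -rho20; lra.
have [Q0 Q01 fr] := frameP _ _ _ detN aJ abJ bJ.
have QA0 : 0 <= Q0 * A by clear -Q01 A0; apply: mulr_ge0; lra.
have [P0 P01 PQ] := @powR_unbounded R n (fun i => w 0 i) (Q0 * A) QA0 w0.
pose V (P : R) j := if j == i1 then P `^ w 0 j / L ^+ n.-1 else L * P `^ w 0 j.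
have VQ P : P0 <= P -> forall j, Q0 <= V P j.
  move=> /PQ pQ j; rewrite /V -/A; case: ifP => _; first by rewrite ler_pdivlMr.
  have h1 : Q0 <= Q0 * A by clear -Q01 A1; rewrite ler_peMr //; lra.
  apply: le_trans (le_trans h1 (pQ j)) _.
  by rewrite ler_peMl // powR_ge0.
(* The three terms ensure that the scales exceed Q0, that q >= N0 and that d <= rho2 / 4. *)
pose K0 := P0 + `|N0| + 8 * A / (s * rho2).
have K00 : 0 < 8 * A / (s * rho2) by rewrite divr_gt0 ?mulr_gt0.
have N0K : N0 <= `|N0| by exact: ler_norm.
have NN0 : 0 <= `|N0| by [].
pose k0' := Num.bound K0.
pose Pk k : R := (k0' + k).+1%:R.
have PkK k : K0 <= Pk k.
  have K0ge : 0 <= K0 by clear -P01 K00 NN0; rewrite /K0; lra.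
  have := archi_boundP K0ge; move=> /ltW/le_trans; apply.
  by rewrite ler_nat -addnS leq_addr.
have /choice[X XP] : forall k, exists X : set R, [/\ measurable X,
    (mu X <= (2^-1 * ((rho2 / 2) *+ 2))%:E)%E &
    forall t, t0 - rho2 / 2 <= t <= t0 + rho2 / 2 -> ~ X t ->
      no_short_vector delta (block_mx 1%:M 0 0 (shear i1 gamma) : 'M[R]_(1 + n))
        (frame_weight (V (Pk k))) (graph_family g 0 t)].
  move=> k; have PP0 : P0 <= Pk k.
    by clear -PkK NN0 K00; have := PkK k; rewrite /K0; lra.
  have [Xk [mX lX XP]] := fr _ (frame_weight0 _) (frame_weight_ge (VQ _ PP0)).
  exists Xk; split=> //; apply: le_trans lX _; rewrite lee_fin; clear; lra.
have [Z [mZ Zc Zio]] := liminf_measure (fun k => let: And3 m _ _ := XP k in m)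
  (fun k => let: And3 _ m _ := XP k in m).
have mBb : measurable (B `&` ball t0 (rho2 / 2)).
  exact: measurableI mB (measurable_realfun.measurable_ball _ _).
apply: (negligible_cover mBb mZ _ Zc).
apply: (@density_null R _ B (1 - tau / 2)) => //; [by move=> x [[]]|clear -tau0; lra|].
move=> t [[Bt tball] nZt] rho1 rho10.
(* Taking k >= m makes d at most rho1 / 4, so the ball of radius 2 d is smaller than rho1. *)
pose m := Num.bound (8 * A / (s * rho1)).
have [k mk nX] := Zio t nZt m.
set P := Pk k.
have P1 : 1 <= P by rewrite ler1n.
have P00 : 0 < P by clear -P1; lra.
have PP : K0 <= P by exact: PkK.
pose d := 2 * A / s / (P * P `^ w 0 i1).
have Pw1 : 1 <= P `^ w 0 i1.
  by rewrite -(powRr0 P); apply: ler_powR => //; exact: ltW.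
have Pw0 : 0 < P `^ w 0 i1 by clear -Pw1; lra.
have d0 : 0 < d.
  by apply: divr_gt0; [apply: divr_gt0 => //; apply: mulr_gt0|apply: mulr_gt0].
have dP : P * d <= 2 * A / s.
  have -> : P * d = 2 * A / s / P `^ w 0 i1 by clear -P00 Pw0 s_gt0; rewrite /d; field; rewrite !gt_eqF.
  by rewrite ler_pdivrMr // ler_peMr // divr_ge0 ?mulr_ge0 ?ltW.
have dsmall c : 0 < c -> 8 * A / (s * c) <= P -> d <= c / 4.
  clear -d0 dP s_gt0 A0; move=> c0 h; have := ler_wpM2r (ltW d0) h; move=> /le_trans /(_ dP).
  have -> : 8 * A / (s * c) * d = (2 * A / s) * (4 / c * d) by field; rewrite !gt_eqF.
  rewrite ger_pMr ?divr_gt0 ?mulr_gt0 // => h'.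
  by rewrite ler_pdivlMr // mulrC -[leRHS]mul1r -ler_pdivrMr //; lra.
have d_rho2 : d <= rho2 / 4.
  by apply: dsmall => //; clear -PP NN0 P01; move: PP; rewrite /K0; lra.
have d_rho1 : d <= rho1 / 4.
  apply: dsmall => //; have h : 0 <= 8 * A / (s * rho1).
    by rewrite divr_ge0 ?mulr_ge0 ?ltW.
  apply: le_trans (ltW (archi_boundP h)) _; rewrite ler_nat.
  by apply: leq_trans mk _; rewrite -addSn leq_addl.
exists (2 * d); split; [clear -d0; lra|clear -d_rho1 rho10; lra|].
have tJ : t0 - rho2 / 2 <= t <= t0 + rho2 / 2.
  by clear -tball; move: tball; rewrite /ball /= ltr_norml; lra.
have [_ _ /(_ t tJ nX) short] := XP k.
have PP0 : P0 <= P by clear -PP NN0 K00; move: PP; rewrite /K0; lra.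
have Vpos j : 0 < V P j by apply: lt_le_trans (VQ P PP0 j); clear -Q01; lra.
have Wpos l : 0 < frame_weight (V P) l.
  by rewrite /frame_weight; case: fintype.split.
have [q [p [y [yk]]]] := latticeP i1 gamma (g 0%N t) theta (frame_weight (V P)) Wpos short.
rewrite frame_weight_prod scale_prod // => qP eqs.
have lot : lo <= t - d by clear -tJ d_rho2 rho20; rewrite /lo; lra.
have thi : t + d <= hi by clear -tJ d_rho2 rho20; rewrite /hi; lra.
have [t' t'd t'P] := @hole_at_scale R n (fun i x => g 0%N x 0 i) (fun i x => g 1%N x 0 i)
  i1 (fun i => gamma 0 i) (fun i => w 0 i) lo hi s omega M s0 t q%:~R eps kappa A L tau P
  (fun i => theta 0 i + (p i)%:~R) y
  (fun i x xP => sg 0%N i x (le_lt_trans (lohi x xP).1 rar))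
  (fun i x xP => gM x (lohi x xP).1 i)
  (fun x xP => (loc x (lohi x xP).2).1) erefl s_gt0
  (fun i x ii1 xP => (loc x (lohi x xP).2).2 i ii1) (ltW om0) M0 lot thi gamma1
  (fun i => introT andP (conj (w0 i) (wmax i)))
  ltac:(by rewrite -w1 (bigD1 i1) //= lerDl; apply: sumr_ge0 => i _; exact: ltW)
  eps0 k1 A1 L0 (ltW tau0) P1 Leta ometa taueta qP yk
  ltac:(by move=> i; rewrite opprD addrA eqs !frame_weightS).
apply: (measure_hole mB d0 _ t'd); first by rewrite tau0.
rewrite -subset0 => u [Bu]; rewrite /ball /= => ut'.
have Nq : N0 <= q%:~R.
  have /andP[+ _] := qP; apply: le_trans; apply: le_trans (_ : P <= _).
    by clear -PP N0K P01 K00; move: PP; rewrite /K0; lra.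
  by rewrite ler_peMl // ltW.
have [i iP] := BP u Bu q Nq.
have td' : tau * d <= d by rewrite ler_piMl ?(ltW d0) //; clear -tau2; lra.
have uP : lo <= u <= hi := window_step tJ d0 d_rho2 td' t'd ut'.
rewrite distrC in ut'; have := t'P u uP ut' i.
by rewrite ltNge opprD addrA iP.
Qed.

(** By [half_null] no t0 near 0 with nonzero velocity in coordinate i1 is a density point of B.
    Spanning makes some derivative of that coordinate nonzero at 0, so by [nonvanishing] its
    velocity is nonzero at all t0 != 0 close to 0. *)
Lemma curve_null (R : realType) n D r (g : nat -> R -> 'rV[R]_n) (w theta : 'rV[R]_n)
    (eps N0 : R) (B : set R) :
  0 < r -> smooth r g -> spanning D g -> 0 < eps -> measurable B ->
  (forall i, 0 < w 0 i) -> \sum_i w 0 i = 1 ->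
  (forall t, B t -> bad_near (g 0%N) w theta eps N0 t) ->
  exists2 r1, 0 < r1 & (@lebesgue_measure R).-negligible (B `&` ball 0 r1).
Proof.
move=> r0 sg sp eps0 mB w0 w1 BP.
case: (pickP (fun _ : 'I_n => true)) => [i0 _|no]; last first.
  have : \sum_i w 0 i = 0 by apply: big1 => i; have := no i.
  by rewrite w1 => /eqP; rewrite oner_eq0.
pose i1 := [arg max_(i > i0) w 0 i]%O.
have wmax i : w 0 i <= w 0 i1.
  by rewrite /i1; case: arg_maxP => // j _ /(_ i isT).
have [delta [ra [delta0 /andP[ra0 rar] fr]]] :=
  frame_nondivergence r0 (smooth_graph sg) (nondeg_graph sp).
have [kappa k1 lp] := @lattice_point R n delta delta0.
have [k gk] : exists k, g k.+1 0 0 i1 != 0.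
  apply: contrapT => /forallNP no.
  have /matrixP /(_ 0 i1) : delta_mx 0 i1 = 0 :> 'rV[R]_n.
    apply: sp => k /andP[k0 _]; rewrite dot_sum (bigD1 i1) //= big1 => [|i ii1].
      by rewrite addr0 -(prednK k0); have /negP/negPn/eqP -> := no k.-1; rewrite mulr0.
    by rewrite mxE eqxx (negbTE ii1) mul0r.
  by rewrite !mxE !eqxx => /eqP; rewrite oner_eq0.
have [rb rb0 rbP] := @nonvanishing R (fun k t => g k.+1 t 0 i1) r k r0
  (fun k => sg k.+1 i1) gk.
have [M M0 MP] := smooth_bounded 1 sg rar.
exists (Num.min ra rb); first by rewrite lt_min ra0.
have sub : B `&` ball 0 (Num.min ra rb) `<=`
    [set 0] `|` ((B `&` ball 0 (Num.min ra rb)) `\` [set 0]).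
  by move=> t Bt; have [->|t0] := eqVneq t 0; [left|right; split=> //; exact/eqP].
suff : (@lebesgue_measure R).-negligible ([set 0] `|`
    ((B `&` ball 0 (Num.min ra rb)) `\` [set 0])) by apply: negligibleS.
apply: negligibleU; first by exists [set 0]; split=> //; exact: lebesgue_measure_set1.
apply: (@density_null R _ B 2^-1) => //; [by move=> t [[]]|lra|].
move=> t0 [[_ +] /eqP t00] rho0 rho00; rewrite /ball /= sub0r normrN lt_min => /andP[ta tb].
apply: (@half_null R n r g w theta eps N0 B i1 kappa delta ra M t0) => //.
by apply: rbP; rewrite normr_gt0 t00.
Qed.

(** * Power series in one variable *)

Section PowerSeries.
Context {R : realType}.

(** Radius of convergence at least rho, in a form that passes easily to the differentiated
    series. *)
Definition geom_bounded (rho : R) (b : nat -> R) :=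
  forall rho', 0 < rho' < rho -> exists C, forall k, `|b k| * rho' ^+ k <= C.

Lemma exprn_mul_bounded (q : R) : 0 < q < 1 -> forall k, k.+1%:R * q ^+ k <= (1 - q)^-1.
Proof.
move=> /andP[q0 q1] k; rewrite -[leRHS]mul1r ler_pdivlMr; last by lra.
have -> : k.+1%:R * q ^+ k * (1 - q) = (\sum_(i < k.+1) q ^+ k) * (1 - q).
  by rewrite sumr_const card_ord mulr_natl.
apply: (@le_trans _ _ ((\sum_(i < k.+1) q ^+ i) * (1 - q))).
  apply: ler_wpM2r; first by lra.
  by apply: ler_sum => i _; rewrite ler_wiXn2l ?ltW // -ltnS.
have -> : (\sum_(i < k.+1) q ^+ i) * (1 - q) = 1 - q ^+ k.+1.
  by rewrite -[in RHS](expr1n _ k.+1) subrXX mulrC; congr (_ * _);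
    apply: eq_bigr => i _; rewrite expr1n mul1r.
by rewrite gerBl exprn_ge0 // ltW.
Qed.

Lemma geom_bounded_diffs rho b : geom_bounded rho b -> geom_bounded rho (pseries_diffs b).
Proof.
move=> bb r' /andP[r'0 r'r]; pose r'' := (r' + rho) / 2.
have r''0 : 0 < r'' by rewrite /r''; lra.
have [C bC] := bb r'' (ltac:(rewrite /r''; lra) : 0 < r'' < rho).
have C0 : 0 <= C by apply: le_trans (bC 0%N); rewrite mulr_ge0 // exprn_ge0 // ltW.
have q01 : 0 < r' / r'' < 1.
  by rewrite divr_gt0 //= ltr_pdivrMr // mul1r /r''; lra.
exists (C / r'' * (1 - r' / r'')^-1) => k; rewrite /pseries_diffs normrM normr_nat.
have -> : k.+1%:R * `|b k.+1| * r' ^+ k =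
    (`|b k.+1| * r'' ^+ k.+1 / r'') * (k.+1%:R * (r' / r'') ^+ k).
  have r''n : r'' != 0 by rewrite gt_eqF.
  have r''k : r'' ^+ k != 0 by rewrite expf_neq0.
  by clearbody r''; rewrite expr_div_n exprS; field; rewrite r''k.
have q0 : 0 <= (r' / r'') ^+ k by rewrite exprn_ge0 // ltW //; case/andP: q01.
have i0 : 0 <= r''^-1 by rewrite invr_ge0 ltW.
clearbody r''; apply: ler_pM.
- by rewrite !mulr_ge0 // exprn_ge0 // ltW.
- by rewrite mulr_ge0.
- by apply: ler_wpM2r => //; exact: bC.
- exact: exprn_mul_bounded.
Qed.

Lemma geom_bounded_cvg rho b K : geom_bounded rho b -> `|K| < rho -> cvgn (pseries b K).
Proof.
move=> bb Kr; pose r' := (`|K| + rho) / 2.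
have K0 := normr_ge0 K.
have r'0 : 0 < r' by rewrite /r'; lra.
have Kr' : `|K| < r' by rewrite /r'; lra.
have [C bC] := bb r' (ltac:(rewrite /r'; lra) : 0 < r' < rho).
have C0 : 0 <= C by apply: le_trans (bC 0%N); rewrite mulr_ge0 // exprn_ge0 // ltW.
apply: normed_cvg; rewrite /normed_series_of /=.
apply: (@series_le_cvg _ _ (geometric C (`|K| / r'))) => [k|k|k|] //=.
- by rewrite mulr_ge0 // exprn_ge0 // divr_ge0 // ltW.
- rewrite normrM normrX expr_div_n -[leLHS]mul1r.
  rewrite (_ : 1 * _ = (`|b k| * r' ^+ k) * (`|K| ^+ k / r' ^+ k)); last first.
    by field; rewrite expf_neq0 // gt_eqF.
  apply: ler_wpM2r.
    by rewrite divr_ge0 // exprn_ge0 // ltW.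
  exact: bC.
- apply: is_cvg_geometric_series.
  by rewrite normrM normr_id normfV (gtr0_norm r'0) ltr_pdivrMr // mul1r.
Qed.

(** The k-th derivative of the sum of the series, as [pw_derive] shows. *)
Definition pw (b : nat -> R) (k : nat) (t : R) : R :=
  limn (pseries (iter k (@pseries_diffs R) b) t).

Lemma pw_derive rho b k (t : R) : geom_bounded rho b -> `|t| < rho ->
  is_derive t (1 : R) (pw b k) (pw b k.+1 t).
Proof.
move=> bb tr; have bk j : geom_bounded rho (iter j (@pseries_diffs R) b).
  by elim: j => //= j IH; exact: geom_bounded_diffs.
have K0 := normr_ge0 t.
pose K := (`|t| + rho) / 2.
have K0' : `|K| = K by rewrite ger0_norm // /K; lra.
have Kr : `|K| < rho by rewrite K0' /K; lra.
apply: (@pseries_snd_diffs _ _ K).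
- exact: geom_bounded_cvg (bk k) Kr.
- exact: geom_bounded_cvg (bk k.+1) Kr.
- exact: geom_bounded_cvg (bk k.+2) Kr.
- by rewrite K0' /K; lra.
Qed.

Lemma iter_pseries_diffs (b : nat -> R) k j :
  iter k (@pseries_diffs R) b j = (j + k)`!%:R / j`!%:R * b (j + k)%N.
Proof.
elim: k j => [|k IH] j /=.
  by rewrite addn0 divff ?mul1r // pnatr_eq0 -lt0n fact_gt0.
rewrite /pseries_diffs IH addSnnS factS natrM; field.
by rewrite nat1r !pnatr_eq0 -lt0n fact_gt0.
Qed.

Lemma pw0 (b : nat -> R) k : pw b k 0 = k`!%:R * b k.
Proof.
rewrite /pw; have -> : k`!%:R * b k = iter k (@pseries_diffs R) b 0%N.
  by rewrite iter_pseries_diffs add0n fact0 divr1.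
move: (iter k _ b) => c; apply: lim_near_cst => //.
near=> m; rewrite /pseries /series /= -[m]prednK; last by near: m; exists 1%N.
rewrite big_nat_recl //= expr0 mulr1 big1 ?addr0 // => i _.
by rewrite expr0n mulr0.
Unshelve. all: by end_near. Qed.

End PowerSeries.

(** * Power series in several variables along a monomial curve *)

Section MultiIndex.
Context {R : realType} {d : nat}.
Local Notation index := {ffun 'I_d -> nat}.

Definition box (N : nat) : seq index :=
  [seq [ffun i => a i : nat] | a : {ffun 'I_d -> 'I_N}].

Lemma box_uniq N : uniq (box N).
Proof.
rewrite map_inj_uniq ?enum_uniq // => a b /ffunP ab; apply/ffunP => i.
by apply: val_inj; have := ab i; rewrite !ffunE.
Qed.

Lemma mem_box N (a : index) : (a \in box N) = [forall i, (a i < N)%N].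
Proof.
apply/mapP/forallP => [[b _ ->] i|aN]; first by rewrite ffunE.
exists [ffun i => Ordinal (aN i)]; first by rewrite mem_enum.
by apply/ffunP => i; rewrite !ffunE.
Qed.

Lemma sum_box N (F : index -> R) :
  \sum_(a : {ffun 'I_d -> 'I_N}) F [ffun i => a i : nat] = \sum_(a <- box N) F a.
Proof. by rewrite big_map big_enum. Qed.

Lemma summable_bound (u : index -> R) : summable [set: index] (fun a => (u a)%:E) ->
  exists2 A, 0 <= A & forall s : seq index, uniq s -> \sum_(a <- s) `|u a| <= A.
Proof.
rewrite /summable => su; set S := (\esum_(_ in _) _)%E in su.
have S0 : (0 <= S)%E by apply: esum_ge0 => a _; exact: abse_ge0.
have Sfin : S \is a fin_num by rewrite ge0_fin_numE.
exists (fine S); first exact: fine_ge0.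
move=> s us; rewrite -lee_fin fineK //.
apply: esum_ge; exists [set` s]; first by split=> //; exact: finite_seq.
by rewrite -fsbig_seq // -sumEFin.
Qed.

Variable m : 'I_d -> nat.
Hypothesis m0 : forall i, (0 < m i)%N.

Definition weight (a : index) : nat := (\sum_i a i * m i)%N.

(** The coefficient of t^e after substituting t^(m i) for the i-th variable. As every m i is
    positive, the box of side e + 1 contains all indices of weight e. *)
Definition weight_coef (c : index -> R) (e : nat) : R :=
  \sum_(a <- box e.+1 | weight a == e) c a.

Lemma weight_box N a e : weight a = e -> (e < N)%N -> a \in box N.
Proof.
move=> <- aN; rewrite mem_box; apply/forallP => i; apply: leq_ltn_trans aN.
by rewrite /weight (bigD1 i) //= (leq_trans _ (leq_addr _ _)) // leq_pmulr.
Qed.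

Lemma weight_coefE c N e : (e < N)%N ->
  weight_coef c e = \sum_(a <- box N | weight a == e) c a.
Proof.
move=> eN; rewrite /weight_coef -[LHS]big_filter -[RHS]big_filter; apply: perm_big.
apply: uniq_perm; rewrite ?filter_uniq ?box_uniq // => a.
rewrite !mem_filter; have [ae|//] := eqVneq (weight a) e.
by rewrite (weight_box ae (ltnSn e)) (weight_box ae eN).
Qed.

Lemma sum_weight_coef c N (t : R) :
  \sum_(0 <= e < N) weight_coef c e * t ^+ e =
  \sum_(a <- box N | (weight a < N)%N) c a * t ^+ weight a.
Proof.
rewrite big_mkord; under eq_bigr => e _ do rewrite (weight_coefE _ (ltn_ord e)) mulr_suml.
rewrite (exchange_big_dep xpredT) //= [RHS]big_mkcond /=; apply: eq_bigr => a _.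
case: ifPn => aN.
  rewrite (bigD1 (Ordinal aN)) //= big1 ?addr0 // => e /andP[/eqP ae].
  by rewrite -val_eqE /= ae eqxx.
by rewrite big1 // => e /eqP ae; rewrite ae ltn_ord in aN.
Qed.

Lemma box_subset N N' : (N <= N')%N -> {subset box N <= box N'}.
Proof.
move=> NN' a; rewrite !mem_box => /forallP aN; apply/forallP => i.
exact: leq_trans (aN i) NN'.
Qed.

Lemma weight_coef_bound c (rho A : R) : 0 <= rho ->
  (forall s : seq index, uniq s -> \sum_(a <- s) `|c a| * rho ^+ weight a <= A) ->
  forall e, `|weight_coef c e| * rho ^+ e <= A.
Proof.
move=> rho0 cA e; apply: le_trans (cA [seq a <- box e.+1 | weight a == e] _); last first.
  by rewrite filter_uniq ?box_uniq.
rewrite big_filter (eq_bigr (fun a => `|c a| * rho ^+ e)) => [|a /eqP -> //].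
by rewrite -mulr_suml ler_wpM2r ?exprn_ge0 // ler_norm_sum.
Qed.

                                                                 
                                                                             
(** The N-th partial sum and the sum over the box of side N differ by indices of weight at least N.
    These lie outside the box of side N / M, so absolute convergence makes the difference tend to
    0. *)
Lemma cvg_weight_coef c (t A L : R) :
  (forall s : seq index, uniq s -> \sum_(a <- s) `|c a * t ^+ weight a| <= A) ->
  (fun N => \sum_(a <- box N) c a * t ^+ weight a) @ \oo --> L ->
  pseries (weight_coef c) t @ \oo --> L.
Proof.
move=> uA uL; pose M := (1 + \sum_i m i)%N.
pose u a := c a * t ^+ weight a; pose AN N := \sum_(a <- box N) `|u a|.
have split_box N N' F : (N <= N')%N -> \sum_(a <- box N') F a =
    \sum_(a <- box N) F a + \sum_(a <- box N' | a \notin box N) F a :> R.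
  move=> NN'; rewrite (bigID (mem (box N))) /=; congr (_ + _).
  rewrite -big_filter; apply: perm_big; apply: uniq_perm; rewrite ?filter_uniq ?box_uniq //.
  move=> a; rewrite mem_filter /=; have [aN|//] := boolP (a \in box N).
  by rewrite (box_subset NN').
have AN_nd : nondecreasing_seq AN.
  by move=> N N' NN'; rewrite /AN (split_box _ _ _ NN') lerDl sumr_ge0.
have AN_cvg : cvgn AN.
  apply: nondecreasing_is_cvgn => //; exists A => _ [N _ <-]; exact: uA (box_uniq N).
pose h N := (N %/ M)%N.
have hoo : h N @[N --> \oo] --> \oo.
  move=> P [K _ KP]; exists (K * M)%N => // N /= KN; apply: KP => /=.
  by rewrite /h leq_divRL.
have dA : (fun N => AN N - AN (h N)) @ \oo --> (0 : R).
  rewrite -(subrr (limn AN)); apply: cvgB => //.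
  exact: (cvg_comp _ _ hoo AN_cvg).
rewrite -[L]addr0 -[0]oppr0.
have -> : pseries (weight_coef c) t = (fun N => \sum_(a <- box N) u a +
    - (\sum_(a <- box N | ~~ (weight a < N)%N) u a)).
  apply/funext => N; rewrite /pseries /series /= sum_weight_coef.
  by rewrite [X in _ = X - _](bigID (fun a => (weight a < N)%N)) /= addrK.
apply: cvgD => //; apply: cvgN; apply/norm_cvg0P.
apply: (@squeeze_cvgr _ _ _ _ (cst 0) (fun N => AN N - AN (h N))) => //; last exact: cvg_cst.
exists M => // N /= MN; rewrite normr_ge0 /=.
apply: le_trans (ler_norm_sum _ _ _) _.
rewrite /AN (split_box (h N) N) ?leq_div // addrAC subrr add0r.
rewrite [leLHS]big_mkcond [leRHS]big_mkcond; apply: ler_sum => a _.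
case: ifPn => aN; last by case: ifP.
rewrite ifT //; apply: contra aN; rewrite mem_box => /forallP ah.
have hN : (0 < h N)%N by rewrite divn_gt0.
apply: (@leq_ltn_trans (h N * \sum_i m i)%N).
  rewrite big_distrr /=; apply: leq_sum => i _.
  by rewrite leq_mul2r ltnW ?orbT.
apply: leq_trans (leq_trunc_div N M); rewrite -/(h N) /M mulnDr muln1.
by rewrite -[X in (X < _)%N]add0n ltn_add2r.
Qed.

End MultiIndex.

(** * Partial derivatives and finite differences *)

Section Partials.
Context {R : realType} {d : nat}.
Implicit Types (G : 'rV[R]_d -> R) (x y h : 'rV[R]_d) (s : seq 'I_d).

Definition scalar_partial s G : 'rV[R]_d -> R :=
  foldr (fun i g => 'D_(delta_mx 0 i) g) G s.

Definition derivable_upto (k : nat) G x (e : R) := forall s i y, (size s < k)%N ->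
  ball x e y -> derivable (scalar_partial s G) y (delta_mx 0 i).

Definition delta (u : R) (i : 'I_d) G : 'rV[R]_d -> R :=
  fun y => G (y + u *: delta_mx 0 i) - G y.

Fixpoint findiff u s G : 'rV[R]_d -> R :=
  if s is i :: s' then findiff u s' (delta u i G) else G.

Lemma derivable_translate G y h v : derivable G (y + h) v <-> derivable (fun z => G (z + h)) y v.
Proof.
rewrite /derivable.
suff -> : (fun h0 : R => h0^-1 *: (G (h0 *: v + y + h) - G (y + h))) =
  (fun h0 : R => h0^-1 *: (G (h0 *: v + (y + h)) - G (y + h))) by [].
by apply/funext => z; rewrite addrA.
Qed.

Lemma derive_translate G y h v : 'D_v (fun z => G (z + h)) y = 'D_v G (y + h).
Proof.
rewrite /derive.
suff -> : (fun h0 : R => h0^-1 *: (G (h0 *: v + y + h) - G (y + h))) =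
  (fun h0 : R => h0^-1 *: (G (h0 *: v + (y + h)) - G (y + h))) by [].
by apply/funext => z; rewrite addrA.
Qed.

Lemma norm_delta_mx (i : 'I_d) : `|delta_mx 0 i : 'rV[R]_d| <= 1.
Proof.
rewrite /Num.norm /= mx_normrE; apply: bigmax_le => // -[a b] _ /=.
by rewrite !mxE; case: (_ && _); rewrite ?normr1 ?normr0.
Qed.

Lemma line_derive G y (i : 'I_d) (tau : R) : let e : 'rV[R]_d := delta_mx 0 i in
  derivable G (y + tau *: e) e ->
  is_derive tau (1 : R) (fun tau : R => G (y + tau *: e)) ('D_e G (y + tau *: e)).
Proof.
move=> e dG.
have E : (fun h : R => h^-1 *: (G (y + (h *: 1 + tau) *: e) - G (y + tau *: e))) =
    (fun h : R => h^-1 *: (G (h *: e + (y + tau *: e)) - G (y + tau *: e))).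
  apply/funext => h; congr (_ *: (G _ - _)).
  by rewrite scalerDl [h *: 1]mulr1 addrCA.
split; first by rewrite /derivable; move: dG; rewrite /derivable -E.
by rewrite /derive /= E.
Qed.

Lemma ball_translate x y (e u : R) (i : 'I_d) : 0 <= u ->
  ball x (e - u) y -> ball x e (y + u *: delta_mx 0 i).
Proof.
move=> u0; rewrite -!ball_normE /= => xy.
rewrite opprD addrA; apply: le_lt_trans (ler_normB _ _) _.
rewrite normrZ (ger0_norm u0); have := norm_delta_mx i.
move=> /(ler_wpM2l u0); lra.
Qed.

Lemma partial_delta k G x (e u : R) i s : 0 <= u -> derivable_upto k G x e ->
  (size s <= k)%N -> forall y, ball x (e - u) y ->
  scalar_partial s (delta u i G) y =
    scalar_partial s G (y + u *: delta_mx 0 i) - scalar_partial s G y.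
Proof.
move=> u0 dG; elim: s => [//|j s IH] /= sk y xy.
have bsub z : ball x (e - u) z -> ball x e z by apply: le_ball; lra.
have near_eq : \near y, scalar_partial s (delta u i G) y =
    ((fun z => scalar_partial s G (z + u *: delta_mx 0 i)) - scalar_partial s G) y.
  have : \forall z \near y, ball x (e - u) z.
    by apply: open_nbhs_nbhs; split; [exact: ball_open|].
  by apply: filterS => z; exact: IH (ltnW sk) z.
have d1 : derivable (fun z => scalar_partial s G (z + u *: delta_mx 0 i)) y (delta_mx 0 j).
  by apply/derivable_translate; apply: dG => //; exact: ball_translate.
have d2 : derivable (scalar_partial s G) y (delta_mx 0 j) by apply: dG => //; exact: bsub.
by rewrite (near_eq_derive _ near_eq) (deriveB d1 d2) derive_translate.
Qed.

Lemma derivable_delta k G x (e u : R) i : 0 <= u -> derivable_upto k G x e ->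
  derivable_upto k (delta u i G) x (e - u).
Proof.
move=> u0 dG s j y sk xy.
have bsub z : ball x (e - u) z -> ball x e z by apply: le_ball; lra.
have near_eq : \near y, ((fun z => scalar_partial s G (z + u *: delta_mx 0 i)) -
    scalar_partial s G) y = scalar_partial s (delta u i G) y.
  have : \forall z \near y, ball x (e - u) z.
    by apply: open_nbhs_nbhs; split; [exact: ball_open|].
  by apply: filterS => z xz; rewrite (@partial_delta _ _ _ _ _ i _ u0 dG (ltnW sk) _ xz).
apply: (near_eq_derivable near_eq); apply: derivableB.
  by apply/derivable_translate; apply: dG => //; exact: ball_translate.
by apply: dG => //; exact: bsub.
Qed.

Lemma derivable_uptoW k k' G x e : (k' <= k)%N -> derivable_upto k G x e -> derivable_upto k' G x e.
Proof. by move=> kk dG s i y sk; apply: dG; exact: leq_trans kk. Qed.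

(** One mean value theorem per direction; [partial_delta] lets the differences commute with the
    partial derivatives already taken. *)
Lemma findiff_mvt s G x (e u : R) : 0 < u -> derivable_upto (size s) G x e ->
  (size s)%:R * u < e ->
  exists2 z, `|z - x| <= (size s)%:R * u & findiff u s G x = u ^+ size s * scalar_partial s G z.
Proof.
move=> u0; elim: s G e => [|i s IH] G e dG se /=.
  by exists x; rewrite ?subrr ?normr0 ?mul0r // expr0 mul1r.
have se' : (size s)%:R * u < e - u by move: se; rewrite /= -natr1 mulrDl mul1r; lra.
have dG' := @derivable_delta _ _ _ _ _ i (ltW u0) (derivable_uptoW (leqnSn _) dG).
have [z zx ->] := IH _ _ dG' se'.
have xz : ball x (e - u) z by rewrite -ball_normE /= distrC; apply: le_lt_trans se'.
rewrite (@partial_delta _ _ _ _ _ i _ (ltW u0) (derivable_uptoW (leqnSn _) dG)) //.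
pose K (tau : R) := scalar_partial s G (z + tau *: delta_mx 0 i).
have dK tau : 0 <= tau <= u -> is_derive tau (1 : R) K
    ('D_(delta_mx 0 i) (scalar_partial s G) (z + tau *: delta_mx 0 i)).
  move=> /andP[t0 tu]; apply: line_derive; apply: dG => //.
  by apply: ball_translate => //; apply: le_ball xz; lra.
have [c cu Kc] : exists2 c, c \in `[0, u] & K u - K 0 =
    'D_(delta_mx 0 i) (scalar_partial s G) (z + c *: delta_mx 0 i) * (u - 0).
  apply: MVT_segment => [|t|]; first exact: ltW.
    by rewrite in_itv /= => /andP[t0 tu]; apply: dK; rewrite !ltW.
  by apply: derivable_within_continuous => t; rewrite in_itv /= => /dK [].
exists (z + c *: delta_mx 0 i).
  move: cu; rewrite in_itv /= => /andP[c0 cu].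
  rewrite addrAC; apply: le_trans (ler_normD _ _) _.
  rewrite normrZ (ger0_norm c0) -natr1 mulrDl mul1r; apply: lerD => //.
  by apply: le_trans cu; rewrite ler_piMr // norm_delta_mx.
have -> : scalar_partial s G z = K 0 by rewrite /K scale0r addr0.
by rewrite -/(K u) Kc subr0 exprS; ring.
Qed.

Lemma findiff_bound s G x (u B : R) : 0 <= u ->
  (forall y, `|y - x| <= (size s)%:R * u -> `|G y| <= B) ->
  `|findiff u s G x| <= 2 ^+ size s * B.
Proof.
move=> u0; elim: s G B => [|i s IH] G B GB /=.
  by rewrite expr0 mul1r; apply: GB; rewrite subrr normr0 mul0r.
rewrite exprSr -mulrA; apply: IH => y yx; rewrite /delta.
apply: le_trans (ler_normB _ _) _; rewrite mulr_natl mulr2n; apply: lerD.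
  apply: GB; rewrite /= addrAC; apply: le_trans (ler_normD _ _) _.
  rewrite -natr1 mulrDl mul1r; apply: lerD => //.
  by rewrite normrZ (ger0_norm u0) ler_piMr // norm_delta_mx.
by apply: GB; apply: le_trans yx _; rewrite ler_wpM2r // ler_nat.
Qed.

                                                                                 
                                                                        
(** The iterated difference with step u is u^|s| times the partial derivative at a nearby point, and
    by hypothesis it is of order u^(l+1) with l + 1 > |s|. This links the partial derivatives in
    [nondegenerate_at] to power series coefficients without differentiating the series in several
    variables. *)
Lemma partial_eq0 s l G x (e A rho : R) : (0 < size s <= l)%N -> 0 < e -> 0 < rho ->
  derivable_upto (size s) G x e -> {for x, continuous (scalar_partial s G)} ->
  (forall theta h, 0 <= theta <= 1 -> `|h| <= theta * rho ->
     `|G (x + h) - G x| <= A * theta ^+ l.+1) ->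
  scalar_partial s G x = 0.
Proof.
case: s => [//|i s]; set S := i :: s; move=> /andP[_ sl] e0 rho0 dG cG GA.
apply/eqP/negPn/negP => nz; set eta := `|scalar_partial S G x|.
have eta0 : 0 < eta by rewrite normr_gt0.
have [e' e'0 e'P] : exists2 e', 0 < e' & forall z, `|z - x| < e' ->
    eta / 2 <= `|scalar_partial S G z|.
  have eta2 : 0 < eta / 2 by rewrite divr_gt0.
  have /cvgr_dist_lt /(_ _ eta2) := cG.
  move=> /nbhs_ballP[e' /= e'0 e'P]; exists e' => // z zx.
  have /e'P : ball x e' z by rewrite -ball_normE /= distrC.
  have := ler_normD (scalar_partial S G x - scalar_partial S G z) (scalar_partial S G z).
  rewrite subrK -/eta; lra.
pose p : R := (size S)%:R; have p1 : 1 <= p by rewrite ler1n.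
have A0 : 0 <= A.
  have := GA 1 0; rewrite expr1n mulr1 ler01 lexx normr0 mul1r (ltW rho0) => /(_ isT isT).
  exact: le_trans.
pose b := (rho / p) ^+ size S * (eta / 2).
have b0 : 0 < b by rewrite mulr_gt0 ?exprn_gt0 ?divr_gt0 //; lra.
pose D := 2 ^+ size S * A + 1.
have D0 : 0 < D by rewrite ltr_wpDl // mulr_ge0 // exprn_ge0.
pose theta := Num.min 2^-1 (Num.min (e / (2 * rho)) (Num.min (e' / (2 * rho)) (b / (2 * D)))).
have [th0 th1 the the' thb] : [/\ 0 < theta, theta <= 2^-1, theta <= e / (2 * rho),
    theta <= e' / (2 * rho) & theta <= b / (2 * D)].
  split; rewrite /theta ?ge_min ?lexx ?orbT //.
  by rewrite !lt_min invr_gt0 ltr0n /= !divr_gt0 // mulr_gt0.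
clearbody theta.
(* The p steps of size u then stay within distance theta rho of x. *)
pose u := theta * rho / p.
have u0 : 0 < u by rewrite divr_gt0 ?mulr_gt0 //; lra.
have pu : p * u = theta * rho by rewrite /u mulrC divfK // gt_eqF //; lra.
have thr c : 0 < c -> theta <= c / (2 * rho) -> theta * rho < c.
  move=> c0 h; have := ler_wpM2r (ltW rho0) h.
  have -> : c / (2 * rho) * rho = c / 2 by field; rewrite gt_eqF.
  lra.
have [z zx fz] := findiff_mvt u0 dG (ltac:(by rewrite -/p pu; exact: thr) : p * u < e).
have lower : u ^+ size S * (eta / 2) <= `|findiff u S G x|.
  rewrite fz normrM [`|u ^+ _|]ger0_norm ?exprn_ge0 ?(ltW u0) //.
  apply: ler_wpM2l; first by rewrite exprn_ge0 // ltW.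
  by apply: e'P; apply: le_lt_trans zx _; rewrite -/p pu; exact: thr.
have upper : `|findiff u S G x| <= 2 ^+ size S * (A * theta ^+ l.+1).
  rewrite /S /= exprSr -mulrA; apply: findiff_bound; first exact: ltW.
  move=> y yx; rewrite /delta.
  have psu : p * u = (size s)%:R * u + u by rewrite /p /S /= -natr1 mulrDl mul1r.
  have -> : G (y + u *: delta_mx 0 i) - G y =
      (G (x + (y + u *: delta_mx 0 i - x)) - G x) - (G (x + (y - x)) - G x).
    by rewrite !(addrC x) !subrK opprB addrA subrK.
  apply: le_trans (ler_normB _ _) _; rewrite mulr_natl mulr2n.
  apply: lerD; apply: GA; try by rewrite (ltW th0) /=; lra.
    rewrite -pu psu addrAC; apply: le_trans (ler_normD _ _) _; apply: lerD => //.
    by rewrite normrZ (gtr0_norm u0) ler_piMr ?(ltW u0) // norm_delta_mx.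
  by rewrite -pu psu; apply: le_trans yx _; rewrite lerDl ltW.
have := le_trans lower upper.
have -> : u ^+ size S * (eta / 2) = theta ^+ size S * b.
  by rewrite /b /u -[theta * rho / p]mulrA exprMn; ring.
have -> : 2 ^+ size S * (A * theta ^+ l.+1) =
    theta ^+ size S * (2 ^+ size S * A * theta ^+ (l.+1 - size S)).
  by rewrite -[in LHS](@subnK (size S) l.+1) ?exprD; [ring|exact: leqW].
rewrite ler_pM2l ?exprn_gt0 //; apply/negP; rewrite -ltNge.
apply: (@le_lt_trans _ _ (D * theta)).
  apply: ler_pM; rewrite ?mulr_ge0 ?exprn_ge0 ?(ltW th0) //; first by rewrite /D lerDl.
  rewrite -[leRHS]expr1; apply: ler_wiXn2l; [exact: ltW|lra|].
  by rewrite subn_gt0 ltnS.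
have := ler_wpM2l (ltW D0) thb.
have -> : D * (b / (2 * D)) = b / 2 by field; rewrite gt_eqF.
lra.
Qed.

End Partials.

(** * Exponents that separate the multi-indices of order at most l *)

Section CurveWeights.
Variables (d l : nat).
Local Notation index := {ffun 'I_d -> nat}.

Definition order (a : index) : nat := (\sum_i a i)%N.

                                                                             
                                                                               
                                               
(** The weight of a becomes K times its order plus the sum of the a i (l+1)^i, where K = l ((l+1)^d
    + 1) + 1 exceeds that sum if the order is at most l. The quotient by K gives the order, and the
    digits in base l + 1 give a. *)
Definition curve_weight (i : 'I_d) : nat := (l * (l.+1 ^ d).+1 + 1 + l.+1 ^ i)%N.

Lemma curve_weight_gt0 i : (0 < curve_weight i)%N.
Proof. by rewrite /curve_weight addn1. Qed.

Lemma quotient_inj K p q x y : (x < K)%N -> (y < K)%N -> (p * K + x = q * K + y)%N -> p = q.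
Proof.
move=> xK yK /(congr1 (divn^~ K)); have K0 := leq_ltn_trans (leq0n x) xK.
by rewrite !divnMDl // !divn_small // !addn0.
Qed.

Lemma digits_inj e q (a b : 'I_e -> nat) : (forall i, a i < q)%N -> (forall i, b i < q)%N ->
  (\sum_i a i * q ^ i = \sum_i b i * q ^ i)%N -> a =1 b.
Proof.
elim: e a b => [|e IH] a b aq bq; first by move=> _ [].
rewrite !big_ord_recl /= expn0 !muln1.
have tail (c : 'I_e.+1 -> nat) : (\sum_(i < e) c (lift ord0 i) * q ^ bump 0 i =
    (\sum_(i < e) c (lift ord0 i) * q ^ i) * q)%N.
  by rewrite big_distrl; apply: eq_bigr => i _; rewrite /= -mulnA -expnSr.
rewrite !tail ![(_ ord0 + _)%N]addnC => E.
have E1 := quotient_inj (aq ord0) (bq ord0) E.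
move: E; rewrite E1 => /addnI E0 i.
case: (unliftP ord0 i) => [j ->|->] //.
by apply: (IH (fun j => a (lift ord0 j)) (fun j => b (lift ord0 j))).
Qed.

Lemma coord_le_order (a : index) i : (a i <= order a)%N.
Proof. by rewrite /order (bigD1 i) //= leq_addr. Qed.

Lemma weightE a : weight curve_weight a =
  (order a * (l * (l.+1 ^ d).+1 + 1) + \sum_i a i * l.+1 ^ i)%N.
Proof.
rewrite /weight /order big_distrl -big_split /=; apply: eq_bigr => i _.
by rewrite -mulnDr.
Qed.

Lemma order_le_weight a : (order a <= weight curve_weight a)%N.
Proof.
by apply: leq_sum => i _; rewrite leq_pmulr // curve_weight_gt0.
Qed.

Lemma digit_sum_lt a : (order a <= l)%N ->
  (\sum_i a i * l.+1 ^ i < l * (l.+1 ^ d).+1 + 1)%N.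
Proof.
move=> al; rewrite addn1 ltnS; apply: leq_trans (_ : order a * (l.+1 ^ d).+1 <= _)%N.
  rewrite /order big_distrl; apply: leq_sum => i _.
  by rewrite leq_mul2l leqW ?orbT // leq_pexp2l // ltnW.
by rewrite leq_mul2r al orbT.
Qed.

(** The order of b is not bounded in advance: an order larger than that of a would already make the
    weight larger. *)
Lemma weight_inj a b : (order a <= l)%N -> weight curve_weight a = weight curve_weight b ->
  a = b.
Proof.
move=> al; rewrite !weightE => E.
have al' := digit_sum_lt al.
have sub K p q x y : (x < K)%N -> (p * K + x = q * K + y)%N -> (q <= p)%N.
  move=> xK E'; rewrite leqNgt; apply/negP => pq.
  have := leq_mul pq (leqnn K); rewrite mulSn; lia.
have bl : (order b <= l)%N.
  by apply: leq_trans al; exact: sub E.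
have bl' := digit_sum_lt bl.
have ob : order a = order b := quotient_inj al' bl' E.
move: E; rewrite ob => /addnI E; apply/ffunP.
apply: (digits_inj (q := l.+1) _ _ E) => i; rewrite ltnS.
  exact: leq_trans (coord_le_order a i) al.
exact: leq_trans (coord_le_order b i) bl.
Qed.

Lemma weight_coef_inj (R : realType) (c : index -> R) a : (order a <= l)%N ->
  weight_coef curve_weight c (weight curve_weight a) = c a.
Proof.
move=> al; rewrite /weight_coef big_mkcond /=.
rewrite (bigD1_seq a) ?box_uniq ?(weight_box curve_weight_gt0 (erefl _)) //= eqxx.
rewrite big1 ?addr0 // => b ba; case: eqP => // E; case/eqP: ba.
exact/esym/(weight_inj al).
Qed.

Lemma weight_bound a : (order a <= l)%N ->
  (weight curve_weight a <= l.+1 * (l * (l.+1 ^ d).+1 + 1))%N.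
Proof.
move=> al; rewrite weightE mulSn addnC; apply: leq_add; first exact: ltnW (digit_sum_lt al).
by rewrite leq_mul2r al orbT.
Qed.

Lemma order_gt0_weight a : (0 < order a)%N -> (0 < weight curve_weight a)%N.
Proof. by move=> a0; apply: leq_trans (order_le_weight a). Qed.

End CurveWeights.

(** * An analytic map along the monomial curve *)

Section AnalyticCurve.
Context {R : realType} {d n : nat}.
Implicit Types (f : 'rV[R]_d -> 'rV[R]_n) (x h : 'rV[R]_d).
Local Notation index := {ffun 'I_d -> nat}.

Lemma mx_norm_coord m (v : 'rV[R]_m) j : `|v 0 j| <= `|v|.
Proof.
rewrite [leRHS]/Num.norm /= mx_normrE.
exact: (le_bigmax _ (fun ij : 'I_1 * 'I_m => `|v ij.1 ij.2|) (0, j)).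
Qed.

Lemma mx_norm_le m (v : 'rV[R]_m) M : 0 <= M -> (forall j, `|v 0 j| <= M) -> `|v| <= M.
Proof.
move=> M0 vM; rewrite [leLHS]/Num.norm /= mx_normrE; apply: bigmax_le => // -[i j] _ /=.
by rewrite ord1.
Qed.

Lemma monomial_const (rho : R) a : monomial (const_mx rho : 'rV_d) a = rho ^+ order a.
Proof.
rewrite /monomial /order; under eq_bigr do rewrite mxE.
by rewrite -(big_morph _ (exprD rho) (expr0 rho)).
Qed.

Lemma monomial_bound h a (rho : R) : `|h| <= rho -> `|monomial h a| <= rho ^+ order a.
Proof.
move=> hrho; rewrite -monomial_const /monomial normr_prod; apply: ler_prod => i _.
rewrite normr_ge0 normrX mxE /=; apply: lerXn2r; rewrite ?nnegrE //.
  exact: le_trans hrho.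
exact: le_trans (mx_norm_coord h i) hrho.
Qed.

Lemma analytic_expansion f x : (forall j, real_analytic_at (fun y => f y 0 j) x) ->
  exists (c : 'I_n -> index -> R) (rho A : R), [/\ 0 < rho,
    forall j (s : seq index), uniq s -> \sum_(a <- s) `|c j a| * rho ^+ order a <= A &
    forall j h, `|h| <= rho ->
      (fun N => \sum_(a <- box N) c j a * monomial h a) @ \oo --> f (x + h) 0 j].
Proof.
move=> /choice[c cP].
have /nbhs_ballP[e /= e0 eP] := @filter_forall _ _ _ (nbhs x) (nbhs_filter x) cP.
have e2 : 0 <= e / 2 by rewrite divr_ge0 // ltW.
pose rho := e / 2.
have rho0 : 0 < rho by rewrite divr_gt0.
have xh h : `|h| <= rho -> ball x e (x + h).
  move=> hr; rewrite -ball_normE /= opprD addrA subrr sub0r normrN.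
  by apply: le_lt_trans hr _; rewrite /rho; lra.
have bound j : exists A, 0 <= A /\ forall s : seq index, uniq s ->
    \sum_(a <- s) `|c j a| * rho ^+ order a <= A.
  (* Absolute convergence at the increment with all entries rho bounds the series for every |h| <=
     rho. *)
  have [] := eP _ (xh (const_mx rho) _) j.
    by apply: mx_norm_le => [|i]; rewrite ?mxE ?gtr0_norm // ltW.
  move=> /summable_bound[A A0 AP] _; exists A; split=> // s us.
  apply: le_trans (AP s us); apply: ler_sum => a _.
  by rewrite (addrC x) addrK monomial_const normrM [`|rho ^+ _|]ger0_norm // exprn_ge0 // ltW.
have [A AP] := choice bound.
exists c, rho, (\sum_j A j); split=> // j.
  move=> s us; apply: le_trans ((AP j).2 s us) _; rewrite (bigD1 j) //= lerDl.
  by apply: sumr_ge0 => i _; exact: (AP i).1.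
move=> h /xh /eP /(_ j)[_]; rewrite (addrC x) addrK.
set u := (X in X @ _ --> _); set u' := (X in _ -> X @ _ --> _).
suff -> : u = u' by [].
apply/funext => N; exact: (sum_box N (fun a => c j a * monomial h a)).
Qed.

Definition monomial_curve (m : 'I_d -> nat) (t : R) : 'rV[R]_d := \row_i t ^+ m i.

Lemma monomial_curve_bound m t (rho : R) : (forall i, 0 < m i)%N ->
  `|t| <= Num.min rho 1 -> `|monomial_curve m t| <= rho.
Proof.
move=> m0; rewrite le_min => /andP[tr t1]; apply: mx_norm_le.
  exact: le_trans tr.
move=> i; rewrite mxE normrX; apply: le_trans tr.
by rewrite -[leRHS]expr1; apply: ler_wiXn2l.
Qed.

Lemma monomial_curveE m t a : monomial (monomial_curve m t) a = t ^+ weight m a.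
Proof.
rewrite /monomial /weight (big_morph _ (exprD t) (expr0 t)).
by apply: eq_bigr => i _; rewrite mxE -exprM mulnC.
Qed.

                                                                                
                                                                                
                                                                              
                                                
(** Because the weights separate, each coefficient c j a with order a <= l stands alone in front of
    its power of t, so up to a factorial it is a derivative of g at 0. *)
Lemma analytic_curve f x l : (forall j, real_analytic_at (fun y => f y 0 j) x) ->
  exists (g : nat -> R -> 'rV[R]_n) (r : R) (c : 'I_n -> index -> R) (rho A : R),
  [/\ 0 < r /\ smooth r g,
      forall t, `|t| < r -> g 0%N t = f (x + monomial_curve (@curve_weight d l) t),
      forall j a, (order a <= l)%N ->
        g (weight (@curve_weight d l) a) 0 0 j = (weight (@curve_weight d l) a)`!%:R * c j a,
      0 < rho /\ forall j (s : seq index), uniq s ->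
        \sum_(a <- s) `|c j a| * rho ^+ order a <= A &
      forall j h, `|h| <= rho ->
      (fun N => \sum_(a <- box N) c j a * monomial h a) @ \oo --> f (x + h) 0 j].
Proof.
move=> /analytic_expansion[c [rho [A [rho0 cA cf]]]].
pose m := @curve_weight d l; have m0 i : (0 < m i)%N := curve_weight_gt0 l i.
pose r := Num.min rho 1; have r0 : 0 < r by rewrite lt_min rho0 ltr01.
have cr j (t : R) s : `|t| <= r -> uniq s -> \sum_(a <- s) `|c j a| * `|t| ^+ weight m a <= A.
  move=> tr us; apply: le_trans (cA j s us); apply: ler_sum => a _; apply: ler_wpM2l => //.
  move: tr; rewrite le_min => /andP[tr t1].
  apply: (@le_trans _ _ (`|t| ^+ order a)); last by apply: lerXn2r; rewrite ?nnegrE ?(ltW rho0).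
  by apply: ler_wiXn2l => //; exact: order_le_weight.
have gb j : geom_bounded r (weight_coef m (c j)).
  move=> r' /andP[r'0 r'r]; exists A => k.
  apply: weight_coef_bound; first exact: ltW.
  move=> s us; have := cr j r' s _ us; rewrite gtr0_norm //; apply; exact: ltW.
exists (fun k t => \row_j pw (weight_coef m (c j)) k t), r, c, rho, A; split=> //.
- split=> // k i t tr; rewrite mxE (_ : (fun t => _) = pw (weight_coef m (c i)) k).
    exact: pw_derive (gb i) tr.
  by apply/funext => u; rewrite mxE.
- move=> t tr; apply/rowP => j; rewrite mxE; apply: cvg_lim => //.
  apply: (@cvg_weight_coef _ _ _ m0 (c j) t A).
    move=> s us; apply: le_trans (cr j t s (ltW tr) us).
    by apply: ler_sum => a _; rewrite normrM normrX.
  have := cf j _ (monomial_curve_bound m0 (ltW tr)).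
  by under eq_cvg => N do under eq_bigr => a _ do rewrite monomial_curveE.
- move=> j a al; rewrite mxE pw0 weight_coef_inj //.
Qed.

End AnalyticCurve.

Lemma cvg_sumr (R : realType) T (F : set_system T) (p : nat) (u : 'I_p -> T -> R)
    (a : 'I_p -> R) : Filter F ->
  (forall i, u i @ F --> a i) -> (fun x => \sum_i u i x) @ F --> \sum_i a i.
Proof. by move=> FF ua; apply: (cvg_big (op := +%R) (P := xpredT)); [exact: add_continuous|]. Qed.

(** * Nondegeneracy yields a spanning curve *)

Section Nondegenerate.
Context {R : realType} {d n : nat}.
Implicit Types (f : 'rV[R]_d -> 'rV[R]_n) (x h : 'rV[R]_d) (v : 'rV[R]_n).

Lemma is_derive_dot v f y e : derivable f y e ->
  is_derive y e (fun y => dot v (f y)) (dot v ('D_e f y)).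
Proof.
move=> df.
have -> : (fun y => dot v (f y)) = \sum_i (fun y => v 0 i * f y 0 i).
  by apply/funext => u; rewrite dot_sum fct_sumE.
rewrite dot_sum; apply: is_derive_sum => i; apply: is_deriveZ.
rewrite (derive_mx df) mxE; apply/derivableP.
by move/derivable_mxP : df.
Qed.

Lemma continuous_dot v f y : {for y, continuous f} -> {for y, continuous (fun y => dot v (f y))}.
Proof.
move=> cf; rewrite (_ : (fun y => _) = (fun y => \sum_i v 0 i * f y 0 i)).
  apply: (@cvg_sumr R _ (nbhs y) n (fun i y => v 0 i * f y 0 i)) => i.
  apply: cvgMr; apply: (@continuous_comp _ _ _ f (fun u : 'rV[R]_n => u 0 i) y cf).
  exact: coord_continuous.
by apply/funext => u; rewrite dot_sum.
Qed.

Lemma scalar_partial_dot l f x v : C_near l f x -> exists2 e, 0 < e &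
  derivable_upto l (fun y => dot v (f y)) x e /\
  forall s, (size s <= l)%N ->
    {for x, continuous (scalar_partial s (fun y => dot v (f y)))} /\
    scalar_partial s (fun y => dot v (f y)) x = dot v (partial s f x).
Proof.
move=> /nbhs_ballP[e /= e0 eP]; exists e => //.
have E s : (size s <= l)%N -> forall y, ball x e y ->
    scalar_partial s (fun y => dot v (f y)) y = dot v (partial s f y).
  elim: s => //= i s IH sl y xy.
  have near_eq : \near y, scalar_partial s (fun y => dot v (f y)) y = dot v (partial s f y).
    have : \forall z \near y, ball x e z.
      by apply: open_nbhs_nbhs; split; [exact: ball_open|].
    by apply: filterS => z; exact: IH (ltnW sl) z.
  rewrite (near_eq_derive _ near_eq).
  exact: (@derive_val _ _ _ _ _ _ _ (is_derive_dot v ((eP y xy).1 s i sl))).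
have near_E s y : (size s <= l)%N -> ball x e y -> \near y,
    dot v (partial s f y) = scalar_partial s (fun y => dot v (f y)) y.
  move=> sl xy; have : \forall z \near y, ball x e z.
    by apply: open_nbhs_nbhs; split; [exact: ball_open|].
  by apply: filterS => z xz; rewrite E.
split=> [s i y sl xy|s sl].
  apply: (near_eq_derivable (near_E s y (ltnW sl) xy)).
  by have [] := is_derive_dot v ((eP y xy).1 s i sl).
have xx : ball x e x by exact: ballxx.
split; last exact: E.
have := @continuous_dot v _ _ ((eP x xx).2 s sl).
rewrite /prop_for /continuous_at => cd; rewrite E //; apply: cvg_trans cd.
exact: near_eq_cvg (near_E s x sl xx).
Qed.

(** Terms of order 1 to l vanish, the constant terms cancel, and a term of order at least l + 1
    shrinks by theta^(l+1) when h is scaled by theta. *)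
Lemma jet_eq0_increment (c : {ffun 'I_d -> nat} -> R) (rho A : R) (G : 'rV[R]_d -> R) x l :
  0 < rho ->
  (forall s, uniq s -> \sum_(a <- s) `|c a| * rho ^+ order a <= A) ->
  (forall h, `|h| <= rho ->
      (fun N => \sum_(a <- box N) c a * monomial h a) @ \oo --> G (x + h)) ->
  (forall a, (0 < order a <= l)%N -> c a = 0) ->
  forall theta h, 0 <= theta <= 1 -> `|h| <= theta * rho ->
     `|G (x + h) - G x| <= A * theta ^+ l.+1.
Proof.
move=> rho0 cA cG c0 theta h /andP[t0 t1] ht.
have hr : `|h| <= rho by apply: le_trans ht _; rewrite ler_piMl // ltW.
have c1 := cG _ hr.
have c2 : (fun N => \sum_(a <- box N) c a * monomial (0 : 'rV[R]_d) a) @ \oo --> G x.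
  by rewrite -[x in G x]addr0; apply: cG; rewrite normr0 ltW.
have cN : (fun N => `|\sum_(a <- box N) c a * monomial h a -
    \sum_(a <- box N) c a * monomial (0 : 'rV[R]_d) a|) @ \oo --> `|G (x + h) - G x|.
  by apply: cvg_norm; exact: cvgB.
rewrite -(cvg_lim _ cN) //; apply: limr_le; first by apply/cvg_ex; eexists; exact: cN.
near=> N; rewrite /= -sumrB; apply: le_trans (ler_norm_sum _ _ _) _.
apply: (@le_trans _ _ (\sum_(a <- box N) `|c a| * rho ^+ order a * theta ^+ l.+1)).
  apply: ler_sum => a _; rewrite -mulrBr normrM -mulrA; have [a0|a0] := posnP (order a).
    have -> : monomial h a - monomial 0 a = 0.
      have az i : a i = 0%N by apply/eqP; rewrite -leqn0 -a0 coord_le_order.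
      by rewrite /monomial !big1 ?subrr // => i _; rewrite az expr0.
    by rewrite normr0 mulr0 !mulr_ge0 // exprn_ge0 // ltW.
  have [al|al] := leqP (order a) l; first by rewrite c0 ?a0 // normr0 !mul0r.
  apply: ler_wpM2l => //.
  have -> : monomial (0 : 'rV[R]_d) a = 0.
    have [i ai] : exists i, (0 < a i)%N.
      apply/existsP; apply: contraT; rewrite negb_exists => /forallP az.
      move: a0; rewrite /order big1 // => i _; apply/eqP.
      by have := az i; rewrite lt0n negbK.
    by rewrite /monomial (bigD1 i) //= mxE expr0n gtn_eqF // mul0r.
  rewrite subr0; apply: le_trans (monomial_bound _ ht) _.
  rewrite exprMn mulrC; apply: ler_wpM2l; first by rewrite exprn_ge0 // ltW.
  exact: ler_wiXn2l.
rewrite -mulr_suml ler_wpM2r ?exprn_ge0 //; exact: cA (box_uniq N).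
Unshelve. all: by end_near. Qed.

(** If v is orthogonal to the derivatives of g, the series of <v, f> at x has no terms of order 1 to
    l. Then <v, f> varies by O(theta^(l+1)), so all its partial derivatives of order 1 to l vanish
    by [partial_eq0], and v is orthogonal to n independent vectors. *)
Lemma spanning_curve f x l : (forall j, real_analytic_at (fun y => f y 0 j) x) ->
  nondegenerate_at l f x ->
  exists (g : nat -> R -> 'rV[R]_n) (r : R) D,
  [/\ 0 < r, smooth r g, spanning D g &
      forall t, `|t| < r -> g 0%N t = f (x + monomial_curve (@curve_weight d l) t)].
Proof.
move=> /(@analytic_curve _ _ _ _ _ l)[g [r [c [rho [A [[r0 sg] gf gc [rho0 cA] cf]]]]]].
move=> [Cf [s [sl sfree]]].
exists g, r, (l.+1 * (l * (l.+1 ^ d).+1 + 1))%N; split=> // v vP.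
pose C a := \sum_j v 0 j * c j a.
have C0 a : (0 < order a <= l)%N -> C a = 0.
  move=> /andP[a0 al]; have := vP (weight (@curve_weight d l) a).
  rewrite order_gt0_weight // weight_bound // => /(_ isT); rewrite dot_sum.
  under eq_bigr => j _ do rewrite gc // mulrCA.
  rewrite -mulr_sumr => /eqP; rewrite mulf_eq0 => /orP[|/eqP //].
  by rewrite pnatr_eq0 -leqn0 leqNgt fact_gt0.
pose A' := \sum_j `|v 0 j| * A.
have CA s' : uniq s' -> \sum_(a <- s') `|C a| * rho ^+ order a <= A'.
  move=> us; apply: (@le_trans _ _ (\sum_(a <- s') \sum_j `|v 0 j| * (`|c j a| * rho ^+ order a))).
    apply: ler_sum => a _.
    under [leRHS]eq_bigr => j _ do rewrite mulrA -normrM.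
    rewrite -mulr_suml ler_wpM2r ?ler_norm_sum // exprn_ge0 // ltW //.
  rewrite exchange_big; apply: ler_sum => j _.
  by rewrite -mulr_sumr ler_wpM2l // cA.
have CG h : `|h| <= rho ->
    (fun N => \sum_(a <- box N) C a * monomial h a) @ \oo --> dot v (f (x + h)).
  move=> hr; rewrite dot_sum.
  rewrite (_ : (fun N => _) = (fun N => \sum_j v 0 j * \sum_(a <- box N) c j a * monomial h a)).
    by apply: cvg_sumr => j; apply: cvgMr; exact: cf.
  apply/funext => N; under [RHS]eq_bigr do rewrite mulr_sumr.
  rewrite exchange_big; apply: eq_bigr => a _; rewrite mulr_suml.
  by apply: eq_bigr => j _; rewrite mulrA.
have inc := jet_eq0_increment (G := fun y => dot v (f y)) rho0 CA CG C0.
have [e e0 [dG sG]] := scalar_partial_dot v Cf.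
have v0 k : dot v (partial (s k) f x) = 0.
  have /andP[sk0 skl] := sl k; have [cG <-] := sG _ skl.
  apply: (@partial_eq0 _ _ (s k) l _ x e A' rho) => //.
  exact: derivable_uptoW skl dG.
move: sfree; set P := \matrix_(k < n) _ => Pfree.
have : P *m v^T = 0.
  apply/colP => k; rewrite mxE [RHS]mxE; apply: etrans (v0 k).
  by rewrite dotC dot_sum; apply: eq_bigr => j _; rewrite !mxE.
move=> Pv; have PU : P \in unitmx by rewrite -row_free_unit.
by apply: trmx_inj; rewrite trmx0 -[v^T](mulKmx PU) Pv mulmx0.
Qed.

(** Used to keep only the coordinates of nonzero weight. *)
Lemma spanning_coords p (phi : 'I_p -> 'I_n) D (g : nat -> R -> 'rV[R]_n) : injective phi ->
  spanning D g -> spanning D (fun k t => \row_j g k t 0 (phi j)).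
Proof.
move=> phi_inj sg c cP; pose v := \sum_j c 0 j *: delta_mx 0 (phi j) : 'rV[R]_n.
have vphi j : v 0 (phi j) = c 0 j.
  rewrite summxE (bigD1 j) //= !mxE !eqxx mulr1 big1 ?addr0 // => i ij.
  by rewrite !mxE (inj_eq phi_inj) eq_sym (negbTE ij) andbF mulr0.
have dotv u : dot v u = \sum_j c 0 j * u 0 (phi j).
  rewrite dotC /dot /v linear_sum /= mulmx_sumr summxE; apply: eq_bigr => j _.
  rewrite linearZ /= -scalemxAr mxE; congr (_ * _).
  by rewrite -[LHS]/(dot u (delta_mx 0 (phi j))) dot_sum (bigD1 (phi j)) //= !mxE !eqxx mulr1
    big1 ?addr0 // => i ij; rewrite !mxE (negbTE ij) andbF mulr0.
have v0 : v = 0.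
  apply: sg => k kD; rewrite dotv; apply: etrans (cP k kD); rewrite dot_sum.
  by apply: eq_bigr => j _; rewrite mxE.
by apply/rowP => j; rewrite -vphi v0 !mxE.
Qed.

End Nondegenerate.

(** * Lebesgue measure on tuples *)

Section TranslationInvariance.
Context {R : realType}.
Local Notation leb := (@lebesgue_measure R).
Local Notation T d := (d.-tuple (measurableTypeR R)).

Lemma lebesgue_translate (v : R) (A : set (measurableTypeR R)) : measurable A ->
  leb ((fun x => x + v) @^-1` A) = leb A.
Proof.
move=> mA; pose f (x : measurableTypeR R) : measurableTypeR R := x + v.
have mf : measurable_fun setT f by apply: measurable_funD.
apply/esym; rewrite -[RHS]/(pushforward leb f A).
apply: lebesgue_measure_unique => // _ [[a b] /= _ <-].
rewrite /pushforward (_ : f @^-1` _ = `](a - v), (b - v)]%classic).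
  by rewrite !lebesgue_measure_itv /= !lte_fin ltrD2r -!EFinB opprB addrA subrK.
by apply/seteqP; split=> x; rewrite /= !in_itv /= ltrBlDr lerBrDr.
Qed.

Definition translate d (v : 'rV[R]_d) (x : T d) : T d := [tuple (tnth x i : R) + v 0 i | i < d].

Lemma row_translate d (v : 'rV[R]_d) (x : T d) :
  row_of_tuple (translate v x) = row_of_tuple x + v.
Proof. by apply/rowP => i; rewrite !mxE tnth_mktuple. Qed.

Lemma measurable_translate d (v : 'rV[R]_d) : measurable_fun setT (@translate d v).
Proof.
apply/measurable_fun_tnthP => i.
rewrite (_ : _ \o _ = (fun x : T d => (tnth x i : R) + v 0 i)); last first.
  by apply/funext => x; rewrite /= tnth_mktuple.
by apply: measurable_funD => //; exact: measurable_tnth.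
Qed.

Definition cube d (M : R) : set (T d) := [set x | forall i, `|tnth x i : R| <= M].

Lemma measurable_cube d M : measurable (@cube d M).
Proof.
rewrite (_ : cube M = \bigcap_(i in [set: 'I_d]) ((fun x : T d => tnth x i) @^-1` `[- M, M])).
  apply: fin_bigcap_measurable => // i _; rewrite -[X in measurable X]setTI.
  exact: measurable_tnth.
by apply/seteqP; split=> x xM i; [move=> _|]; have := xM i; rewrite /= in_itv /= -ler_norml //; exact.
Qed.

Lemma cube_sigma_finite d (m : {measure set (T d) -> \bar R}) :
  (forall M, m (cube M) < +oo)%E -> sigma_finite setT m.
Proof.
move=> mfin; exists (fun k : nat => cube k%:R) => [|k]; last by split=> //; exact: measurable_cube.
apply/seteqP; split=> // x _; exists (\sum_i Num.truncn `|tnth x i : R|).+1%N => // i /=.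
apply: le_trans (ltW (truncnS_gt _)) _; rewrite ler_nat ltnS.
by rewrite (bigD1 i) //= leq_addr.
Qed.

End TranslationInvariance.

Section SigmaFinite.
Context d (T : measurableType d) (R : realType) (m : {measure set T -> \bar R}).
Hypothesis sf : sigma_finite setT m.

                                                              
(** An alias of m whose argument is the proof that lets it carry the sigma-finite structure needed
    for products and Fubini. *)
Definition with_sigma_finite (_ : sigma_finite setT m) : set T -> \bar R := m.
Local Notation m' := (with_sigma_finite sf).

HB.instance Definition _ := isMeasure.Build _ _ _ m'
  (measure0 m) (measure_ge0 m) (@measure_semi_sigma_additive _ _ _ m).
HB.instance Definition _ := Measure_isSigmaFinite.Build _ _ _ m' sf.

End SigmaFinite.

Section LebesgueTuple.
Context {R : realType}.
Local Notation leb := (@lebesgue_measure R).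
Local Notation T d := (d.-tuple (measurableTypeR R)).

Lemma translate_cons d (v : 'rV[R]_d.+1) (x : measurableTypeR R) (t : T d) :
  translate v (cons_tuple x t) =
  cons_tuple (x + v 0 0 : measurableTypeR R) (translate (\row_i v 0 (lift 0 i)) t).
Proof.
apply: eq_from_tnth => i; rewrite tnth_mktuple; case: (unliftP ord0 i) => [j ->|->].
  by rewrite !tnthS tnth_mktuple mxE.
by rewrite !tnth0.
Qed.

(** The properties are proved together by induction: the product needs sigma-finiteness one
    dimension lower, which follows from finiteness on cubes, and uniqueness of product measures
    gives translation invariance. *)
Lemma lebesgue_tuple_spec d : exists m : {sigma_finite_measure set (T d) -> \bar R},
  [/\ m = @lebesgue_tuple R d :> (set (T d) -> \bar R),
      forall M, (m (cube M) < +oo)%E &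
      forall v A, measurable A -> m (translate v @^-1` A) = m A].
Proof.
elim: d => [|d [m' [m'E m'fin m'tr]]].
  pose m0 : {measure set (T 0) -> \bar R} := \d_[tuple].
  have m0fin M : (m0 (cube M) < +oo)%E by rewrite /m0 /= diracE ltry.
  exists (with_sigma_finite (cube_sigma_finite m0fin)); split=> // v A _.
  rewrite (_ : translate v @^-1` A = A) //.
  by apply/seteqP; split=> x; rewrite /= (tuple0 x) (tuple0 (translate _ _)).
pose P : {measure set (measurableTypeR R * T d)%type -> \bar R} := (leb \x m')%E.
pose c (xt : (measurableTypeR R * T d)%type) : T d.+1 := cons_tuple xt.1 xt.2.
have mc : measurable_fun setT c by apply: measurable_cons.
pose m0f : {measure set (T d.+1) -> \bar R} := pushforward P c.
pose m0 := m0f mc.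
have m0fin M : (m0 (cube M) < +oo)%E.
  rewrite /m0 /= /pushforward (_ : _ @^-1` _ = `[- M, M] `*` cube M).
    rewrite /P /= product_measure1E //; last exact: measurable_cube.
    apply: lte_mul_pinfty; [exact: measure_ge0| |exact: m'fin].
    rewrite (_ : _ \is a fin_num = (leb `[- M, M]%classic \is a fin_num)) //.
    by rewrite lebesgue_measure_itv; case: ifP.
  apply/seteqP; split=> -[x t] /=.
    move=> xM; split=> [|i]; first by have := xM ord0; rewrite tnth0 in_itv /= -ler_norml.
    by have := xM (lift ord0 i); rewrite tnthS.
  rewrite in_itv /= -ler_norml => -[xM tM] i; case: (unliftP ord0 i) => [j ->|->].
    by rewrite tnthS.
  by rewrite tnth0.
exists (with_sigma_finite (cube_sigma_finite m0fin)); split=> //.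
  by rewrite /= -m'E.
move=> v A mA; rewrite /with_sigma_finite /m0 /= /pushforward.
pose tr (xt : (measurableTypeR R * T d)%type) : (measurableTypeR R * T d)%type :=
  (xt.1 + v 0 0 : measurableTypeR R, translate (\row_i v 0 (lift 0 i)) xt.2).
have mtr : measurable_fun setT tr.
  apply: measurable_fun_pair; first by apply: measurable_funD.
  by apply: measurableT_comp => //; exact: measurable_translate.
have Ptr X : measurable X -> P X = pushforward P tr X.
  apply: product_measure_unique => X1 X2 mX1 mX2.
  rewrite /= /pushforward (_ : _ @^-1` _ = ((fun x => x + v 0 0) @^-1` X1) `*`
    (translate (\row_i v 0 (lift 0 i)) @^-1` X2)); last by apply/seteqP; split=> -[x t].
  rewrite /P /= product_measure1E; first last.
  - by rewrite -[X in measurable X]setTI; exact: measurable_translate.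
  - by rewrite -[X in measurable X]setTI; apply: measurable_funD.
  by congr (_ * _)%E; [exact: lebesgue_translate|exact: m'tr].
rewrite [in RHS]Ptr; last by rewrite -[X in measurable X]setTI; exact: (mc _).
rewrite /pushforward; congr (P _); apply/seteqP; split=> -[x t] /=; by rewrite translate_cons.
Qed.

End LebesgueTuple.

(** * From null fibers along translated curves to null sets *)

Section Fibers.
Context {R : realType}.
Local Notation leb := (@lebesgue_measure R).
Local Notation T d := (d.-tuple (measurableTypeR R)).

(** An open set is the union of the countably many rational boxes that it contains. *)
Lemma measurable_open_tuple d (O : set 'rV[R]_d) : open O ->
  measurable ((@row_of_tuple R d) @^-1` O).
Proof.
move=> oO; pose I := (d.-tuple rat * rat)%type.
pose bx (cq : I) : set (T d) := [set x | forall i, `|(tnth x i : R) - ratr (tnth cq.1 i)| < ratr cq.2].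
have mbx cq : measurable (bx cq).
  rewrite (_ : bx cq = \bigcap_(i in [set: 'I_d]) ((fun x : T d => tnth x i) @^-1`
      `]ratr (tnth cq.1 i) - ratr cq.2, ratr (tnth cq.1 i) + ratr cq.2[)).
    apply: fin_bigcap_measurable => // i _; rewrite -[X in measurable X]setTI.
    exact: measurable_tnth.
  by apply/seteqP; split=> x xM i; [move=> _|]; have := xM i;
    rewrite /= in_itv /= -ltr_distl; [|apply].
pose F k : set (T d) := if @unpickle I k is Some cq then bx cq else set0.
rewrite (_ : _ @^-1` O = \bigcup_(k in [set k | F k `<=` (@row_of_tuple R d) @^-1` O]) F k).
  by apply: bigcup_measurable => k _; rewrite /F; case: unpickle.
apply/seteqP; split=> [x /= Ox|x [k /= FO Fx]]; last exact: FO.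
have /nbhs_ballP[e /= e0 eO] := open_nbhs_nbhs (conj oO Ox).
have [q /andP[q0 qe]] : exists q : rat, 0 < (ratr q : R) < e / 2.
  have [q] := @rat_in_itvoo R 0 (e / 2) ltac:(by rewrite divr_gt0).
  by rewrite in_itv /= => qP; exists q.
have /choice[c cP] : forall i : 'I_d, exists c : rat, `|(tnth x i : R) - ratr c| < ratr q.
  move=> i; have [c] := @rat_in_itvoo R ((tnth x i : R) - ratr q) ((tnth x i : R) + ratr q)
    ltac:(by rewrite ltrBlDr -addrA ltrDl addr_gt0).
  by rewrite in_itv /= => cP; exists c; rewrite distrC ltr_distl.
pose cq : I := ([tuple c i | i < d], q).
have Fk : F (pickle cq) = bx cq by rewrite /F pickleK.
exists (pickle cq) => /=; rewrite Fk; last by move=> i; rewrite /= tnth_mktuple.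
move=> z zP; apply: eO; split=> // i j; rewrite !mxE /ball /=.
have := zP j; have := cP j; rewrite /= tnth_mktuple => h1 h2.
apply: le_lt_trans (ler_distD (ratr (c j)) _ _) _.
by rewrite [X in _ + X]distrC; clear -h1 h2 qe; lra.
Qed.

Lemma measurable_closed_tuple d (B : set 'rV[R]_d) : closed B ->
  measurable ((@row_of_tuple R d) @^-1` B).
Proof.
move=> cB; rewrite -[B]setCK preimage_setC; apply: measurableC.
exact: measurable_open_tuple (closed_openC cB).
Qed.

Section FiberNull.
Variables (d : nat) (B : set 'rV[R]_d) (gamma : R -> 'rV[R]_d) (M K : R).
Hypothesis mB : measurable ((@row_of_tuple R d) @^-1` B).
Hypothesis BM : forall x, B x -> forall i, `|x 0 i| <= M.
Hypothesis mgamma : forall i, measurable_fun setT (fun t : measurableTypeR R => gamma t 0 i).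
Hypothesis gammaK : forall t, `|t| < 1 -> forall i, `|gamma t 0 i| <= K.

Definition fiber (r : R) (x : T d) : set (measurableTypeR R) :=
  [set t | `|t : R| < r /\ B (row_of_tuple x + gamma t)].

Let S (xt : T d * measurableTypeR R) : T d := translate (gamma xt.2) xt.1.

Let mS : measurable_fun setT S.
Proof.
apply/measurable_fun_tnthP => i.
rewrite (_ : _ \o _ = (fun xt : (T d * measurableTypeR R)%type =>
    (tnth xt.1 i : R) + gamma xt.2 0 i)); last first.
  by apply/funext => x; rewrite /= tnth_mktuple.
apply: measurable_funD.
  by apply: (@measurableT_comp _ _ _ _ _ _ (fun x : T d => tnth x i)) => //; exact: measurable_tnth.
by apply: (@measurableT_comp _ _ _ _ _ _ (fun t => gamma t 0 i)); [exact: mgamma|exact: measurable_snd].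
Qed.

Let D (r : R) : set (measurableTypeR R) := [set t | `|t : R| < r].

Let DE (r : R) : D r = `]- r, r[%classic.
Proof. by apply/seteqP; split=> t; rewrite /D /= in_itv /= ltr_norml. Qed.

Let mD r : measurable (D r).
Proof. by rewrite DE. Qed.

Let lebD r : 0 < r -> leb (D r) = (r *+ 2)%:E.
Proof.
by move=> r0; rewrite DE lebesgue_measure_itv /= lte_fin gtrN // -EFinB opprK mulr2n.
Qed.

Let E r : set (T d * measurableTypeR R) :=
  (S @^-1` ((@row_of_tuple R d) @^-1` B)) `&` (snd @^-1` D r).

Let mE r : measurable (E r).
Proof.
apply: measurableI; first by rewrite -[X in measurable X]setTI; exact: mS.
by rewrite -[X in measurable X]setTI; exact: measurable_snd.
Qed.

Let xsE r x : xsection (E r) x = fiber r x.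
Proof.
apply/seteqP; split=> t; rewrite /xsection /= inE /E /fiber /D /= row_translate; tauto.
Qed.

Lemma measurable_fiber r x : measurable (fiber r x).
Proof. by rewrite -xsE; exact: measurable_xsection. Qed.

                                                                       
                                                                                
                                                                                
                        
(** By Fubini and translation invariance the measure of [fiber r x] integrates over x to 2 r times
    the measure of B. A fiber has measure at most 2 r, so the set A r of x with a fiber of positive
    measure is at least as large as B. The A r decrease with r and their intersection is null by
    hypothesis. *)
Lemma fiber_null : (\forall x \ae @lebesgue_tuple R d, exists2 r, 0 < r & leb (fiber r x) = 0%E) ->
  @lebesgue_tuple R d ((@row_of_tuple R d) @^-1` B) = 0%E.
Proof.
have [m [<- mfin mtr]] := @lebesgue_tuple_spec R d.
set B' := _ @^-1` B => aeF.
pose phi r x := leb (fiber r x).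
have phiE r : phi r = leb \o xsection (E r) by apply/funext => x; rewrite /phi /= xsE.
have mphi r := measurable_fun_xsection leb (mE r).
have ysE r t : m (ysection (E r) t) = ((cst (m B')) \_ (D r)) t.
  rewrite patchE; case: ifPn => tD.
    rewrite /= -(mtr (gamma t) B' mB); congr (m _); apply/seteqP; split=> x;
      rewrite /ysection /= inE /E /=; first by case.
    by move=> Bx; split=> //; exact: set_mem.
  rewrite (_ : ysection _ _ = set0) ?measure0 //; apply/seteqP; split=> // x.
  rewrite /ysection /= inE /E /= => -[_ tD']; move: tD; rewrite notin_setE; exact.
have intphi r : 0 < r -> (\int[m]_x phi r x = m B' * (r *+ 2)%:E)%E.
  move=> r0; have := @indic_fubini_tonelli _ _ _ _ R m leb _ (mE r).
  rewrite indic_fubini_tonelli_FE // indic_fubini_tonelli_GE // -phiE => ->.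
  rewrite -lebD // -(integral_cst leb (mD r)) [RHS]integral_mkcond.
  by apply: eq_integral => t _; exact: ysE.
pose A r := [set x | (0 < phi r x)%E].
have mA r : measurable (A r).
  have := emeasurable_fun_o_infty measurableT (mphi r) 0%E; by rewrite setTI -phiE.
have BA r : 0 < r -> (m B' <= m (A r))%E.
  move=> r0; have r2 : 0 < r *+ 2 by rewrite pmulrn_lgt0.
  rewrite -(@lee_pmul2r _ (r *+ 2)%:E) //.
  rewrite -intphi // muleC -(integral_cst m (mA r)) integral_mkcond.
  apply: ge0_le_integral => // [||x _].
  - by rewrite phiE; exact: mphi.
  - by apply/(measurable_restrictT _ (mA r)); exact: measurable_cst.
  - rewrite patchE; case: ifPn => xA; last by move: xA; rewrite notin_setE /A /= => /negP; rewrite -leNgt.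
    rewrite -lebD //; apply: le_measure; rewrite ?inE //; first exact: measurable_fiber.
    by move=> t [].
(* As B and gamma are bounded, A 1 lies in a cube; finite measure is needed for continuity from
   above. *)
have A1 : (m (A 1%R) < +oo)%E.
  apply: le_lt_trans (mfin (M + K)); apply: le_measure; rewrite ?inE //.
    exact: measurable_cube.
  move=> x Ax i; have [t [t1 Bt]] : exists t, fiber 1 x t.
    apply/set0P; apply: contraTneq Ax => /= fx0.
    by rewrite /A /= /phi fx0 measure0 ltxx.
  have := BM Bt i; have := gammaK t1 i; rewrite !mxE => h1 h2.
  have := ler_normB ((tnth x i : R) + gamma t 0 i) (gamma t 0 i); rewrite addrK; lra.
pose Ak (k : nat) := A k.+1%:R^-1.
have Amono r r' : r <= r' -> A r `<=` A r'.
  move=> rr x; rewrite /A /= => /lt_le_trans; apply; apply: le_measure; rewrite ?inE;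
    try exact: measurable_fiber.
  by move=> t [tr Bt]; split=> //; exact: lt_le_trans rr.
have mcap : measurable (\bigcap_k Ak k) by apply: bigcap_measurable => // k _; exact: mA.
have cap0 : m (\bigcap_k Ak k) = 0%E.
  apply: measure_negligible => //; apply: negligibleS aeF => x Ax [r r0 fr].
  pose k := Num.truncn r^-1.
  have kr : k.+1%:R^-1 <= r.
    by rewrite -[leRHS]invrK lef_pV2 ?posrE ?invr_gt0 // ltW // truncnS_gt.
  have := Amono _ _ kr x (Ax k I); by rewrite /A /= /phi fr ltxx.
have cvgA : m \o Ak @ \oo --> m (\bigcap_k Ak k).
  apply: nonincreasing_cvg_mu => //.
  - by rewrite /Ak invr1.
  - by move=> k; exact: mA.
  move=> k k' kk; apply/subsetPset; apply: Amono.
  by rewrite lef_pV2 ?posrE // ler_nat ltnS.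
apply/eqP; rewrite eq_le measure_ge0 andbT -cap0 -(cvg_lim _ cvgA) //.
apply: lime_ge; first by apply/cvg_ex; eexists; exact: cvgA.
by apply: nearW => k; apply: BA; rewrite invr_gt0.
Qed.

End FiberNull.
End Fibers.

(** * Covering the bad set by closed sets with uniform constants *)

Section BadCover.
Context {R : realType} {d n : nat}.
Variables (w theta : 'rV[R]_n).
Hypothesis hw : is_weight w.

Lemma dist_int_le (z : R) (p : int) : dist_int z <= `|z - p%:~R|.
Proof. by apply: ge_inf; [exists 0 => _ [m _ <-]|exists p]. Qed.

Lemma dist_int_ge0 (z : R) : 0 <= dist_int z.
Proof. by apply: lb_le_inf => [|_ [m _ <-] //]; exists `|z - 0%:~R|; exists 0. Qed.

Lemma weight_le1 i : w 0 i <= 1.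
Proof.
have [w0 <-] := hw; rewrite (bigD1 i) //= lerDl; apply: sumr_ge0 => j _; exact: w0.
Qed.

(** A positive maximum must come from a coordinate of nonzero weight. Taking eps <= 1 gives eps <=
    eps^(w i), so the exponent can be moved from the distance to q. *)
Lemma Bad_bound (y : 'rV[R]_n) : Bad theta w y -> exists (eps : R) (N : nat), 0 < eps /\
  forall q : int, N.+1%:R <= (q%:~R : R) -> exists2 i, w 0 i != 0 & forall p : int,
    eps / q%:~R `^ w 0 i <= `|q%:~R * y 0 i - theta 0 i - p%:~R|.
Proof.
rewrite /Bad /= /liminf_absz => /ereal_sup_gt[_ [N _ <-]].
set c := ereal_inf _ => c0.
have [e /andP[e0 e1] ec] : exists2 e : R, 0 < e <= 1 & (e%:E <= c)%E.
  case: c c0 => [r| |] // c0; last by exists 1; rewrite ?ltr01 ?lexx ?leey.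
  exists (Num.min r 1); last by rewrite lee_fin ge_min lexx.
  by rewrite lt_min ltr01 andbT ge_min lexx orbT andbT -lte_fin.
exists e, N; split=> // q Nq; set Q : R := q%:~R.
have Q0 : 0 < Q by apply: lt_le_trans Nq; rewrite ltr0n.
have q0 : (0 < q)%R by rewrite -(ltr0z R).
have qN : q != 0 /\ (N <= `|q|)%N.
  split; first by rewrite gt_eqF.
  rewrite -(ler_nat R) natr_absz gtr0_norm //; apply: le_trans Nq; by rewrite ler_nat.
have := le_trans ec (ereal_inf_lbound (imageP _ qN)).
rewrite lee_fin gtr0_norm // -ler_pdivrMr // => bigmax_ge.
have eQ : 0 < e / Q by rewrite divr_gt0.
have [i wi] : exists i, e / Q <= weighted_dist w theta y q i.
  apply/existsP; apply: contraT; rewrite negb_exists => /forallP lt.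
  move: bigmax_ge; rewrite leNgt bigmax_lt // => i _.
  by have := lt i; rewrite -ltNge.
move: wi; rewrite /weighted_dist; case: ifPn => [_|wi0 wi]; first by rewrite leNgt eQ.
have wi_gt0 : 0 < w 0 i by rewrite lt0r wi0 hw.1.
exists i => // p; apply: le_trans (dist_int_le _ p).
rewrite ler_pdivrMr ?powR_gt0 //.
have le1 : e <= e `^ w 0 i.
  by rewrite -[leLHS]powRr1 ?(ltW e0) //; apply: ger_powR; [rewrite e0|exact: weight_le1].
apply: le_trans le1 _.
have Qn : Q != 0 by rewrite gt_eqF.
rewrite -[X in X `^ _](divfK Qn e).
rewrite powRM ?(ltW eQ) ?(ltW Q0) //; apply: ler_wpM2r; first exact: powR_ge0.
have -> : dist_int (Q * y 0 i - theta 0 i) =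
    (dist_int (Q * y 0 i - theta 0 i) `^ (w 0 i)^-1) `^ w 0 i.
  by rewrite -powRrM mulVf // powRr1 // dist_int_ge0.
by apply: ge0_ler_powR; rewrite ?nnegrE ?powR_ge0 // ltW.
Qed.

Variables (U : set 'rV[R]_d) (f : 'rV[R]_d -> 'rV[R]_n).
Hypothesis oU : open U.

(** Distance at least 1 / (k + 1) to the complement of U keeps limit points inside U, so that the
    set is closed in the whole space; boundedness is required by [fiber_null]. *)
Definition uniformly_bad (k : nat) : set 'rV[R]_d :=
  [set x | [/\ forall z, ~ U z -> k.+1%:R^-1 <= `|z - x|, `|x| <= k%:R &
    forall q : int, k.+1%:R <= (q%:~R : R) -> exists2 i, w 0 i != 0 & forall p : int,
      k.+1%:R^-1 / q%:~R `^ w 0 i <= `|q%:~R * f x 0 i - theta 0 i - p%:~R|]].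

Lemma uniformly_bad_sub k : uniformly_bad k `<=` U.
Proof.
move=> x [xU _ _]; apply: contrapT => /xU; rewrite subrr normr0.
by rewrite leNgt invr_gt0 ltr0n.
Qed.

Lemma Bad_cover x : U x -> Bad theta w (f x) -> exists k, uniformly_bad k x.
Proof.
move=> Ux /Bad_bound[eps [N [eps0 xb]]].
have /nbhs_ballP[e /= e0 eU] := open_nbhs_nbhs (conj oU Ux).
pose T (z : R) := Num.truncn z.
have [k [ke keps kx kN]] : exists k, [/\ (T e^-1 <= k)%N, (T eps^-1 <= k)%N,
    (T `|x|%R < k)%N & (N <= k)%N].
  move: (T e^-1) (T eps^-1) (T `|x|%R) => a b c; exists (a + b + c.+1 + N)%N; split; lia.
have inv_le (z : R) : 0 < z -> (T z^-1 <= k)%N -> k.+1%:R^-1 <= z.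
  move=> z0 zk; rewrite -[leRHS]invrK lef_pV2 ?posrE ?invr_gt0 //.
  by apply: le_trans (ltW (truncnS_gt _)) _; rewrite ler_nat ltnS.
exists k; split.
- move=> z nUz; rewrite leNgt; apply/negP => zx; apply: nUz; apply: eU.
  rewrite -ball_normE /= distrC; apply: lt_le_trans zx _; exact: inv_le.
- by apply: le_trans (ltW (truncnS_gt _)) _; rewrite ler_nat.
- move=> q kq; have [|i wi ip] := xb q.
    by apply: le_trans kq; rewrite ler_nat ltnS.
  exists i => // p; apply: le_trans (ip p); apply: ler_wpM2r.
    by rewrite invr_ge0 powR_ge0.
  exact: inv_le.
Qed.

Hypothesis fcont : forall x, U x -> forall i (e : R), 0 < e ->
  \forall y \near x, `|f y 0 i - f x 0 i| < e.

(** If the last condition fails at x for some q, every coordinate of nonzero weight violates it by a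
    strict inequality, which persists near x by continuity. *)
Lemma closed_uniformly_bad k : closed (uniformly_bad k).
Proof.
move=> x clx.
have near_pt (e : R) (A : set 'rV[R]_d) : 0 < e -> nbhs x A ->
    exists y, [/\ uniformly_bad k y, `|x - y| < e & A y].
  move=> e0 Ax; have /clx[y [yb [/= xy Ay]]] : nbhs x (ball x e `&` A).
    by apply: filterI => //; exact: nbhsx_ballx.
  by exists y; rewrite -ball_normE in xy.
have xU z : ~ U z -> k.+1%:R^-1 <= `|z - x|.
  move=> nUz; rewrite leNgt; apply/negP => zx.
  have [y [[yU _ _] xy _]] := near_pt (k.+1%:R^-1 - `|z - x|) setT
    ltac:(by rewrite subr_gt0) filterT.
  have := yU z nUz; rewrite leNgt; case/negP.
  by apply: le_lt_trans (ler_distD x _ _) _; rewrite -ltrBrDl.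
have Ux : U x.
  apply: contrapT => /xU; rewrite subrr normr0; by rewrite leNgt invr_gt0 ltr0n.
split=> //.
  rewrite leNgt; apply/negP => xk.
  have [y [[_ yk _] xy _]] := near_pt (`|x| - k%:R) setT ltac:(by rewrite subr_gt0) filterT.
  have := ler_normD (x - y) y; rewrite subrK => h.
  by move: (le_lt_trans h (ltr_leD xy yk)); rewrite subrK ltxx.
move=> q kq; set Q : R := q%:~R.
have Q0 : 0 < Q by apply: lt_le_trans kq; rewrite ltr0n.
apply: contrapT => xq.
have : \forall y \near x, forall i, w 0 i != 0 -> exists p : int,
    `|Q * f y 0 i - theta 0 i - p%:~R| < k.+1%:R^-1 / Q `^ w 0 i.
  apply: (@filter_forall _ _ _ (nbhs x) (nbhs_filter x)) => i.
  have [wi|wi] := eqVneq (w 0 i) 0; first by apply: nearW.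
  have [p ip] : exists p : int, `|Q * f x 0 i - theta 0 i - p%:~R| < k.+1%:R^-1 / Q `^ w 0 i.
    apply: contrapT => np; apply: xq; exists i => // p; rewrite leNgt; apply/negP => lt.
    by apply: np; exists p.
  set c := k.+1%:R^-1 / _ in ip *; set A := `|_| in ip.
  have cA : 0 < (c - A) / Q by rewrite divr_gt0 // subr_gt0.
  apply: filterS (fcont Ux i cA) => y yx _; exists p.
  have -> : Q * f y 0 i - theta 0 i - p%:~R =
      (Q * f x 0 i - theta 0 i - p%:~R) + Q * (f y 0 i - f x 0 i) by ring.
  apply: le_lt_trans (ler_normD _ _) _; rewrite -/A -ltrBrDl normrM (gtr0_norm Q0).
  by rewrite mulrC -ltr_pdivlMr.
move=> /(near_pt 1 _ ltr01)[y [[_ _ /(_ q kq)[i wi ip]] _ /(_ i wi)[p pi]]].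
by have := ip p; rewrite leNgt pi.
Qed.

End BadCover.

(** * Conclusion for analytic nondegenerate maps *)

Section AnalyticNull.
Context {R : realType} {d n : nat}.
Local Notation leb := (@lebesgue_measure R).
Local Notation T := (d.-tuple (measurableTypeR R)).
Variables (w theta : 'rV[R]_n) (U : set 'rV[R]_d) (f : 'rV[R]_d -> 'rV[R]_n).
Hypothesis hw : is_weight w.
Hypothesis oU : open U.
Hypothesis fan : real_analytic U f.

Lemma analytic_continuous x : U x -> forall i (e : R), 0 < e ->
  \forall y \near x, `|f y 0 i - f x 0 i| < e.
Proof.
move=> Ux i e e0; have [c [rho [A [rho0 cA cf]]]] := analytic_expansion (fan Ux).
(* Used with l = 0, where there is no coefficient to kill and the bound is a Lipschitz estimate at
   x. *)
have inc := @jet_eq0_increment _ _ (c i) rho A (fun y => f y 0 i) x 0 rho0 (cA i) (cf i).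
have {}inc : forall tau h, 0 <= tau <= 1 -> `|h| <= tau * rho ->
    `|f (x + h) 0 i - f x 0 i| <= A * tau.
  move=> tau h t01 ht; have := inc _ tau h t01 ht; rewrite expr1; apply.
  by move=> a /andP[a0]; rewrite leqn0 => /eqP aE; rewrite aE in a0.
have A0 : 0 <= A by have := cA i [::] isT; rewrite big_nil.
pose tau := Num.min 1 (e / (2 * (A + 1))).
have A1 : 0 < 2 * (A + 1) by lra.
have tau0 : 0 < tau by rewrite lt_min ltr01 divr_gt0.
have tauE : A * tau < e.
  apply: (@le_lt_trans _ _ (A * (e / (2 * (A + 1))))).
    by apply: ler_wpM2l => //; rewrite ge_min lexx orbT.
  rewrite mulrA ltr_pdivrMr // [A * e]mulrC ltr_pM2l //; lra.
have : \forall y \near x, ball x (tau * rho) y.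
  by apply: nbhsx_ballx; rewrite mulr_gt0.
apply: filterS => y; rewrite -ball_normE /= distrC => yx.
have := inc tau (y - x) _ (ltW yx); rewrite (ltW tau0) ge_min lexx /= => /(_ isT).
by rewrite (addrC x) subrK => h; exact: le_lt_trans tauE.
Qed.

Let gamma l := @monomial_curve R d (@curve_weight d l).

Lemma measurable_monomial_curve l i :
  measurable_fun setT (fun t : measurableTypeR R => gamma l t 0 i).
Proof.
rewrite (_ : (fun t => _) = (fun t : measurableTypeR R => (t : R) ^+ curve_weight l i)).
  exact: exprn_measurable.
by apply/funext => t; rewrite /gamma mxE.
Qed.

Let Bk := uniformly_bad w theta U f.

Let closed_Bk k : closed (Bk k).
Proof. exact: closed_uniformly_bad analytic_continuous _. Qed.

Let mBk k : measurable ((@row_of_tuple R d) @^-1` Bk k).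
Proof. exact: measurable_closed_tuple. Qed.

Lemma monomial_curve_norm l (t : R) : `|t| < 1 -> `|gamma l t| <= `|t|.
Proof.
move=> t1; apply: monomial_curve_bound; first by move=> i; exact: curve_weight_gt0.
by rewrite le_min lexx (ltW t1).
Qed.

(** The fiber is the set of bad parameters of a spanning curve, and restricting to the coordinates
    of nonzero weight brings it under [curve_null]. *)
Lemma fiber_eq0 k l (x : T) : Bk k (row_of_tuple x) -> nondegenerate_at l f (row_of_tuple x) ->
  exists2 r, 0 < r & leb (fiber (Bk k) (gamma l) r x) = 0%E.
Proof.
move=> Bx ndx; have Ux := uniformly_bad_sub Bx.
have [g [r [D [r0 sg spg gf]]]] := spanning_curve (fan Ux) ndx.
pose S := [pred i | w 0 i != 0]; pose phi (j : 'I_#|S|) := enum_val j.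
have phi_inj : injective phi by exact: enum_val_inj.
have phiS j : w 0 (phi j) != 0 by have := enum_valP j.
pose g' k t : 'rV[R]_#|S| := \row_j g k t 0 (phi j).
have sg' : smooth r g'.
  move=> m j t tr; rewrite mxE (_ : (fun t => _) = (fun t => g m t 0 (phi j))).
    exact: sg.
  by apply/funext => u; rewrite mxE.
have mF := @measurable_fiber R d (Bk k) (gamma l) (mBk k) (@measurable_monomial_curve l).
have k0 : 0 < k.+1%:R^-1 :> R by rewrite invr_gt0.
have [r1 r10 nF] : exists2 r1, 0 < r1 & leb.-negligible (fiber (Bk k) (gamma l) r x `&` ball 0 r1).
  apply: (@curve_null R #|S| D r g' (\row_j w 0 (phi j)) (\row_j theta 0 (phi j))
    k.+1%:R^-1 k.+1%:R) => //.
  - exact: spanning_coords.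
  - exact: mF.
  - by move=> j; rewrite mxE lt0r phiS hw.1.
  - under eq_bigr do rewrite mxE.
    rewrite -(big_enum_val (A := S) (fun i => w 0 i)) -[RHS]hw.2 [RHS](bigID S) /=.
    by rewrite [X in _ = _ + X]big1 ?addr0 // => i; rewrite negbK => /eqP.
  - move=> t [tr [_ _ Bt]] q kq; have [i wi ip] := Bt q kq.
    have iS : i \in S by [].
    exists (enum_rank_in iS i) => p; rewrite !mxE /phi enum_rankK_in // gf //.
exists (Num.min r r1); first by rewrite lt_min r0.
apply: measure_negligible; first exact: mF.
apply: negligibleS nF => t [+ Bt]; rewrite lt_min => /andP[tr tr1]; split=> //.
by rewrite /ball /= sub0r normrN.
Qed.

Lemma fiber_eq0_out k l (x : T) : ~ Bk k (row_of_tuple x) ->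
  exists2 r, 0 < r & leb (fiber (Bk k) (gamma l) r x) = 0%E.
Proof.
move=> nBx; have /nbhs_ballP[e /= e0 eP] : nbhs (row_of_tuple x) (~` Bk k).
  by apply: open_nbhs_nbhs; split=> //; exact: closed_openC.
exists (Num.min e 1); first by rewrite lt_min e0 ltr01.
rewrite (_ : fiber _ _ _ _ = set0) ?measure0 //; apply/seteqP; split=> // t [+ Bt].
rewrite lt_min => /andP[te t1]; apply: (eP _ _ Bt).
rewrite -ball_normE /= opprD addrA subrr sub0r normrN.
exact: le_lt_trans (monomial_curve_norm l t1) te.
Qed.

(** Each closed piece is null by [fiber_null]: its nondegenerate points have null fibers by
    [fiber_eq0], and a point outside it has an empty fiber for small r because the piece is
    closed. *)
Lemma ae_not_Bad : Defs.nondegenerate U f -> ae_in U (fun x => ~ Bad theta w (f x)).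
Proof.
move=> [l ndf]; have [m [mE _ _]] := @lebesgue_tuple_spec R d.
move: ndf; rewrite /ae_in -mE => ndf.
have Bk0 k : @lebesgue_tuple R d ((@row_of_tuple R d) @^-1` Bk k) = 0%E.
  apply: (@fiber_null R d (Bk k) (gamma l) k%:R 1 (mBk k)).
  - by move=> x [_ xk _] i; apply: le_trans xk; exact: mx_norm_coord.
  - exact: measurable_monomial_curve.
  - move=> t t1 i; apply: le_trans (mx_norm_coord _ _) _.
    exact: le_trans (monomial_curve_norm l t1) (ltW t1).
  rewrite -mE; apply: negligibleS ndf => x /= nfib Ux_nd; apply: nfib.
  have [Bx|nBx] := pselect (Bk k (row_of_tuple x)); last exact: fiber_eq0_out.
  by apply: fiber_eq0 => //; apply: Ux_nd; exact: uniformly_bad_sub Bx.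
apply: (@negligibleS _ _ _ _ (\bigcup_k ((@row_of_tuple R d) @^-1` Bk k))).
  move=> x /= nbad; have [Ux Bx] : U (row_of_tuple x) /\ Bad theta w (f (row_of_tuple x)).
    by split; apply: contrapT => h; apply: nbad.
  have [k Bkx] := Bad_cover hw oU Ux Bx; by exists k.
apply: negligible_bigcup => k; exists ((@row_of_tuple R d) @^-1` Bk k).
by split=> //; have := Bk0 k; rewrite -mE.
Qed.

End AnalyticNull.

Theorem corollary1p2 (R : realType) (n d : nat) (w theta : 'rV[R]_n)
    (M : set 'rV[R]_n)
    (hw : is_weight w)
    (hM : nondegenerate_analytic_manifold d M) :
  almost_every_point d M (fun p => ~ Bad theta w p).
Proof.
by move=> U f [oU _ fan fnd]; exact: ae_not_Bad.
Qed.
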